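(* Let $\{\mu_n\}_{n>0}$ be a sequence of probability measures on $\mathbb{R}$, each with mean $0$ and variance $1$, and each infinitely divisible with respect to free additive convolution $\boxplus$. Let $X_n$ be a random variable with distribution $\mu_n$. If $E[X_n^4]=\int_{\mathbb{R}}x^4\,\mu_n(dx)\to 2$ as $n\to\infty$, then $\mu_n$ converges weakly to the standard semicircle distribution $\mathcal{S}(0,1)$.
   Context: The standard semicircle distribution $\mathcal{S}(0,1)$ has density $\frac{1}{2\pi}\sqrt{4-x^2}$ on $[-2,2]$. For a probability measure $\mu$ on $\mathbb{R}$, let $G_\mu(z)=\int_{\mathbb{R}}\frac{\mu(dx)}{z-x}$ ($z\in\mathbb{C}^+$, the open upper half-plane) be its Cauchy transform and $F_\mu=1/G_\mu$. There are $\eta,M>0$ such that $F_\mu$ has a right inverse $F_\mu^{-1}$ (with $F_\mu^{-1}(z)/z\to1$ as $|z|\to\infty$) defined on $\Gamma_{\eta,M}=\{z\in\mathbb{C}^+: |\mathrm{Re}\,z|<\eta\,\mathrm{Im}\,z,\ |z|>M\}$; the Voiculescu transform is $\phi_\mu(z)=F_\mu^{-1}(z)-z$ there. The free additive convolution $\mu_1\boxplus\mu_2$ is the unique probability measure on $\mathbb{R}$ with $\phi_{\mu_1\boxplus\mu_2}=\phi_{\mu_1}+\phi_{\mu_2}$ on a common domain of the form $\Gamma_{\eta,M}$. A probability measure $\mu$ is $\boxplus$-infinitely divisible, written $\mu\in ID(\boxplus)$, if for every $N\in\mathbb{N}$ there is a probability measure $\nu_N$ on $\mathbb{R}$ with $\mu=\nu_N^{\boxplus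 N}$ ($N$-fold $\boxplus$-convolution power). *)

(* Defs.v *)
From HB Require Import structures.
From mathcomp Require Import all_boot all_order all_algebra.
From mathcomp Require Import all_classical all_reals all_analysis.
From mathcomp Require Import measurable_realfun complex.
From mathcomp Require Import ring lra.

Set Implicit Arguments.
Unset Strict Implicit.
Unset Printing Implicit Defensive.

Import Order.TTheory GRing.Theory Num.Theory.
Import numFieldNormedType.Exports.

Local Open Scope classical_set_scope.
Local Open Scope ring_scope.
Local Open Scope complex_scope.

Section semicircle.
Variable R : realType.
Notation leb := (@lebesgue_measure R).

(* Num.sqrt is 0 on negative numbers, so this density vanishes off [-2, 2]    *)
(* (semicircle_pdf_eq0).                                                      *)
Definition semicircle_pdf (x : R) : R := (2 * pi)^-1 * Num.sqrt (4 - x ^+ 2).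

Definition semicircle : set (measurableTypeR R) -> \bar R :=
  fun A => (\int[leb]_(x in A) (semicircle_pdf x)%:E)%E.

Lemma semicircle_pdf_ge0 x : 0 <= semicircle_pdf x.
Proof. by rewrite mulr_ge0 ?sqrtr_ge0// invr_ge0 mulr_ge0// pi_ge0. Qed.

Lemma continuous_semicircle_pdf : continuous semicircle_pdf.
Proof.
move=> x; apply: cvgM; first exact: cvg_cst.
apply: (@continuous_comp _ _ _ (fun y : R => 4 - y ^+ 2) Num.sqrt); last first.
  exact: sqrt_continuous.
apply: cvgB; first exact: cvg_cst.
exact: exprn_continuous.
Qed.

Lemma measurable_semicircle_pdf : measurable_fun [set: R] semicircle_pdf.
Proof. exact: continuous_measurable_fun continuous_semicircle_pdf. Qed.

Lemma semicircle_pdf_eq0 x : x \notin `[-2, 2] -> semicircle_pdf x = 0.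
Proof.
move=> x2; rewrite /semicircle_pdf ler0_sqrtr ?mulr0//.
rewrite leNgt; apply: contra x2; rewrite subr_gt0 in_itv/= => x2.
apply/andP; split; nra.
Qed.

Let is_derive_2sin (t : R) :
  is_derive t (1 : R) (fun t => 2 * sin t : R) (2 * cos t).
Proof. by apply: is_derive_eq; rewrite /GRing.scale/=; lra. Qed.

Let integral_cos2 :
  (\int[leb]_(x in `[(- (pi / 2))%R, (pi / 2)%R]) (4 * cos x ^+ 2)%:E
   = (2 * pi)%:E)%E.
Proof.
pose F (t : R) := 2 * t + 2 * (sin t * cos t).
have dF (t : R) : is_derive t 1 F (4 * cos t ^+ 2).
  rewrite /F; apply: is_derive_eq.
  rewrite /GRing.scale/=.
  by have := cos2Dsin2 t; lra.
have cF t : {for t, continuous F}.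
  by apply: differentiable_continuous; apply/derivable1_diffP.
have pi0 := @pi_gt0 R.
rewrite (@continuous_FTC2 _ _ F); first last.
- by move=> t _; rewrite derive1E; exact: derive_val.
- split=> [t _ //||].
  + exact/cvg_at_right_filter/cF.
  + exact/cvg_at_left_filter/cF.
- apply: continuous_subspaceT => t; apply: cvgM; first exact: cvg_cst.
  apply: (@continuous_comp _ _ _ cos (fun x : R => x ^+ 2)).
    exact: continuous_cos.
  exact: exprn_continuous.
- lra.
rewrite /F sinN cosN cos_pihalf -EFinB; congr EFin; lra.
Qed.

Lemma integral_semicircle_pdf :
  (\int[leb]_x (semicircle_pdf x)%:E = 1)%E.
Proof.
have pi0 := @pi_gt0 R.
have -> : (\int[leb]_x (semicircle_pdf x)%:E =
   \int[leb]_(x in `[(-2)%R, 2%R]) (semicircle_pdf x)%:E)%E.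
  rewrite [RHS]integral_mkcond; apply: eq_integral => x _.
  rewrite patchE; case: ifPn => // x2.
  rewrite semicircle_pdf_eq0//; apply: contra x2 => x2.
  by rewrite inE.
have F1 : 2 * sin (- (pi / 2)) = -2 :> R by rewrite sinN sin_pihalf mulrN1.
have F2 : 2 * sin (pi / 2) = 2 :> R by rewrite sin_pihalf mulr1.
pose F (t : R) := 2 * sin t : R.
have d1F : F^`()%classic = (fun t => 2 * cos t).
  by apply/funext => t; rewrite derive1E;
  exact: (@derive_val _ _ _ _ _ _ _ (is_derive_2sin t)).
have cdF : continuous F^`()%classic.
  by rewrite d1F => t; apply: cvgM; [exact: cvg_cst|exact: continuous_cos].
have cF t : {for t, continuous F}.
  by apply: differentiable_continuous; apply/derivable1_diffP.
rewrite (_ : `[(-2)%R, 2%R]%classic = `[F (- (pi / 2)), F (pi / 2)]%classic);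
  last by rewrite /F F1 F2.
rewrite (@integration_by_substitution_increasing _ F semicircle_pdf);
  first last.
- exact/continuous_subspaceT/continuous_semicircle_pdf.
- split=> [t _||].
  + exact: (@ex_derive _ _ _ _ _ _ _ (is_derive_2sin t)).
  + exact/cvg_at_right_filter/cF.
  + exact/cvg_at_left_filter/cF.
- by apply: cvgP; apply/cvg_at_left_filter/cdF.
- by apply: cvgP; apply/cvg_at_right_filter/cdF.
- by move=> t _; exact: cdF.
- by move=> x y xI yI xy; rewrite /F ltr_pM2l// ltr_sin.
- lra.
transitivity (\int[leb]_(x in `[(- (pi / 2))%R, (pi / 2)%R])
    ((2 * pi)^-1%:E * (4 * cos x ^+ 2)%:E))%E.
  apply: eq_integral => t; rewrite inE/= => tI.
  rewrite d1F -EFinM.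
  transitivity
    ((2 * pi)^-1 * Num.sqrt (4 - (2 * sin t) ^+ 2) * (2 * cos t))%:E => //.
  rewrite -[in LHS]mulrA; congr (_ * _)%:E.
  have -> : 4 - (2 * sin t) ^+ 2 = (2 * cos t) ^+ 2.
    by have := cos2Dsin2 t; rewrite !exprMn; lra.
  rewrite sqrtr_sqr ger0_norm; first by ring.
  by rewrite mulr_ge0// cos_ge0_pihalf//; move: tI; rewrite in_itv.
rewrite ge0_integralZl//=.
- by rewrite integral_cos2 -EFinM mulVf// mulf_neq0// gt_eqF.
- apply/measurable_EFinP; apply: measurable_funTS.
  apply: continuous_measurable_fun => t.
  apply: cvgM; first exact: cvg_cst.
  apply: (@continuous_comp _ _ _ cos (fun x : R => x ^+ 2)).
    exact: continuous_cos.
  exact: exprn_continuous.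
- by move=> t _; rewrite lee_fin mulr_ge0// sqr_ge0.
- by rewrite lee_fin invr_ge0 mulr_ge0// ltW.
Qed.

Lemma integrable_semicircle_pdf :
  leb.-integrable [set: R] (EFin \o semicircle_pdf).
Proof.
apply/integrableP; split.
  by apply/measurable_EFinP; exact: measurable_semicircle_pdf.
under eq_integral do rewrite /= ger0_norm ?semicircle_pdf_ge0//.
by rewrite integral_semicircle_pdf ltry.
Qed.

Let semicircle0 : semicircle set0 = 0%E.
Proof. by rewrite /semicircle integral_set0. Qed.

Let semicircle_ge0 A : (0 <= semicircle A)%E.
Proof. by apply: integral_ge0 => x _; rewrite lee_fin semicircle_pdf_ge0. Qed.

Let semicircle_sigma_additive : semi_sigma_additive semicircle.
Proof.
move=> /= A mA tA mUA.
rewrite /semicircle integral_bigcup//=; last first.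
  exact: (integrableS _ _ (@subsetT _ _) integrable_semicircle_pdf).
apply: is_cvg_ereal_nneg_natsum_cond => n _ _.
by apply: integral_ge0 => x _; rewrite lee_fin semicircle_pdf_ge0.
Qed.

HB.instance Definition _ := isMeasure.Build _ _ _
  semicircle semicircle0 semicircle_ge0 semicircle_sigma_additive.

Let semicircle_setT : semicircle [set: _] = 1%E.
Proof. exact: integral_semicircle_pdf. Qed.

HB.instance Definition _ :=
  @Measure_isProbability.Build _ _ R semicircle semicircle_setT.

End semicircle.
Arguments semicircle R A : clear implicits.

Section free_convolution.
Variable R : realType.
Notation prob := (probability (measurableTypeR R) R).
Implicit Types (mu nu rho : prob) (eta M : R) (z : R[i]).

Definition upper_half_plane : set R[i] := [set z | 0 < complex.Im z].

Definition cauchy_transform mu z : R[i] :=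
  (\int[mu]_x complex.Re (z - x%:C)^-1) +i*
  (\int[mu]_x complex.Im (z - x%:C)^-1).

Definition F_transform mu z : R[i] := (cauchy_transform mu z)^-1.

Definition truncated_cone eta M : set R[i] :=
  [set z | [/\ upper_half_plane z, `|complex.Re z| < eta * complex.Im z &
               M%:C < `|z|]].

(* The limit at infinity is taken inside the truncated cone. It determines    *)
(* H z uniquely for large |z|, since F_mu is univalent far out in the cone.   *)
Definition is_F_inverse mu eta M (H : R[i] -> R[i]) : Prop :=
  [/\ forall z, truncated_cone eta M z -> upper_half_plane (H z),
      forall z, truncated_cone eta M z -> F_transform mu (H z) = z &
      forall e : R, 0 < e -> exists K : R, forall z,
        truncated_cone eta M z -> K%:C < `|z| -> `|H z / z - 1| < e%:C].

Definition is_voiculescu_transform mu eta M (phi : R[i] -> R[i]) : Prop :=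
  exists2 H, is_F_inverse mu eta M H &
    forall z, truncated_cone eta M z -> phi z = H z - z.

(* Graph of the operation: [is_free_convolution mu1 mu2 mu] means that mu is  *)
(* the free additive convolution of mu1 and mu2. The cone is existentially    *)
(* quantified because the transforms of different measures need not share a   *)
(* domain.                                                                    *)
Definition is_free_convolution mu1 mu2 mu : Prop :=
  exists eta M phi1 phi2 phi,
    [/\ 0 < eta, 0 < M,
        is_voiculescu_transform mu1 eta M phi1,
        is_voiculescu_transform mu2 eta M phi2 &
        is_voiculescu_transform mu eta M phi /\
        forall z, truncated_cone eta M z -> phi z = phi1 z + phi2 z].

(* Measures are compared on measurable sets only: the underlying set          *)
(* functions are unconstrained elsewhere.                                     *)
Inductive is_free_power nu : nat -> prob -> Prop :=
| free_power1 mu : (forall A, measurable A -> mu A = nu A) ->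
    is_free_power nu 1 mu
| free_powerS n rho mu : is_free_power nu n rho ->
    is_free_convolution rho nu mu -> is_free_power nu n.+1 mu.

Definition free_infinitely_divisible mu : Prop :=
  forall N : nat, (0 < N)%N -> exists nu, is_free_power nu N mu.

Definition cvg_weakly (mu_ : nat -> prob) mu : Prop :=
  forall f : R -> R, continuous f -> [bounded f x | x in [set: R]] ->
    \int[mu_ n]_x f x @[n --> \oo] --> \int[mu]_x f x.

End free_convolution.

(* Main.v *)
Require Import Defs.
From mathcomp Require Import all_boot all_order all_algebra.
From mathcomp Require Import all_classical all_reals all_analysis.
From mathcomp Require Import measurable_realfun complex.
From mathcomp Require Import ring lra.

Set Implicit Arguments.
Unset Strict Implicit.
Unset Printing Implicit Defensive.

Import Order.TTheory GRing.Theory Num.Theory.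
Import numFieldNormedType.Exports.
Import ComplexField.Normc.

Local Open Scope classical_set_scope.
Local Open Scope ring_scope.
Local Open Scope complex_scope.

(** Write G and F = 1 / G for the Cauchy transform of mu and its reciprocal,
    and phi for its Voiculescu transform, so that w - F w = phi (F w). The free
    fourth cumulant of a centred measure with variance 1 is m4 - 2, where m4 is
    the fourth moment. The semicircle distribution is the one with
    phi v = 1 / v, that is, with F (w - F) = 1. If mu is freely infinitely
    divisible then phi v is the integral of sigma (dx) / (v - x) for a
    probability measure sigma with second moment m4 - 2, and Cauchy-Schwarz
    bounds v phi v - 1, the integral of x sigma (dx) / (v - x), by the square
    root of m4 - 2. So the hypothesis forces the semicircle equation in the
    limit.

    The proof follows this idea on the imaginary axis and replaces sigma by the
    kernel that it would define.

    - Let nu be an N-th free convolution root of mu. Far out, right inverses of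
      F_mu that are asymptotic to the identity are unique
      ([voiculescu_unique]), so phi_mu is N times phi_nu there. This says that
      G_nu composed with Phi = w / N + (1 - 1 / N) F_mu is G_mu
      ([subordination_far]). Phi maps the upper half-plane to itself, so both
      sides are analytic on the whole imaginary axis and agree there
      ([subordination_everywhere]). Analyticity is expressed by iterated
      difference quotients with geometric bounds, a class that is visibly
      closed under reciprocals and under integration of resolvents.

    - The functions x |-> F_nu (w) / (w - x) - 1 with w = Phi (i y) are bounded,
      and by the resolvent identity their inner products in L^2 of nu are
      (conj (phi v') - phi v) / (N (w - conj w')). As N grows, w tends to
      v = F_mu (i y), and the Cauchy-Schwarz inequality passes to the Pick
      kernel of - phi_mu ([pick_inequality]). It is applied to
      one fixed height y and to the combination of heights s and 2 s that
      isolates the function x when s tends to infinity. There only the behaviour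
      of F_mu (i s) to the order of the fourth moment matters, and the limit is
      |1 - phi v v|^2 <= |m4 - 2| with v = F_mu (i y)
      ([semicircle_equation_error]).

    - Since Im F_mu (i y) >= y, the residual picks out one root of the quadratic
      equation, hence G_(mu n) (i y) converges to ((y - sqrt (y^2 + 4)) / 2) i
      for every y > 0. This is the Cauchy transform of the semicircle
      distribution, by an explicit primitive ([semicircle_poisson]).

    - Convergence of all integrals of 1 / (x^2 + a) and x / (x^2 + a) gives that
      of the integrals of u^k and x u^k with u = 1 / (1 + x^2), and Bernstein
      polynomials in u then reach every even or odd function with compact
      support. The second moments keep the sequence tight
      ([weak_convergence]). *)


(** * Complex moduli, and complex-valued integrals of bounded functions *)

Section modulus.
Variable R : realType.
Notation C := R[i].
Implicit Types z w : C.

Lemma Rec_mul z w : complex.Re (z * w) =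
  complex.Re z * complex.Re w - complex.Im z * complex.Im w.
Proof. by case: z => a b; case: w => c d. Qed.

Lemma Imc_mul z w : complex.Im (z * w) =
  complex.Re z * complex.Im w + complex.Im z * complex.Re w.
Proof. by case: z => a b; case: w => c d. Qed.

Lemma Rec_add z w : complex.Re (z + w) = complex.Re z + complex.Re w.
Proof. by case: z => a b; case: w => c d. Qed.

Lemma Imc_add z w : complex.Im (z + w) = complex.Im z + complex.Im w.
Proof. by case: z => a b; case: w => c d. Qed.

Lemma Rec_opp z : complex.Re (- z) = - complex.Re z.
Proof. by case: z => a b. Qed.

Lemma Imc_opp z : complex.Im (- z) = - complex.Im z.
Proof. by case: z => a b. Qed.

Lemma Rec_real (x : R) : complex.Re x%:C = x. Proof. by []. Qed.

Lemma Imc_real (x : R) : complex.Im x%:C = 0. Proof. by []. Qed.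

Lemma Rec_conj z : complex.Re (conjc z) = complex.Re z.
Proof. by case: z. Qed.

Lemma Imc_conj z : complex.Im (conjc z) = - complex.Im z.
Proof. by case: z. Qed.

Lemma conjcD z w : conjc (z + w) = conjc z + conjc w.
Proof. by rewrite rmorphD. Qed.

Lemma conjcB z w : conjc (z - w) = conjc z - conjc w.
Proof. by rewrite rmorphB. Qed.

Lemma conjcN z : conjc (- z) = - conjc z.
Proof. by rewrite rmorphN. Qed.

Lemma conjcM z w : conjc (z * w) = conjc z * conjc w.
Proof. by rewrite rmorphM. Qed.

Definition abs2 z : R := complex.Re z ^+ 2 + complex.Im z ^+ 2.

Lemma abs2_ge0 z : 0 <= abs2 z.
Proof. by rewrite addr_ge0// sqr_ge0. Qed.

Lemma normcE2 z : normc z ^+ 2 = abs2 z.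
Proof. by case: z => a b; rewrite /= sqr_sqrtr// addr_ge0// sqr_ge0. Qed.

Lemma abs2M z w : abs2 (z * w) = abs2 z * abs2 w.
Proof. by rewrite /abs2 Rec_mul Imc_mul; ring. Qed.

Lemma Rec_inv z : complex.Re z^-1 = complex.Re z / abs2 z.
Proof. by case: z => a b. Qed.

Lemma Imc_inv z : complex.Im z^-1 = - complex.Im z / abs2 z.
Proof. by case: z => a b /=; rewrite /abs2/= mulNr. Qed.

Lemma ler_normcD z w : normc (z + w) <= normc z + normc w.
Proof. exact: le_normcD. Qed.

Lemma normcNr z : normc (- z) = normc z.
Proof. by rewrite (@normcN R). Qed.

Lemma normc_ge0 z : 0 <= normc z.
Proof. by case: z => a b; exact: sqrtr_ge0. Qed.

Lemma normc_eq0 z : (normc z == 0) = (z == 0).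
Proof. by apply/eqP/eqP => [/eq0_normc|->]//; rewrite normc0. Qed.

Lemma normc_gt0 z : (0 < normc z) = (z != 0).
Proof. by rewrite lt_neqAle normc_ge0 andbT eq_sym normc_eq0. Qed.

Lemma abs2_eq0 z : (abs2 z == 0) = (z == 0).
Proof. by rewrite -normcE2 sqrf_eq0 normc_eq0. Qed.

Lemma abs2_gt0 z : (0 < abs2 z) = (z != 0).
Proof. by rewrite lt_neqAle abs2_ge0 andbT eq_sym abs2_eq0. Qed.

Lemma normcX z n : normc (z ^+ n) = normc z ^+ n.
Proof.
elim: n => [|n IH]; first by rewrite !expr0 normc1.
by rewrite !exprS normcM IH.
Qed.

Lemma normc_real (x : R) : normc x%:C = `|x|.
Proof. by rewrite /= expr0n/= addr0 sqrtr_sqr. Qed.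

Lemma normcB z w : normc (z - w) = normc (w - z).
Proof. by rewrite -normcNr opprB. Qed.

Lemma normcJr z : normc (conjc z) = normc z.
Proof. by case: z => a b /=; rewrite sqrrN. Qed.

Lemma normc_Re z : `|complex.Re z| <= normc z.
Proof.
case: z => a b /=; rewrite -sqrtr_sqr ler_sqrt ?lerDl ?sqr_ge0//.
by rewrite addr_ge0// sqr_ge0.
Qed.

Lemma normc_Im z : `|complex.Im z| <= normc z.
Proof.
case: z => a b /=; rewrite -sqrtr_sqr ler_sqrt ?lerDr ?sqr_ge0//.
by rewrite addr_ge0// sqr_ge0.
Qed.

Lemma normc_le_ReIm z : normc z <= `|complex.Re z| + `|complex.Im z|.
Proof.
case: z => a b; have {1}-> : a +i* b = a%:C + 'i * b%:C :> C.
  by apply/eqP; rewrite eq_complex/=; apply/andP; split; apply/eqP; ring.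
apply: (le_trans (ler_normcD _ _)); rewrite normcM !normc_real.
have -> : normc ('i : C) = 1 by rewrite /= expr0n/= expr1n add0r sqrtr1.
by rewrite mul1r.
Qed.

Lemma le_normcB z w : normc (z - w) <= normc z + normc w.
Proof. by rewrite -(normcNr w) ler_normcD. Qed.

Lemma ler_normcB z w : normc z - normc w <= normc (z - w).
Proof. by rewrite lerBlDr -{1}(subrK w z) ler_normcD. Qed.

Lemma normc_sum (I : Type) (r : seq I) (P : pred I) (F : I -> C) :
  normc (\sum_(i <- r | P i) F i) <= \sum_(i <- r | P i) normc (F i).
Proof.
elim/big_ind2 : _ => [|x a y b xa yb|//]; first by rewrite normc0.
exact: le_trans (ler_normcD _ _) (lerD xa yb).
Qed.

Lemma complexP z w : complex.Re z = complex.Re w ->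
  complex.Im z = complex.Im w -> z = w.
Proof. by case: z => a b; case: w => c d /= -> ->. Qed.

Lemma Im_gt0_neq0 z : 0 < complex.Im z -> z != 0.
Proof. by apply: contraTneq => ->; rewrite ltxx. Qed.

End modulus.

Section complex_integral.
Variable R : realType.
Notation C := R[i].
Notation RT := (measurableTypeR R).
Variable mu : probability RT R.

Definition cintegral (f : R -> C) : C :=
  (\int[mu]_x complex.Re (f x)) +i* (\int[mu]_x complex.Im (f x)).

(** Bounded measurable functions form an algebra, so integrability never needs
    to be discussed for the complex integrands below. *)
Definition bounded_mfun (f : R -> C) :=
  [/\ measurable_fun [set: RT] (fun x => complex.Re (f x)),
      measurable_fun [set: RT] (fun x => complex.Im (f x)) &
      exists M : R, forall x, normc (f x) <= M].

Lemma bounded_integrable (f : R -> R) (M : R) :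
  measurable_fun [set: RT] f -> (forall x, `|f x| <= M) ->
  mu.-integrable [set: RT] (EFin \o f).
Proof.
move=> mf fM; apply: measurable_bounded_integrable => //.
  by rewrite ltey_eq fin_num_measure.
exists M; split; first exact: num_real.
by move=> x Mx y _ /=; apply: (le_trans (fM y)); exact: ltW.
Qed.

Lemma Rintegral_prob_cst (a : R) : \int[mu]_x a = a.
Proof.
rewrite Rintegral_cst//.
by rewrite (_ : fine _ = 1) ?mulr1//; exact: (congr1 fine (probability_setT mu)).
Qed.

Lemma bounded_mfun_Re f : bounded_mfun f ->
  mu.-integrable [set: RT] (EFin \o (fun x => complex.Re (f x))).
Proof.
case=> mr _ [M fM]; apply: (bounded_integrable (M := M)) => // x.
exact: le_trans (normc_Re _) (fM x).
Qed.

Lemma bounded_mfun_Im f : bounded_mfun f ->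
  mu.-integrable [set: RT] (EFin \o (fun x => complex.Im (f x))).
Proof.
case=> _ mi [M fM]; apply: (bounded_integrable (M := M)) => // x.
exact: le_trans (normc_Im _) (fM x).
Qed.

Lemma bounded_mfun_cst z : bounded_mfun (fun=> z).
Proof. by split => //; exists (normc z). Qed.

Lemma bounded_mfunD f g : bounded_mfun f -> bounded_mfun g ->
  bounded_mfun (fun x => f x + g x).
Proof.
case=> fr fi [M fM] [gr gi [K gK]]; split.
- under eq_fun do rewrite Rec_add; exact: measurable_funD.
- under eq_fun do rewrite Imc_add; exact: measurable_funD.
- exists (M + K) => x; exact: le_trans (ler_normcD _ _) (lerD (fM x) (gK x)).
Qed.

Lemma bounded_mfunM f g : bounded_mfun f -> bounded_mfun g ->
  bounded_mfun (fun x => f x * g x).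
Proof.
case=> fr fi [M fM] [gr gi [K gK]]; split.
- under eq_fun do rewrite Rec_mul.
  by apply: measurable_funB; exact: measurable_funM.
- under eq_fun do rewrite Imc_mul.
  by apply: measurable_funD; exact: measurable_funM.
- by exists (M * K) => x; rewrite normcM ler_pM// normc_ge0.
Qed.

Lemma bounded_mfunZ z f : bounded_mfun f -> bounded_mfun (fun x => z * f x).
Proof. by move=> bf; apply: bounded_mfunM => //; exact: bounded_mfun_cst. Qed.

Lemma bounded_mfunN f : bounded_mfun f -> bounded_mfun (fun x => - f x).
Proof.
move=> bf; under eq_fun do rewrite -mulN1r.
exact: bounded_mfunZ.
Qed.

Lemma bounded_mfunB f g : bounded_mfun f -> bounded_mfun g ->
  bounded_mfun (fun x => f x - g x).
Proof. by move=> bf bg; apply: bounded_mfunD => //; exact: bounded_mfunN. Qed.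

Lemma bounded_mfunJ f : bounded_mfun f -> bounded_mfun (fun x => conjc (f x)).
Proof.
case=> fr fi [M fM]; split.
- by under eq_fun do rewrite Rec_conj.
- by under eq_fun do rewrite Imc_conj; exact: measurableT_comp.
- by exists M => x; rewrite normcJr.
Qed.

Lemma bounded_mfun_sum (I : Type) (r : seq I) (P : pred I) (F : I -> R -> C) :
  (forall i, bounded_mfun (F i)) ->
  bounded_mfun (fun x => \sum_(i <- r | P i) F i x).
Proof.
move=> bF; elim: r => [|i r IH].
  by under eq_fun do rewrite big_nil; exact: bounded_mfun_cst.
case Pi : (P i); under eq_fun do rewrite big_cons Pi; last exact: IH.
exact: bounded_mfunD.
Qed.

Lemma cintegralD f g : bounded_mfun f -> bounded_mfun g ->
  cintegral (fun x => f x + g x) = cintegral f + cintegral g.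
Proof.
move=> bf bg; apply: complexP; rewrite ?Rec_add ?Imc_add /=.
- under eq_Rintegral do rewrite Rec_add.
  by rewrite RintegralD//; exact: bounded_mfun_Re.
- under eq_Rintegral do rewrite Imc_add.
  by rewrite RintegralD//; exact: bounded_mfun_Im.
Qed.

Lemma cintegralZ z f : bounded_mfun f ->
  cintegral (fun x => z * f x) = z * cintegral f.
Proof.
move=> bf; have [ir ii] := (bounded_mfun_Re bf, bounded_mfun_Im bf).
have iZ (a : R) (g : R -> R) : mu.-integrable [set: RT] (EFin \o g) ->
    mu.-integrable [set: RT] (EFin \o (fun x => a * g x)).
  by move=> ig; under [X in _.-integrable _ X]eq_fun do rewrite /= EFinM;
    exact: integrableZl.
apply: complexP; rewrite ?Rec_mul ?Imc_mul /=.
- under eq_Rintegral do rewrite Rec_mul.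
  by rewrite RintegralB ?RintegralZl//; exact: iZ.
- under eq_Rintegral do rewrite Imc_mul.
  by rewrite RintegralD ?RintegralZl//; exact: iZ.
Qed.

Lemma cintegralN f : bounded_mfun f ->
  cintegral (fun x => - f x) = - cintegral f.
Proof.
move=> bf; rewrite -mulN1r -cintegralZ//; congr cintegral.
by apply/funext => x; rewrite mulN1r.
Qed.

Lemma cintegralB f g : bounded_mfun f -> bounded_mfun g ->
  cintegral (fun x => f x - g x) = cintegral f - cintegral g.
Proof.
by move=> bf bg; rewrite cintegralD ?cintegralN//; exact: bounded_mfunN.
Qed.

Lemma cintegral_cst z : cintegral (fun=> z) = z.
Proof.
by apply: complexP; rewrite /= Rintegral_prob_cst.
Qed.

Lemma cintegralJ f : bounded_mfun f ->
  cintegral (fun x => conjc (f x)) = conjc (cintegral f).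
Proof.
move=> bf; have ii := bounded_mfun_Im bf; apply: complexP => /=.
  by apply: eq_Rintegral => x _; rewrite Rec_conj.
rewrite -[RHS]mulN1r -RintegralZl//.
by apply: eq_Rintegral => x _; rewrite Imc_conj mulN1r.
Qed.

Lemma normc_cintegral_le f (g : R -> R) : bounded_mfun f ->
  mu.-integrable [set: RT] (EFin \o g) -> (forall x, normc (f x) <= g x) ->
  normc (cintegral f) <= 2 * \int[mu]_x g x.
Proof.
move=> bf ig fg; have [ir ii] := (bounded_mfun_Re bf, bounded_mfun_Im bf).
apply: (le_trans (normc_le_ReIm _)); rewrite mulr2n mulrDl !mul1r /=.
have key (h : R -> R) : mu.-integrable [set: RT] (EFin \o h) ->
    (forall x, `|h x| <= normc (f x)) -> `|\int[mu]_x h x| <= \int[mu]_x g x.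
  move=> ih hf; apply: le_trans (le_normr_Rintegral _ ih) _ => //.
  apply: le_Rintegral => //; last by move=> x _; exact: le_trans (hf x) (fg x).
  exact: (integrable_norm ih).
by apply: lerD; apply: key => // x; [exact: normc_Re|exact: normc_Im].
Qed.

Lemma normc_cintegral_bound f (M : R) : bounded_mfun f ->
  (forall x, normc (f x) <= M) -> normc (cintegral f) <= 2 * M.
Proof.
move=> bf fM; rewrite -[in leRHS](Rintegral_prob_cst M).
by apply: normc_cintegral_le => //;
  apply: (bounded_integrable (M := `|M|)).
Qed.

Definition cinner (f g : R -> C) : C :=
  cintegral (fun x => f x * conjc (g x)).

Lemma cinnerDZl z w f g h : bounded_mfun f -> bounded_mfun g ->
  bounded_mfun h ->
  cinner (fun x => z * f x + w * g x) h = z * cinner f h + w * cinner g h.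
Proof.
move=> bf bg bh; have bJ := bounded_mfunJ bh; rewrite /cinner.
rewrite -(cintegralZ z (bounded_mfunM bf bJ)).
rewrite -(cintegralZ w (bounded_mfunM bg bJ)) -cintegralD.
- by congr cintegral; apply/funext => x; rewrite mulrDl !mulrA.
- exact/bounded_mfunZ/bounded_mfunM.
- exact/bounded_mfunZ/bounded_mfunM.
Qed.

Lemma cinnerC f g : bounded_mfun f -> bounded_mfun g ->
  cinner g f = conjc (cinner f g).
Proof.
move=> bf bg; rewrite /cinner -cintegralJ.
  by congr cintegral; apply/funext => x; rewrite conjcM conjcK mulrC.
exact/bounded_mfunM/bounded_mfunJ.
Qed.

Lemma cinnerDZr z w f g h : bounded_mfun f -> bounded_mfun g ->
  bounded_mfun h ->
  cinner h (fun x => z * f x + w * g x) =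
  conjc z * cinner h f + conjc w * cinner h g.
Proof.
move=> bf bg bh.
rewrite cinnerC ?cinnerDZl//; last first.
  by apply: bounded_mfunD; exact: bounded_mfunZ.
by rewrite conjcD !conjcM (cinnerC bh bf) (cinnerC bh bg) !conjcK.
Qed.

Lemma Re_cinner_ge0 f : 0 <= complex.Re (cinner f f).
Proof.
rewrite /=; apply: Rintegral_ge0 => x _.
by rewrite Rec_mul Rec_conj Imc_conj mulrN opprK -!expr2 addr_ge0// sqr_ge0.
Qed.

(** Cauchy-Schwarz in L^2 of a measure, from the positivity of the squared
    norm of z f - w g for suitable scalars. *)
Lemma cinner_cauchy_schwarz f g : bounded_mfun f -> bounded_mfun g ->
  abs2 (cinner f g) <= complex.Re (cinner f f) * complex.Re (cinner g g).
Proof.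
move=> bf bg; have pos (z w : C) :
    0 <= abs2 z * complex.Re (cinner f f) + abs2 w * complex.Re (cinner g g)
         + 2 * complex.Re (z * conjc w * cinner f g).
  apply: (le_trans (Re_cinner_ge0 (fun x => z * f x + w * g x))).
  have bh : bounded_mfun (fun x => z * f x + w * g x).
    by apply: bounded_mfunD; exact: bounded_mfunZ.
  rewrite (cinnerDZl z w bf bg bh) !(cinnerDZr z w bf bg)// (cinnerC bf bg).
  have I0 h : bounded_mfun h -> complex.Im (cinner h h) = 0.
    by move=> bh'; have := cinnerC bh' bh' => /(congr1 (@complex.Im R));
      rewrite Imc_conj; lra.
  rewrite !(Rec_add, Rec_mul, Imc_add, Imc_mul, Rec_conj, Imc_conj) !I0// /abs2.
  by rewrite le_eqVlt; apply/orP; left; apply/eqP; ring.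
move: pos (Re_cinner_ge0 f) (Re_cinner_ge0 g).
move: (cinner f g) (complex.Re (cinner f f)) (complex.Re (cinner g g)).
move=> K A B pos A0 B0.
have [BE|Bn0] := eqVneq B 0.
  have := pos (conjc K) (- ((A + 1) / 2)%:C).
  rewrite BE /abs2 !(Rec_mul, Imc_mul, Rec_conj, Imc_conj, Rec_opp, Imc_opp).
  rewrite /=; have := sqr_ge0 (complex.Re K); have := sqr_ge0 (complex.Im K).
  by lra.
have Bgt0 : 0 < B by rewrite lt_neqAle eq_sym Bn0.
have := pos B%:C (- K).
rewrite /abs2 !(Rec_mul, Imc_mul, Rec_conj, Imc_conj, Rec_opp, Imc_opp) /=.
move=> h; rewrite -(ler_pM2l Bgt0) -subr_ge0.
by apply: le_trans h _; rewrite le_eqVlt; apply/orP; left; apply/eqP; ring.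
Qed.

End complex_integral.

(** * Cauchy transforms *)

Section cauchy_transform.
Variable R : realType.
Notation C := R[i].
Notation RT := (measurableTypeR R).
Variable mu : probability RT R.
Implicit Types z a b : C.

Lemma Rintegral_dominated_cvg (f_ : nat -> R -> R) (f g : R -> R) :
  (forall n, measurable_fun [set: RT] (f_ n)) -> measurable_fun [set: RT] f ->
  (forall x, f_ n x @[n --> \oo] --> f x) ->
  mu.-integrable [set: RT] (EFin \o g) ->
  (forall n x, `|f_ n x| <= g x) ->
  \int[mu]_x f_ n x @[n --> \oo] --> \int[mu]_x f x.
Proof.
move=> mf_ mf cf ig fg.
have [] := @dominated_convergence _ _ _ mu [set: RT] measurableT
   (fun n => EFin \o f_ n) (EFin \o f) (EFin \o g).
- by move=> n; exact/measurable_EFinP.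
- exact/measurable_EFinP.
- by apply: aeW => x _; apply: cvg_EFin; [exact: nearW|exact: cf].
- exact: ig.
- by apply: aeW => x n _; rewrite /= lee_fin.
move=> ifi _ cvg.
have -> : (\int[mu]_x f x) = fine (\int[mu]_x (f x)%:E)%E by [].
apply: fine_cvg; rewrite fineK; first exact: cvg.
exact: integrable_fin_num.
Qed.

Lemma abs2_inv z : abs2 z^-1 = (abs2 z)^-1.
Proof.
have [->|z0] := eqVneq z 0; first by rewrite invr0 /abs2/= expr0n/= addr0 invr0.
apply: (@mulfI _ (abs2 z)); first by rewrite abs2_eq0.
by rewrite -abs2M !divff ?abs2_eq0// /abs2/= expr1n expr0n/= addr0.
Qed.

Definition resolvent z (x : R) : C := (z - x%:C)^-1.

Lemma Im_subC z (x : R) : complex.Im (z - x%:C) = complex.Im z.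
Proof. by rewrite Imc_add Imc_opp Imc_real subr0. Qed.

Lemma Re_subC z (x : R) : complex.Re (z - x%:C) = complex.Re z - x.
Proof. by rewrite Rec_add Rec_opp Rec_real. Qed.

Lemma resolvent_neq0 z (x : R) : 0 < complex.Im z -> z - x%:C != 0.
Proof. by move=> z0; apply: Im_gt0_neq0; rewrite Im_subC. Qed.

Lemma normc_resolvent z (x : R) : 0 < complex.Im z ->
  normc (resolvent z x) <= (complex.Im z)^-1.
Proof.
move=> z0; rewrite normcV lef_pV2 ?posrE ?normc_gt0 ?resolvent_neq0//.
by rewrite -(Im_subC z x); apply: (le_trans (ler_norm _)); exact: normc_Im.
Qed.

Lemma continuous_inv_abs2 z : 0 < complex.Im z ->
  continuous (fun x : R => (abs2 (z - x%:C))^-1).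
Proof.
move=> z0 x; apply: cvgV; first by rewrite abs2_eq0 resolvent_neq0.
rewrite /abs2; under eq_fun do rewrite Re_subC Im_subC.
rewrite Re_subC Im_subC; apply: cvgD; last exact: cvg_cst.
apply: (@cvg_comp _ _ _ (fun y : R => complex.Re z - y) (fun y => y ^+ 2)).
  by apply: cvgB; [exact: cvg_cst|exact: cvg_id].
exact: exprn_continuous.
Qed.

Lemma bounded_mfun_resolvent z : 0 < complex.Im z ->
  bounded_mfun (resolvent z).
Proof.
move=> z0; have cz := continuous_inv_abs2 z0; split.
- have -> : (fun x => complex.Re (resolvent z x)) =
      (fun x => (complex.Re z - x) * (abs2 (z - x%:C))^-1).
    by apply/funext => x; rewrite Rec_inv Re_subC.
  apply: continuous_measurable_fun => x; apply: cvgM; last exact: cz.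
  by apply: cvgB; [exact: cvg_cst|exact: cvg_id].
- have -> : (fun x => complex.Im (resolvent z x)) =
      (fun x => - complex.Im z * (abs2 (z - x%:C))^-1).
    by apply/funext => x; rewrite Imc_inv Im_subC.
  apply: continuous_measurable_fun => x.
  by apply: cvgM; [exact: cvg_cst|exact: cz].
- by exists (complex.Im z)^-1 => x; exact: normc_resolvent.
Qed.

Notation G := (cauchy_transform mu).

Lemma cauchyE z : G z = cintegral mu (resolvent z).
Proof. by []. Qed.

Lemma resolventB a b (x : R) : 0 < complex.Im a -> 0 < complex.Im b ->
  resolvent a x - resolvent b x = - (a - b) * (resolvent a x * resolvent b x).
Proof.
move=> a0 b0; rewrite /resolvent.
have := resolvent_neq0 x a0; have := resolvent_neq0 x b0 => ax bx.
by field; rewrite ax bx.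
Qed.

Lemma cauchyB a b : 0 < complex.Im a -> 0 < complex.Im b ->
  G a - G b = - (a - b) * cintegral mu (fun x => resolvent a x * resolvent b x).
Proof.
move=> a0 b0.
have [ba bb] := (bounded_mfun_resolvent a0, bounded_mfun_resolvent b0).
rewrite !cauchyE -cintegralB// -cintegralZ; last exact: bounded_mfunM.
by congr cintegral; apply/funext => x; exact: resolventB.
Qed.

(** A bounded substitute for the tail mass outside [-K, K]: unlike the mass
    itself, it controls x / (z - x) directly. *)
Definition tail (K : R) : R := \int[mu]_x Num.min (`|x| / K) 1.

Lemma min_tail_ge0 (K x : R) : 0 < K -> 0 <= Num.min (`|x| / K) 1.
Proof. by move=> K0; rewrite le_min ler01 andbT divr_ge0// ltW. Qed.

Lemma measurable_min_tail (K : R) :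
  measurable_fun [set: RT] (fun x : R => Num.min (`|x| / K) 1).
Proof.
apply: measurable_minr => //; apply: measurable_funM => //.
Qed.

Lemma integrable_min_tail (K : R) : 0 < K ->
  mu.-integrable [set: RT] (EFin \o (fun x : R => Num.min (`|x| / K) 1)).
Proof.
move=> K0; apply: (@bounded_integrable _ _ _ 1).
  exact: measurable_min_tail.
by move=> x; rewrite ger0_norm ?min_tail_ge0// ge_min lexx orbT.
Qed.

Lemma tail_le (K L : R) : 0 < K -> K <= L -> tail L <= tail K.
Proof.
move=> K0 KL; have L0 := lt_le_trans K0 KL.
apply: le_Rintegral => //; [exact: integrable_min_tail..|move=> x _].
rewrite le_min [X in _ && X]ge_min lexx orbT andbT ge_min; apply/orP; left.
by rewrite ler_wpM2l// lef_pV2.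
Qed.

Lemma tail_small (e : R) : 0 < e -> exists2 K, 0 < K & tail K <= e.
Proof.
move=> e0.
have : tail n.+1%:R @[n --> \oo] --> \int[mu]_x (0 : R).
  apply: (@Rintegral_dominated_cvg _ _ (fun=> 1)).
  - by move=> n; exact: measurable_min_tail.
  - exact: measurable_cst.
  - move=> x; have : `|x| / n.+1%:R @[n --> \oo] --> (0 : R).
      rewrite -[X in _ --> X](mulr0 `|x|); apply: cvgM; first exact: cvg_cst.
      exact: cvg_harmonic.
    move=> h; apply: (@squeeze_cvgr _ _ _ _ (fun=> 0) (fun n => `|x| / n.+1%:R)).
    + by apply: nearW => n; rewrite min_tail_ge0// ge_min lexx.
    + exact: cvg_cst.
    + exact: h.
  - by apply: (@bounded_integrable _ _ _ 1) => // x; rewrite normr1.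
  - by move=> n x; rewrite ger0_norm ?min_tail_ge0// ge_min lexx orbT.
rewrite Rintegral_prob_cst => /cvgrPdist_le/(_ e e0)[n _ h].
exists n.+1%:R => //; have := h n (leqnn n).
by rewrite sub0r normrN; apply: le_trans; exact: ler_norm.
Qed.

Lemma integrable_inv_abs2 z : 0 < complex.Im z ->
  mu.-integrable [set: RT] (EFin \o (fun x : R => (abs2 (z - x%:C))^-1)).
Proof.
move=> z0; apply: (@bounded_integrable _ _ _ (complex.Im z ^+ 2)^-1).
  by apply: continuous_measurable_fun; exact: continuous_inv_abs2.
move=> x; rewrite ger0_norm ?invr_ge0 ?abs2_ge0//.
rewrite lef_pV2 ?posrE ?exprn_gt0//; last by rewrite abs2_gt0 resolvent_neq0.
by rewrite /abs2 Im_subC lerDr sqr_ge0.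
Qed.

Lemma cauchy_abs2_int_gt0 z : 0 < complex.Im z ->
  0 < \int[mu]_x (abs2 (z - x%:C))^-1.
Proof.
move=> z0; have h0 : 0 < 1 / 2 :> R by lra.
have [K K0 tK] := tail_small h0.
pose c := ((normc z + K) ^+ 2)^-1.
have c0 : 0 < c.
  by rewrite invr_gt0 exprn_gt0// ltr_wpDl// normc_ge0.
have i1 := integrable_min_tail K0.
have i2 : mu.-integrable [set: RT] (EFin \o (fun=> 1 : R)).
  by apply: (@bounded_integrable _ _ _ 1) => // x; rewrite normr1.
have i3 : mu.-integrable [set: RT]
    (EFin \o (fun x : R => 1 - Num.min (`|x| / K) 1)).
  by under [X in _.-integrable _ X]eq_fun do rewrite /= EFinB; exact: integrableB.
apply: (@lt_le_trans _ _ (c * (1 - tail K))); first by apply: mulr_gt0 => //; lra.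
rewrite /tail -[X in X - _](Rintegral_prob_cst mu) -RintegralB// -RintegralZl//.
apply: le_Rintegral => //.
- by under [X in _.-integrable _ X]eq_fun do rewrite /= EFinM; exact: integrableZl.
- exact: integrable_inv_abs2.
move=> x _; have [xK|xK] := leP K `|x|.
  rewrite (_ : Num.min _ _ = 1); last first.
    by apply/min_idPr; rewrite ler_pdivlMr// mul1r.
  by rewrite subrr mulr0 invr_ge0 abs2_ge0.
apply: (@le_trans _ _ c).
  by rewrite ger_pMr// gerBl min_tail_ge0.
rewrite lef_pV2 ?posrE; last 2 first.
- by rewrite -invr_gt0.
- by rewrite abs2_gt0 resolvent_neq0.
rewrite -normcE2 ler_pXn2r// ?nnegrE ?normc_ge0//; last first.
  by rewrite addr_ge0 ?normc_ge0// ltW.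
apply: (le_trans (le_normcB _ _)); rewrite normc_real lerD2l; exact: ltW.
Qed.

Lemma Im_cauchy z : 0 < complex.Im z ->
  complex.Im (G z) = - (complex.Im z * \int[mu]_x (abs2 (z - x%:C))^-1).
Proof.
move=> z0; rewrite -mulNr -RintegralZl//.
  by rewrite /=; apply: eq_Rintegral => x _; rewrite Imc_inv Im_subC.
exact: integrable_inv_abs2.
Qed.

Lemma Im_cauchy_lt0 z : 0 < complex.Im z -> complex.Im (G z) < 0.
Proof.
by move=> z0; rewrite Im_cauchy// oppr_lt0 mulr_gt0// cauchy_abs2_int_gt0.
Qed.

Lemma cauchy_neq0 z : 0 < complex.Im z -> G z != 0.
Proof.
by move=> /Im_cauchy_lt0; apply: contraTneq => ->; rewrite /= ltxx.
Qed.

(** Cauchy-Schwarz applied to the resolvent: |G z|^2 <= - Im (G z) / Im z. *)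
Lemma Im_F_transform_ge z : 0 < complex.Im z ->
  complex.Im z <= complex.Im (F_transform mu z).
Proof.
move=> z0; have bz := bounded_mfun_resolvent z0.
have := cinner_cauchy_schwarz mu bz (bounded_mfun_cst 1).
have -> : cinner mu (resolvent z) (fun=> 1) = G z.
  rewrite cauchyE; congr cintegral.
  by apply/funext => x; rewrite conjc1 mulr1.
have -> : cinner mu (fun=> 1) (fun=> 1) = 1.
  by rewrite /cinner cintegral_cst conjc1 mulr1.
rewrite mulr1.
have -> : complex.Re (cinner mu (resolvent z) (resolvent z)) =
    \int[mu]_x (abs2 (z - x%:C))^-1.
  rewrite /=; apply: eq_Rintegral => x _.
  rewrite Rec_mul Rec_conj Imc_conj mulrN opprK -!expr2.
  by rewrite -[LHS]/(abs2 _) abs2_inv.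
rewrite /F_transform Imc_inv Im_cauchy// opprK => h.
by rewrite ler_pdivlMr ?abs2_gt0 ?cauchy_neq0// ler_pM2l.
Qed.

Lemma normc_mul_resolvent z (x K : R) : normc z <= 3 * complex.Im z ->
  0 < K -> K <= complex.Im z ->
  normc (x%:C * resolvent z x) <= 4 * Num.min (`|x| / K) 1.
Proof.
move=> sz K0 Kz; have z0 := lt_le_trans K0 Kz.
rewrite minr_pMr; last by [].
rewrite le_min mulr1; apply/andP; split.
  rewrite normcM normc_real; apply: (@le_trans _ _ (`|x| / K)).
    apply: ler_wpM2l => //; apply: (le_trans (normc_resolvent x z0)).
    by rewrite lef_pV2.
  by rewrite ler_peMl ?divr_ge0 ?(ltW K0)//; lra.
have -> : x%:C * resolvent z x = z * resolvent z x - 1.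
  by have := resolvent_neq0 x z0; rewrite /resolvent => zx; field.
apply: (le_trans (le_normcB _ _)); rewrite normcM normc1.
have : normc z * normc (resolvent z x) <= 3; last by lra.
apply: (le_trans (ler_pM (normc_ge0 _) (normc_ge0 _) sz (normc_resolvent x z0))).
by rewrite mulfK ?gt_eqF.
Qed.

Lemma cauchy_asymptotic z (K : R) : normc z <= 3 * complex.Im z ->
  0 < K -> K <= complex.Im z -> normc (z * G z - 1) <= 8 * tail K.
Proof.
move=> sz K0 Kz; have z0 := lt_le_trans K0 Kz.
have bz := bounded_mfun_resolvent z0.
have b0 : bounded_mfun (fun x : R => z * resolvent z x).
  exact: bounded_mfunZ.
rewrite cauchyE -cintegralZ// -[X in _ - X](cintegral_cst mu) -cintegralB//; last first.
  exact: bounded_mfun_cst.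
have E : (fun x => z * resolvent z x - 1) = (fun x => x%:C * resolvent z x).
  apply/funext => x.
  by have := resolvent_neq0 x z0; rewrite /resolvent => zx; field.
rewrite E (_ : 8 * _ = 2 * (4 * tail K)); last by ring.
rewrite /tail -RintegralZl//; last exact: integrable_min_tail.
apply: normc_cintegral_le.
- by rewrite -E; apply: bounded_mfunB => //; exact: bounded_mfun_cst.
- under [X in _.-integrable _ X]eq_fun do rewrite /= EFinM.
  by apply: integrableZl => //; exact: integrable_min_tail.
- by move=> x; exact: normc_mul_resolvent.
Qed.

Lemma cauchy2_asymptotic a b (K : R) :
  normc a <= 3 * complex.Im a -> normc b <= 3 * complex.Im b ->
  0 < K -> K <= complex.Im a -> K <= complex.Im b ->
  normc (a * b * cintegral mu (fun x => resolvent a x * resolvent b x) - 1)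
  <= 48 * tail K.
Proof.
move=> sa sb K0 Ka Kb.
have [a0 b0] := (lt_le_trans K0 Ka, lt_le_trans K0 Kb).
have [ba bb] := (bounded_mfun_resolvent a0, bounded_mfun_resolvent b0).
have bab : bounded_mfun (fun x => resolvent a x * resolvent b x).
  exact: bounded_mfunM.
have babZ : bounded_mfun (fun x => a * b * (resolvent a x * resolvent b x)).
  exact: bounded_mfunZ.
rewrite -cintegralZ// -[X in _ - X](cintegral_cst mu) -cintegralB//; last first.
  exact: bounded_mfun_cst.
rewrite (_ : 48 * _ = 2 * (24 * tail K)); last by ring.
rewrite /tail -RintegralZl//; last exact: integrable_min_tail.
apply: normc_cintegral_le.
- by apply: bounded_mfunB => //; exact: bounded_mfun_cst.
- under [X in _.-integrable _ X]eq_fun do rewrite /= EFinM.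
  by apply: integrableZl => //; exact: integrable_min_tail.
- move=> x; pose p := x%:C * resolvent a x; pose q := x%:C * resolvent b x.
  have -> : a * b * (resolvent a x * resolvent b x) - 1 = p + q + p * q.
    have := resolvent_neq0 x a0; have := resolvent_neq0 x b0.
    by rewrite /p /q /resolvent => ax bx; field; rewrite ax bx.
  have hp : normc p <= _ := normc_mul_resolvent x sa K0 Ka.
  have hq : normc q <= _ := normc_mul_resolvent x sb K0 Kb.
  have m0 := min_tail_ge0 x K0.
  have m1 : Num.min (`|x| / K) 1 <= 1 by rewrite ge_min lexx orbT.
  move: m0 m1 hp hq; set m := Num.min _ _ => m0 m1 hp hq.
  apply: (le_trans (ler_normcD _ _)); rewrite normcM.
  have := ler_normcD p q; have := normc_ge0 p; have := normc_ge0 q.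
  nra.
Qed.

(** G a - G b is b - a times an integral that is close to 1 / (a b), hence not
    zero, when a and b are far out in a sector. *)
Lemma cauchy_univalent : exists2 K : R, 0 < K & forall a b,
  normc a <= 3 * complex.Im a -> normc b <= 3 * complex.Im b ->
  K <= complex.Im a -> K <= complex.Im b -> G a = G b -> a = b.
Proof.
have h0 : 0 < 1 / 96 :> R by lra.
have [K K0 tK] := tail_small h0.
exists K => // a b sa sb Ka Kb Gab.
have [a0 b0] := (lt_le_trans K0 Ka, lt_le_trans K0 Kb).
have := cauchy2_asymptotic sa sb K0 Ka Kb.
have := cauchyB a0 b0; rewrite Gab subrr => /esym/eqP.
rewrite mulf_eq0 oppr_eq0 subr_eq0 => /orP[/eqP//|/eqP->].
by rewrite mulr0 sub0r normcNr normc1 => h; exfalso; lra.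
Qed.

End cauchy_transform.

(** * Uniqueness of Voiculescu transforms, and what a free power says *)

Section voiculescu.
Variable R : realType.
Notation C := R[i].
Notation prob := (probability (measurableTypeR R) R).
Implicit Types (mu nu rho : prob) (eta M : R) (z : C).

Lemma coneE eta M z : truncated_cone eta M z <->
  [/\ 0 < complex.Im z, `|complex.Re z| < eta * complex.Im z & M < normc z].
Proof.
split=> -[h1 h2 h3]; split => //.
- by move: h3; rewrite -[`|z|]/((normc z)%:C) ltcR.
- by rewrite -[`|z|]/((normc z)%:C) ltcR.
Qed.

Lemma sub_cone eta M eta' M' z : eta <= eta' -> M' <= M ->
  truncated_cone eta M z -> truncated_cone eta' M' z.
Proof.
move=> ee MM /coneE[h1 h2 h3]; apply/coneE; split => //.
- by apply: (lt_le_trans h2); rewrite ler_wpM2r// ltW.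
- exact: le_lt_trans MM h3.
Qed.

Lemma cone_sector eta M z : eta <= 1 -> truncated_cone eta M z ->
  normc z <= 2 * complex.Im z.
Proof.
move=> e1 /coneE[h1 h2 _]; apply: (le_trans (normc_le_ReIm z)).
rewrite [X in _ + X]gtr0_norm//.
have : eta * complex.Im z <= complex.Im z by rewrite ger_pMl.
by lra.
Qed.

Lemma near_sector z w : 0 < complex.Im z -> normc z <= 2 * complex.Im z ->
  normc (w - z) <= normc z / 8 ->
  complex.Im z / 2 <= complex.Im w /\ normc w <= 3 * complex.Im w.
Proof.
move=> z0 sz wz; have := normc_Im (w - z); rewrite Imc_add Imc_opp => h.
have h1 : complex.Im z - complex.Im w <= normc (w - z).
  by apply: le_trans h; rewrite distrC ler_norm.
have h2 : normc w <= normc z + normc (w - z).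
  by rewrite -{1}(subrK z w) addrC; exact: ler_normcD.
by split; lra.
Qed.

Lemma F_inverse_sector mu eta M (H : C -> C) : eta <= 1 ->
  is_F_inverse mu eta M H -> exists K : R, forall z,
  truncated_cone eta M z -> K < normc z ->
  complex.Im z / 2 <= complex.Im (H z) /\ normc (H z) <= 3 * complex.Im (H z).
Proof.
move=> e1 [_ _ /(_ (1 / 8))[|K hK]]; first by lra.
exists K => z cz Kz; have /coneE[z0 _ _] := cz.
apply: near_sector => //; first exact: cone_sector cz.
have := hK z cz; rewrite -[`|z|]/((normc z)%:C) ltcR => /(_ Kz).
rewrite -[`|_|]/((normc _)%:C) ltcR => /ltW h.
have -> : H z - z = (H z / z - 1) * z by field; exact: Im_gt0_neq0.
rewrite normcM (_ : normc z / 8 = 1 / 8 * normc z); last by ring.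
by rewrite ler_wpM2r ?normc_ge0.
Qed.

Lemma is_F_inverse_sub mu eta M eta' M' H : eta <= eta' -> M' <= M ->
  is_F_inverse mu eta' M' H -> is_F_inverse mu eta M H.
Proof.
move=> ee MM [h1 h2 h3]; split.
- by move=> z /(sub_cone ee MM); exact: h1.
- by move=> z /(sub_cone ee MM); exact: h2.
- move=> e e0; have [K hK] := h3 e e0.
  by exists K => z /(sub_cone ee MM); exact: hK.
Qed.

(** Right inverses of F that are asymptotic to the identity coincide far out,
    because they take their values where F is injective. *)
Lemma voiculescu_unique mu eta1 M1 phi1 eta2 M2 phi2 :
  0 < eta1 -> 0 < eta2 ->
  is_voiculescu_transform mu eta1 M1 phi1 ->
  is_voiculescu_transform mu eta2 M2 phi2 ->
  exists eta M, [/\ 0 < eta, 0 < M & forall z, truncated_cone eta M z ->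
    phi1 z = phi2 z].
Proof.
move=> e10 e20 [H1 FH1 E1] [H2 FH2 E2].
pose eta := Num.min (Num.min eta1 eta2) 1.
have e0 : 0 < eta by rewrite !lt_min e10 e20 ltr01.
have le1 : eta <= 1 by rewrite ge_min lexx orbT.
have le_1 : eta <= eta1 by rewrite !ge_min lexx.
have le_2 : eta <= eta2 by rewrite !ge_min lexx orbT.
have [K1 s1] := F_inverse_sector le1 (is_F_inverse_sub le_1 (lexx _) FH1).
have [K2 s2] := F_inverse_sector le1 (is_F_inverse_sub le_2 (lexx _) FH2).
have [K K0 inj] := cauchy_univalent mu.
pose M := Num.max (4 * K) (Num.max (Num.max M1 M2) (Num.max K1 K2)).
exists eta, M; split => //.
  by rewrite lt_max; apply/orP; left; lra.
move=> z cz.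
have [MK MM1 MM2 MK1 MK2] :
    [/\ 4 * K <= M, M1 <= M, M2 <= M, K1 <= M & K2 <= M].
  by rewrite /M !le_max !lexx !orbT.
have c1 := sub_cone le_1 MM1 cz; have c2 := sub_cone le_2 MM2 cz.
have d1 := sub_cone (lexx _) MM1 cz; have d2 := sub_cone (lexx _) MM2 cz.
have /coneE[z0 _ Mz] := cz; have sz := cone_sector le1 cz.
have [i1 n1] := s1 z d1 (le_lt_trans MK1 Mz).
have [i2 n2] := s2 z d2 (le_lt_trans MK2 Mz).
rewrite E1// E2//; congr (_ - _); apply: inj => //; [lra|lra|].
apply: invr_inj; have [_ F1 _] := FH1; have [_ F2 _] := FH2.
by rewrite -/(F_transform mu (H1 z)) -/(F_transform mu (H2 z)) F1// F2.
Qed.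

(** The one-fold power of nu is any measure that agrees with nu on measurable
    sets; the transforms cannot tell them apart. *)
Lemma is_voiculescu_eq nu rho eta M phi :
  (forall A, measurable A -> rho A = nu A) ->
  is_voiculescu_transform rho eta M phi -> is_voiculescu_transform nu eta M phi.
Proof.
move=> rn; suff E z : F_transform rho z = F_transform nu z.
  move=> [H [h1 h2 h3] h4]; exists H => //; split => // z cz.
  by rewrite -E; exact: h2.
have I (f : R -> R) : \int[rho]_x f x = \int[nu]_x f x.
  congr fine; apply: eq_measure_integral => A mA _; exact: rn.
by rewrite /F_transform /cauchy_transform !I.
Qed.

Lemma free_power_voiculescu nu n rho : is_free_power nu n rho ->
  forall eta1 M1 phi1 eta2 M2 phi2, 0 < eta1 -> 0 < eta2 ->
  is_voiculescu_transform rho eta1 M1 phi1 ->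
  is_voiculescu_transform nu eta2 M2 phi2 ->
  exists eta M, [/\ 0 < eta, 0 < M & forall z, truncated_cone eta M z ->
    phi1 z = n%:R * phi2 z].
Proof.
elim=> {n rho} [rho rn|n rho mu _ IH [eta [M [pr [pn [pm]]]]]].
  move=> eta1 M1 phi1 eta2 M2 phi2 e1 e2 /(is_voiculescu_eq rn) v1 v2.
  have [eta [M [e0 M0 E]]] := voiculescu_unique e1 e2 v1 v2.
  by exists eta, M; split => // z cz; rewrite mul1r E.
move=> [e0 M0 vr vn [vm E]] eta1 M1 phi1 eta2 M2 phi2 e1 e2 v1 v2.
have [ea [Ma [ea0 Ma0 Ea]]] := voiculescu_unique e1 e0 v1 vm.
have [eb [Mb [eb0 Mb0 Eb]]] := IH _ _ _ _ _ _ e0 e2 vr v2.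
have [ec [Mc [ec0 Mc0 Ec]]] := voiculescu_unique e0 e2 vn v2.
exists (Num.min (Num.min eta ea) (Num.min eb ec)).
exists (Num.max (Num.max M Ma) (Num.max Mb Mc)).
split; [by rewrite !lt_min e0 ea0 eb0|by rewrite !lt_max M0|].
move=> z cz; rewrite Ea; last first.
  by apply: sub_cone cz; rewrite ?ge_min ?le_max ?lexx ?orbT.
rewrite E; last by apply: sub_cone cz; rewrite ?ge_min ?le_max ?lexx ?orbT.
rewrite Eb; last by apply: sub_cone cz; rewrite ?ge_min ?le_max ?lexx ?orbT.
rewrite Ec; last by apply: sub_cone cz; rewrite ?ge_min ?le_max ?lexx ?orbT.
by rewrite -[n.+1]addn1 natrD mulrDl mul1r.
Qed.

Definition iy (y : R) : C := 0 +i* y.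

(** The subordination function: if nu is the N-th free convolution root of mu
    then the Cauchy transform of mu is that of nu composed with this map. *)
Definition subordination mu (N : nat) (w : C) : C :=
  w / N%:R + (1 - N%:R^-1) * F_transform mu w.

Lemma F_transform_asymptotic mu (e : R) : 0 < e -> exists2 Y : R, 0 < Y &
  forall y, Y <= y -> normc (F_transform mu (iy y) - iy y) <= e * y.
Proof.
move=> e0; pose d := Num.min (e / 16) (1 / 16).
have d0 : 0 < d by rewrite lt_min; apply/andP; split; lra.
have de : d <= e / 16 by rewrite ge_min lexx.
have d1 : d <= 1 / 16 by rewrite ge_min lexx orbT.
have [K K0 tK] := tail_small mu d0.
exists K => // y Ky; have y0 := lt_le_trans K0 Ky.
have ny : normc (iy y) = y by rewrite /= expr0n/= add0r sqrtr_sqr gtr0_norm.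
have := @cauchy_asymptotic _ mu (iy y) K; rewrite ny => /(_ _ K0 Ky) h.
have {h} h : normc (iy y * cauchy_transform mu (iy y) - 1) <= 8 * d.
  by apply: (le_trans (h _)); rewrite /=; lra.
set t := iy y * _ in h.
have G0 : cauchy_transform mu (iy y) != 0 by exact: cauchy_neq0.
have iy0 : iy y != 0 by exact: Im_gt0_neq0.
have -> : F_transform mu (iy y) - iy y = iy y * (1 - t) / t.
  by rewrite /F_transform /t; field; rewrite G0 iy0.
rewrite !normcM ny normcV normcB.
have tn : 1 / 2 <= normc t.
  have := ler_normcB 1 t; rewrite normc1 normcB; lra.
have t0 : 0 < normc t by lra.
by rewrite -mulrA (mulrC e) ler_pM2l// ler_pdivrMr//; nra.
Qed.

(** At z = F_mu (i y) the inverse of F_mu takes the value i y, so phi_mu z is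
    i y - z, and the inverse of F_nu takes the value z + (i y - z) / N. Applying
    F_nu to that value gives z back. *)
Lemma subordination_far nu N mu : (1 < N)%N -> is_free_power nu N mu ->
  exists Y : R, forall y, Y < y ->
  cauchy_transform nu (subordination mu N (iy y)) = cauchy_transform mu (iy y).
Proof.
case: N => [//|N] N1 P; inversion P as [|n rho mu' P' FC]; subst.
  by rewrite ltnn in N1.
case: FC => [eta [M [pr [pn [pm [e0 M0 _ vn [vm _]]]]]]].
have [ea [Ma [ea0 Ma0 E]]] := free_power_voiculescu P e0 e0 vm vn.
case: vm => Hm FHm Em; case: vn => Hn FHn En.
pose eb := Num.min (Num.min eta ea) 1.
have eb0 : 0 < eb by rewrite !lt_min e0 ea0 ltr01.
have eb1 : eb <= 1 by rewrite ge_min lexx orbT.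
have ebe : eb <= eta by rewrite !ge_min lexx.
have eba : eb <= ea by rewrite !ge_min lexx orbT.
have [K sH] := F_inverse_sector eb1 (is_F_inverse_sub ebe (lexx _) FHm).
have [K' K'0 inj] := cauchy_univalent mu.
have eb40 : 0 < eb / 8 by lra.
have [Y Y0 hY] := F_transform_asymptotic mu eb40.
exists (Num.max Y (Num.max (4 * K') (Num.max (2 * M) (Num.max (2 * Ma) (2 * K))))).
move=> y; rewrite !gt_max => /and5P[yY yK' yM yMa yK].
set z := F_transform mu (iy y).
have zy : normc (z - iy y) <= eb / 8 * y by exact/hY/ltW.
have y0 : 0 < y := lt_trans Y0 yY.
have re : `|complex.Re z| <= eb / 8 * y.
  by apply: le_trans zy; have := normc_Re (z - iy y); rewrite Rec_add Rec_opp/= subr0.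
have im : y <= complex.Im z by have := Im_F_transform_ge mu (z := iy y); exact.
have zn : complex.Im z <= normc z.
  by apply: (le_trans (ler_norm _)); exact: normc_Im.
have cz L : 2 * L < y -> truncated_cone eb L z.
  move=> Ly; apply/coneE; split; [exact: lt_le_trans im|nra|lra].
have cb := cz _ yM.
have Kz : K < normc z by lra.
have [iH sHz] := sH z cb Kz.
have czm : truncated_cone eta M z by exact: sub_cone cb.
have cza : truncated_cone ea Ma z by exact: sub_cone (cz _ yMa).
have FHz : F_transform mu (Hm z) = z by case: FHm => _ h _; exact: h.
have HE : Hm z = iy y.
  apply: inj => //; [|lra|by rewrite /=; lra|].
  - by rewrite /= expr0n/= add0r sqrtr_sqr gtr0_norm//; lra.
  - by apply: invr_inj; rewrite -/(F_transform mu (Hm z)) FHz.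
have N0 : N.+1%:R != 0 :> C by rewrite pnatr_eq0.
have HnE : Hn z = subordination mu N.+1 (iy y).
  have := E z cza; rewrite Em// En// HE => h.
  rewrite /subordination -/z; apply: (mulfI N0).
  transitivity (N.+1%:R * (Hn z - z) + N.+1%:R * z); first by ring.
  by rewrite -h; field.
have FHnz : F_transform nu (Hn z) = z by case: FHn => _ h _; exact: h.
by apply: invr_inj; rewrite -HnE -/(F_transform nu (Hn z)) FHnz.
Qed.

End voiculescu.

(** * Analytic continuation along the imaginary axis *)

Section analytic.
Variable R : realType.
Notation C := R[i].
Notation RT := (measurableTypeR R).

(** Analyticity at 0 of a complex function of a real variable, through the
    iterated difference quotients J n: writing J n t = J n 0 + t * J n.+1 t
    with geometric bounds encodes the Taylor expansion together with its
    remainders, without infinite sums. *)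
Definition jet (r M : R) (J : nat -> R -> C) :=
  [/\ 0 < r, (forall n t, `|t| < r -> J n t = J n 0 + t%:C * J n.+1 t) &
      (forall n t, `|t| < r -> normc (J n t) <= M / r ^+ n)].

Definition analytic0 (f : R -> C) :=
  exists r M J, jet r M J /\ forall t, J 0%N t = f t.

Lemma jet_ge0 r M J : jet r M J -> 0 <= M.
Proof.
case=> r0 _ /(_ 0%N 0); rewrite normr0 expr0 divr1 => /(_ r0).
exact: le_trans (normc_ge0 _).
Qed.

Lemma jet_shrink r M J r' M' : 0 < r' -> r' <= r -> M <= M' ->
  jet r M J -> jet r' M' J.
Proof.
move=> r'0 rr MM jJ; have M0 := jet_ge0 jJ; case: jJ => r0 JE JM.
split=> // n t tr'; have tr := lt_le_trans tr' rr; first exact: JE.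
apply: (le_trans (JM _ _ tr)); apply: ler_pM => //.
  by rewrite invr_ge0 exprn_ge0// ltW.
by rewrite lef_pV2 ?posrE ?exprn_gt0// lerXn2r// ?nnegrE ltW.
Qed.

Lemma analytic0D f g : analytic0 f -> analytic0 g ->
  analytic0 (fun t => f t + g t).
Proof.
move=> [r [M [J [jJ J0]]]] [r' [M' [J' [jJ' J'0]]]].
have [r0 _ _] := jJ; have [r'0 _ _] := jJ'.
pose s := Num.min r r'.
have s0 : 0 < s by rewrite lt_min r0 r'0.
have sr : s <= r by rewrite ge_min lexx.
have sr' : s <= r' by rewrite ge_min lexx orbT.
have [_ JE JM] := jet_shrink s0 sr (lexx _) jJ.
have [_ J'E J'M] := jet_shrink s0 sr' (lexx _) jJ'.
exists s, (M + M'), (fun n t => J n t + J' n t).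
split; last by move=> t; rewrite J0 J'0.
split=> // n t ts; first by rewrite JE// J'E//; ring.
by apply: (le_trans (ler_normcD _ _)); rewrite mulrDl lerD ?JM ?J'M.
Qed.

Lemma analytic0Z z f : analytic0 f -> analytic0 (fun t => z * f t).
Proof.
move=> [r [M [J [jJ J0]]]]; have [r0 JE JM] := jJ.
exists r, (normc z * M), (fun n t => z * J n t).
split; last by move=> t; rewrite J0.
split=> // n t ts; first by rewrite JE//; ring.
by rewrite normcM -mulrA ler_wpM2l ?normc_ge0 ?JM.
Qed.

Lemma analytic0_iy y : analytic0 (fun t => iy (y + t)).
Proof.
pose J n (t : R) : C :=
  if n is m.+1 then if m is 0%N then 'i else 0 else iy (y + t).
exists 1, (`|y| + 1), J; split => //; split => // -[|[|n]] t t1 /=.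
- by rewrite /iy; apply: complexP; rewrite /= ; ring.
- by rewrite mulr0 addr0.
- by rewrite mulr0 addr0.
- rewrite expr0 divr1 expr0n/= add0r sqrtr_sqr.
  by apply: (le_trans (ler_normD _ _)); rewrite lerD2l ltW.
- rewrite expr1n divr1 expr0n/= expr1n add0r sqrtr1.
  by rewrite lerDr.
- by rewrite expr1n divr1 expr0n/= addr0 sqrtr0 addr_ge0.
Qed.

(** Coefficients of the reciprocal of a power series with coefficients [a]
    and constant term [u0^-1]; the list holds them in decreasing order. *)
Fixpoint rev_inv_coefs (u0 : C) (a : nat -> C) n : seq C :=
  if n is m.+1 then let s := rev_inv_coefs u0 a m in
    (if m is 0%N then u0 else - u0 * \sum_(j < m) s`_j * a j.+1) :: s
  else [::].

Definition inv_coef u0 a n : C := head 0 (rev_inv_coefs u0 a n.+1).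

Lemma nth_rev_inv_coefs u0 a n j : (j < n)%N ->
  (rev_inv_coefs u0 a n)`_j = inv_coef u0 a (n - j.+1).
Proof.
elim: n j => [//|n IH] [|j] jn; first by rewrite subn1.
by rewrite /= IH// subSS.
Qed.

Lemma inv_coef0 u0 a : inv_coef u0 a 0 = u0.
Proof. by []. Qed.

Lemma inv_coefS u0 a n : inv_coef u0 a n.+1 =
  - u0 * \sum_(j < n.+1) inv_coef u0 a (n - j) * a j.+1.
Proof.
rewrite [LHS]/inv_coef; set s := rev_inv_coefs u0 a n.+1.
have -> : rev_inv_coefs u0 a n.+2 =
  (- u0 * \sum_(j < n.+1) s`_j * a j.+1) :: s by [].
rewrite [head _ _]/=; congr (_ * _); apply: eq_bigr => j _.
by rewrite /s nth_rev_inv_coefs// subSS.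
Qed.

Definition inv_jet (u : R -> C) (J : nat -> R -> C) (n : nat) (t : R) : C :=
  if n is m.+1 then
    - u t * \sum_(j < n) inv_coef (u 0) (J ^~ 0) (m - j) * J j.+1 t
  else u t.

Lemma inv_jet0 u J n : inv_jet u J n 0 = inv_coef (u 0) (J ^~ 0) n.
Proof. by case: n => [|n] //=; rewrite inv_coefS. Qed.

(** Since t * J j.+1 t = J j t - J j 0, multiplying by t shifts the convolution
    defining the reciprocal, and the recursion for the coefficients cancels
    the boundary terms. The constant [c] allows J 0 to be translated. *)
Lemma inv_jetE u J r M c : jet r M J ->
  (forall t, `|t| < r -> u t * (J 0%N t - c) = 1) ->
  forall n t, `|t| < r ->
    inv_jet u J n t = inv_jet u J n 0 + t%:C * inv_jet u J n.+1 t.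
Proof.
move=> [r0 JE _] uE n t tr; rewrite inv_jet0.
have E0 : u 0 * (J 0%N 0 - c) = 1 by apply: uE; rewrite normr0.
have Et := uE t tr.
have JS j : t%:C * J j.+1 t = J j t - J j 0 by rewrite (JE j t tr); ring.
set q := inv_coef (u 0) (J ^~ 0).
case: n => [|m]; rewrite /inv_jet -/q.
  rewrite big_ord1 subnn /= {1 2}/q inv_coef0.
  transitivity (u 0 - u t * u 0 * (t%:C * J 1%N t)); last by ring.
  rewrite JS; transitivity
    (u 0 - u 0 * (u t * (J 0%N t - c)) + u t * (u 0 * (J 0%N 0 - c))).
    by rewrite Et E0; ring.
  by ring.
rewrite [in RHS]big_ord_recl subn0.
have -> : \sum_(i < m.+1) q (m.+1 - bump 0 i)%N * J (bump 0 i).+1 t =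
          \sum_(i < m.+1) q (m - i)%N * J i.+2 t.
  by apply: eq_bigr => i _; rewrite /bump /= add1n subSS.
set St := \sum_(i < m.+1) q (m - i)%N * J i.+1 t.
pose S0 := \sum_(i < m.+1) q (m - i)%N * J i.+1 0.
have SE : t%:C * (\sum_(i < m.+1) q (m - i)%N * J i.+2 t) = St - S0.
  rewrite mulr_sumr /St /S0 -sumrB; apply: eq_bigr => i _.
  by rewrite mulrCA JS; ring.
have qS : q m.+1 = - u 0 * S0 by rewrite /q inv_coefS.
transitivity (q m.+1 - u t * (q m.+1 * (t%:C * J 1%N t) +
   t%:C * (\sum_(i < m.+1) q (m - i)%N * J i.+2 t))); last by ring.
rewrite SE JS qS.
transitivity (- u 0 * S0 + u 0 * S0 * (u t * (J 0%N t - c))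
   - u t * (u 0 * (J 0%N 0 - c)) * S0 - u t * St + u t * S0).
  by rewrite Et E0; ring.
by ring.
Qed.

(** The bounds M / r^j on the data and B on the reciprocal give a geometric bound
    with the larger ratio (1 + B M) / r, because the convolution with that ratio
    telescopes. *)
Lemma inv_jet_le u J r M B : jet r M J -> 0 <= B ->
  (forall t, `|t| < r -> normc (u t) <= B) ->
  forall n t, `|t| < r ->
    normc (inv_jet u J n t) <= B / (r / (1 + B * M)) ^+ n.
Proof.
move=> jJ B0 uB n t tr; have M0 := jet_ge0 jJ; have [r0 _ JM] := jJ.
pose D := (1 + B * M) / r.
have BM0 : 0 <= B * M by exact: mulr_ge0.
have D0 : 0 <= D by rewrite divr_ge0// ?(ltW r0)//; lra.
have -> : B / (r / (1 + B * M)) ^+ n = B * D ^+ n.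
  by rewrite -exprVn invf_div.
have geom m : \sum_(j < m.+1) B * D ^+ (m - j) * (M / r ^+ j.+1) <=
    D ^+ m.+1 - (r ^+ m.+1)^-1.
  elim: m => [|m IH].
    rewrite big_ord1 subnn expr0 mulr1 !expr1 /D.
    by rewrite le_eqVlt; apply/orP; left; apply/eqP; field; lra.
  rewrite big_ord_recr/= subnn expr0 mulr1.
  have -> : \sum_(i < m.+1) B * D ^+ (m.+1 - i) * (M / r ^+ i.+1) =
      D * \sum_(i < m.+1) B * D ^+ (m - i) * (M / r ^+ i.+1).
    rewrite mulr_sumr; apply: eq_bigr => i _.
    by rewrite subSn -1?ltnS// exprS; ring.
  have := ler_wpM2l D0 IH; set S := \sum_(i < _) _ => h.
  apply: (le_trans (lerD h (lexx _))).
  rewrite le_eqVlt; apply/orP; left; apply/eqP.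
  rewrite mulrBr -exprS -addrA; congr (_ + _).
  have rm : r ^+ m.+1 != 0 by rewrite expf_neq0// gt_eqF.
  by rewrite /D [r ^+ m.+2]exprS; field; rewrite rm gt_eqF.
elim/ltn_ind: n t tr => -[_ t tr|n IH t tr]; first by rewrite expr0 mulr1 uB.
rewrite /inv_jet normcM normcNr ler_pM ?normc_ge0 ?uB//.
apply: (le_trans (normc_sum _ _ _)).
apply: (@le_trans _ _ (D ^+ n.+1 - (r ^+ n.+1)^-1)); last first.
  by rewrite gerBl invr_ge0 exprn_ge0// ltW.
apply: le_trans (geom n); apply: ler_sum => j _.
rewrite normcM ler_pM ?normc_ge0 ?JM// -inv_jet0.
by apply: IH; rewrite ?normr0// ltnS leq_subr.
Qed.

Lemma shrink_radius (r B M : R) : 0 < r -> 0 <= B -> 0 <= M ->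
  0 < r / (1 + B * M) <= r.
Proof.
move=> r0 B0 M0; have BM0 : 0 <= B * M by exact: mulr_ge0.
apply/andP; split; first by rewrite divr_gt0//; lra.
by rewrite ler_pdivrMr; [rewrite ler_peMr ?(ltW r0)//; lra|lra].
Qed.

Lemma analytic0V f : analytic0 f -> f 0 != 0 ->
  analytic0 (fun t => (f t)^-1).
Proof.
move=> [r [M [J [jJ J0]]]] f0; have M0 := jet_ge0 jJ; have [r0 JE JM] := jJ.
pose b := normc (f 0); have b0 : 0 < b by rewrite normc_gt0.
pose s := Num.min r (r * b / (2 * (M + 1))).
have sr : s <= r by rewrite ge_min lexx.
have s0 : 0 < s.
  by rewrite lt_min r0/= divr_gt0// ?mulr_gt0//; lra.
have low t : `|t| < s -> b / 2 <= normc (f t).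
  move=> ts; have tr := lt_le_trans ts sr.
  have h : `|t| * (M / r) <= b / 2.
    apply: (@le_trans _ _ (r * b / (2 * (M + 1)) * (M / r))).
      rewrite ler_wpM2r ?divr_ge0 ?(ltW r0)// ltW//.
      by apply: (lt_le_trans ts); rewrite ge_min lexx orbT.
    have -> : r * b / (2 * (M + 1)) * (M / r) = b / 2 * (M / (M + 1)).
      by field; rewrite !gt_eqF//; lra.
    rewrite ger_pMr; last by lra.
    by rewrite ler_pdivrMr; lra.
  have := JE 0%N t tr; rewrite !J0 => ->.
  have J1 : normc (t%:C * J 1%N t) <= `|t| * (M / r).
    by rewrite normcM normc_real ler_wpM2l// -[r]expr1 JM.
  have := ler_normcB (f 0) (- (t%:C * J 1%N t)).
  by rewrite normcNr opprK -/b; lra.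
have jJ' := jet_shrink s0 sr (lexx _) jJ.
have uB t : `|t| < s -> normc (f t)^-1 <= (b / 2)^-1.
  move=> /low h; have h0 : 0 < normc (f t) by lra.
  by rewrite normcV lef_pV2 ?posrE//; lra.
have B0 : 0 <= (b / 2)^-1 by rewrite invr_ge0; lra.
have uE t : `|t| < s -> (f t)^-1 * (J 0%N t - 0) = 1.
  move=> /low h; rewrite J0 subr0 mulVf// -normc_gt0; lra.
have /andP[s'0 s's] := shrink_radius s0 B0 M0.
exists (s / (1 + (b / 2)^-1 * M)), (b / 2)^-1, (inv_jet (fun t => (f t)^-1) J).
split=> //; split => // n t ts.
- by apply: (inv_jetE jJ' uE); exact: lt_le_trans s's.
- by apply: (inv_jet_le jJ' B0 uB); exact: lt_le_trans s's.
Qed.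

(** The bounds in [inv_jet_le] are uniform in the point x where the resolvent
    is evaluated, so the difference quotients can be integrated over x. *)
Lemma analytic0_cauchy (nu : probability RT R) f c s : analytic0 f ->
  0 < c -> 0 < s -> (forall t, `|t| < s -> c <= complex.Im (f t)) ->
  analytic0 (fun t => cauchy_transform nu (f t)).
Proof.
move=> [r [M [J [jJ J0]]]] c0 s0 fc; have M0 := jet_ge0 jJ.
have [r0 _ _] := jJ.
pose r' := Num.min r s.
have r'0 : 0 < r' by rewrite lt_min r0 s0.
have r's : r' <= s by rewrite ge_min lexx orbT.
have jJ' := jet_shrink r'0 (_ : r' <= r) (lexx M) jJ.
have {jJ'}jJ' : jet r' M J by apply: jJ'; rewrite ge_min lexx.
have B0 : 0 <= c^-1 by rewrite invr_ge0 ltW.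
have If t : `|t| < r' -> 0 < complex.Im (f t).
  by move=> tr; apply: (lt_le_trans c0); apply: fc; exact: lt_le_trans r's.
pose u x t := resolvent (f t) x.
have uB x t : `|t| < r' -> normc (u x t) <= c^-1.
  move=> tr; apply: (le_trans (normc_resolvent x (If t tr))).
  by rewrite lef_pV2 ?posrE ?If// fc// (lt_le_trans tr).
have uE x t : `|t| < r' -> u x t * (J 0%N t - x%:C) = 1.
  by move=> tr; rewrite J0 mulVf// resolvent_neq0// If.
have bq n : bounded_mfun (fun x => inv_coef (u x 0) (J ^~ 0) n).
  elim/ltn_ind: n => -[|n] IH.
    under eq_fun do rewrite inv_coef0.
    by apply: bounded_mfun_resolvent; apply: If; rewrite normr0.
  under eq_fun do rewrite inv_coefS.
  apply: bounded_mfunM.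
    apply: bounded_mfunN; apply: bounded_mfun_resolvent; apply: If.
    by rewrite normr0.
  apply: bounded_mfun_sum => i; apply: bounded_mfunM.
    by apply: IH; rewrite ltnS leq_subr.
  exact: bounded_mfun_cst.
have bu n t : `|t| < r' -> bounded_mfun (fun x => inv_jet (u x) J n t).
  move=> tr; case: n => [|n]; first by apply: bounded_mfun_resolvent; exact: If.
  rewrite /inv_jet; apply: bounded_mfunM.
    by apply: bounded_mfunN; apply: bounded_mfun_resolvent; exact: If.
  apply: bounded_mfun_sum => i; apply: bounded_mfunM; first exact: bq.
  exact: bounded_mfun_cst.
have /andP[r''0 r''r] := shrink_radius r'0 B0 M0.
exists (r' / (1 + c^-1 * M)), (2 * c^-1).
exists (fun n t => cintegral nu (fun x => inv_jet (u x) J n t)).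
split; last by [].
split=> // n t tr''; have tr := lt_le_trans tr'' r''r.
- rewrite -cintegralZ; last exact: bu.
  have t0 : `|0 : R| < r' by rewrite normr0.
  rewrite -cintegralD; [|exact: bu|]; last first.
    by apply: bounded_mfunM; [exact: bounded_mfun_cst|exact: bu].
  congr cintegral; apply/funext => x.
  exact: (inv_jetE jJ' (uE x)).
- rewrite -mulrA; apply: normc_cintegral_bound; first exact: bu.
  by move=> x; exact: (inv_jet_le jJ' B0 (uB x)).
Qed.

Lemma small_normc (z : C) (K s : R) : 0 < s -> 0 <= K ->
  (forall t, 0 < t -> t < s -> normc z <= t * K) -> z = 0.
Proof.
move=> s0 K0 h; apply/eqP; rewrite -normc_eq0; apply/eqP.
apply: le_anti; rewrite normc_ge0 andbT; apply/ler_addgt0Pr => e e0.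
rewrite add0r; pose t := Num.min (s / 2) (e / (K + 1)).
have t0 : 0 < t by rewrite lt_min divr_gt0//= divr_gt0//; lra.
have ts : t < s by rewrite gt_min; apply/orP; left; lra.
apply: (le_trans (h t t0 ts)).
have : t <= e / (K + 1) by rewrite ge_min lexx orbT.
rewrite ler_pdivlMr; nra.
Qed.

(** Successive values J n 0 vanish by letting t decrease to 0, so
    f t = t^n J n t for every n, on both sides of 0; the geometric bounds then
    force f to vanish. *)
Lemma analytic0_eq0 f s : analytic0 f -> 0 < s ->
  (forall t, 0 < t -> t < s -> f t = 0) ->
  exists2 s', 0 < s' & forall t, `|t| < s' -> f t = 0.
Proof.
move=> [r [M [J [jJ J0]]]] s0 f0; have M0 := jet_ge0 jJ.
have [r0 JE JM] := jJ; exists r => // t tr.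
pose p := Num.min r s.
have p0 : 0 < p by rewrite lt_min r0 s0.
have key n : (forall t, 0 < t -> t < p -> J n t = 0) -> J n 0 = 0.
  move=> Jn; apply: (@small_normc _ (M / r ^+ n.+1) p) => //.
    by rewrite divr_ge0// exprn_ge0// ltW.
  move=> x x0 xp; have xr : `|x| < r.
    by rewrite gtr0_norm// (lt_le_trans xp)// ge_min lexx.
  have /eqP := JE n x xr; rewrite Jn// eq_sym addr_eq0 => /eqP->.
  by rewrite normcNr normcM normc_real gtr0_norm// ler_wpM2l ?(ltW x0)// JM.
have all n : forall t, 0 < t -> t < p -> J n t = 0.
  elim: n => [|n IH] x x0 xp.
    by rewrite J0 f0// (lt_le_trans xp)// ge_min lexx orbT.
  have xr : `|x| < r by rewrite gtr0_norm// (lt_le_trans xp)// ge_min lexx.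
  have /esym/eqP := JE n x xr; rewrite (key n IH) (IH x)// add0r mulf_eq0.
  by move=> /orP[|/eqP//]; rewrite -normc_eq0 normc_real normr_eq0 gt_eqF.
have ft n : f t = t%:C ^+ n * J n t.
  elim: n => [|n IH]; first by rewrite expr0 mul1r J0.
  have Jn0 : J n 0 = 0 by apply: key; exact: all.
  by rewrite IH (JE n t tr) Jn0 add0r exprSr mulrA.
apply/eqP; rewrite -normc_eq0; apply/eqP; apply: le_anti.
rewrite normc_ge0 andbT.
have lim : M * (`|t| / r) ^+ n @[n --> \oo] --> (0 : R).
  rewrite -(mulr0 M); apply: cvgM; first exact: cvg_cst.
  apply: cvg_expr; rewrite normrM normr_id normfV (gtr0_norm r0).
  by rewrite ltr_pdivrMr// mul1r.
apply: (ler_cvg_to (cvg_cst (normc (f t))) lim); apply: nearW => n.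
rewrite (ft n) normcM normcX normc_real expr_div_n mulrCA.
by rewrite ler_wpM2l ?exprn_ge0 ?JM.
Qed.

(** Local vanishing propagates down from infinity: the infimum of the y above
    which f vanishes cannot be positive. *)
Lemma analytic_continuation (f : R -> C) (Y : R) :
  (forall y, 0 < y -> analytic0 (fun t => f (y + t))) ->
  (forall y, Y < y -> f y = 0) -> forall y, 0 < y -> f y = 0.
Proof.
move=> af fY y0 y00.
pose S := [set y : R | 0 <= y /\ forall x, y < x -> f x = 0].
have Slb : lbound S 0 by move=> y [].
have S0 : S !=set0.
  exists (Num.max Y 0); split; first by rewrite le_max lexx orbT.
  by move=> x; rewrite gt_max => /andP[Yx _]; exact: fY.
have iS : has_inf S by split => //; exists 0.
have i0 : 0 <= inf S by exact: lb_le_inf.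
have fi x : inf S < x -> f x = 0.
  move=> /(inf_lt iS.1)[y [_ Sy] yx]; exact: Sy.
move: i0; rewrite le_eqVlt => /orP[/eqP E|i0]; first by apply: fi; rewrite -E.
have [s s0 hs] : exists2 s, 0 < s & forall t, `|t| < s -> f (inf S + t) = 0.
  apply: (analytic0_eq0 (af _ i0) ltr01) => t t0 _.
  by apply: fi; rewrite ltrDl.
pose d := Num.min (s / 2) (inf S).
have d0 : 0 < d by rewrite lt_min i0 divr_gt0.
have ds : d <= s / 2 by rewrite ge_min lexx.
suff Sd : S (inf S - d).
  by have := ge_inf iS.2 Sd => h; exfalso; lra.
split; first by rewrite subr_ge0 ge_min lexx orbT.
move=> x xd; have [xi|/fi//] := leP x (inf S).
rewrite -(subrK (inf S) x) addrC; apply: hs.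
by rewrite ler0_norm; lra.
Qed.

End analytic.

Section root.
Variable R : realType.
Notation C := R[i].
Notation prob := (probability (measurableTypeR R) R).
Implicit Types (mu nu : prob).

Lemma Im_subordination mu N (y : R) : (0 < N)%N -> 0 < y ->
  y <= complex.Im (subordination mu N (iy y)).
Proof.
move=> N0 y0; rewrite /subordination.
have : y <= complex.Im (F_transform mu (iy y)) by exact: (@Im_F_transform_ge _ mu (iy y) y0).
move: (F_transform _ _) => F Fy.
have NE : N%:R^-1 = (N%:R^-1)%:C :> C by rewrite fmorphV rmorph_nat.
rewrite NE Imc_add !Imc_mul Rec_add Imc_add Rec_opp Imc_opp !Rec_real !Imc_real /iy /=.
have N1 : 0 <= (N%:R^-1 : R) <= 1.
  by rewrite invr_ge0 ler0n invf_le1 ?ltr0n// ler1n.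
case/andP: N1; set n := N%:R^-1 => n0 n1.
have := mulr_ge0 (_ : 0 <= 1 - n) (_ : 0 <= complex.Im F - y).
by rewrite !subr_ge0 => /(_ n1 Fy); lra.
Qed.

(** Subordination holds on the whole imaginary axis, and not only far out
    where the Voiculescu transforms live. *)
Lemma subordination_everywhere nu N mu : (1 < N)%N -> is_free_power nu N mu ->
  forall y, 0 < y ->
  cauchy_transform nu (subordination mu N (iy y)) = cauchy_transform mu (iy y).
Proof.
move=> N1 P y y0; apply/eqP; rewrite -subr_eq0; apply/eqP.
pose f y := cauchy_transform nu (subordination mu N (iy y)) +
            -1 * cauchy_transform mu (iy y).
suff: f y = 0 by rewrite /f mulN1r.
have [Y hY] := subordination_far N1 P.
apply: (@analytic_continuation _ f Y) => // [x x0|x /hY E]; last first.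
  by rewrite /f E mulN1r subrr.
have x20 : 0 < x / 2 by lra.
have low (t : R) : `|t| < x / 2 -> x / 2 <= x + t.
  by move=> /ltr_normlP[]; lra.
have aG : analytic0 (fun t => cauchy_transform mu (iy (x + t))).
  by apply: (analytic0_cauchy mu (analytic0_iy x) x20 x20) => t /low.
apply: analytic0D; last exact: analytic0Z.
apply: (@analytic0_cauchy _ nu _ (x / 2) (x / 2)) => //; last first.
  move=> t /low tx; apply: (le_trans tx); apply: Im_subordination.
    exact: ltnW.
  by lra.
apply: analytic0D.
  under eq_fun do rewrite mulrC.
  by apply: analytic0Z; exact: analytic0_iy.
apply: analytic0Z; apply: (analytic0V aG).
by rewrite addr0; exact: cauchy_neq0.
Qed.

End root.

(** * The Pick kernel of the Voiculescu transform *)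

Section complex_limits.
Variable R : realType.
Notation C := R[i].
Implicit Types (u w : nat -> C) (l k : C).

Definition ccvg u l :=
  complex.Re (u n) @[n --> \oo] --> complex.Re l /\
  complex.Im (u n) @[n --> \oo] --> complex.Im l.

Lemma ccvg_cst l : ccvg (fun=> l) l.
Proof. by split; exact: cvg_cst. Qed.

Lemma ccvg_real (u : nat -> R) (l : R) :
  u n @[n --> \oo] --> l -> ccvg (fun n => (u n)%:C) l%:C.
Proof. by move=> ul; split => //=; exact: cvg_cst. Qed.

Lemma ccvgD u w l k : ccvg u l -> ccvg w k -> ccvg (fun n => u n + w n) (l + k).
Proof.
move=> [u1 u2] [w1 w2]; split.
- rewrite Rec_add (_ : (fun n => _) = (fun n => complex.Re (u n) + complex.Re (w n)));
    first exact: cvgD.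
  by apply/funext => n; rewrite Rec_add.
- rewrite Imc_add (_ : (fun n => _) = (fun n => complex.Im (u n) + complex.Im (w n)));
    first exact: cvgD.
  by apply/funext => n; rewrite Imc_add.
Qed.

Lemma ccvgM u w l k : ccvg u l -> ccvg w k -> ccvg (fun n => u n * w n) (l * k).
Proof.
move=> [u1 u2] [w1 w2]; split.
- rewrite Rec_mul (_ : (fun n => _) = (fun n => complex.Re (u n) * complex.Re (w n)
      - complex.Im (u n) * complex.Im (w n))).
    by apply: cvgB; exact: cvgM.
  by apply/funext => n; rewrite Rec_mul.
- rewrite Imc_mul (_ : (fun n => _) = (fun n => complex.Re (u n) * complex.Im (w n)
      + complex.Im (u n) * complex.Re (w n))).
    by apply: cvgD; exact: cvgM.
  by apply/funext => n; rewrite Imc_mul.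
Qed.

Lemma ccvgN u l : ccvg u l -> ccvg (fun n => - u n) (- l).
Proof.
move=> ul; rewrite -mulN1r (_ : (fun n => _) = (fun n => -1 * u n)).
  by apply: ccvgM => //; exact: ccvg_cst.
by apply/funext => n; rewrite mulN1r.
Qed.

Lemma ccvgB u w l k : ccvg u l -> ccvg w k -> ccvg (fun n => u n - w n) (l - k).
Proof. by move=> ul wk; apply: ccvgD => //; exact: ccvgN. Qed.

Lemma ccvgJ u l : ccvg u l -> ccvg (fun n => conjc (u n)) (conjc l).
Proof.
move=> [u1 u2]; split.
- rewrite Rec_conj (_ : (fun n => _) = (fun n => complex.Re (u n)))//.
  by apply/funext => n; rewrite Rec_conj.
- rewrite Imc_conj (_ : (fun n => _) = (fun n => - complex.Im (u n)));
    first exact: cvgN.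
  by apply/funext => n; rewrite Imc_conj.
Qed.

Lemma ccvg_abs2 u l : ccvg u l -> abs2 (u n) @[n --> \oo] --> abs2 l.
Proof.
move=> [u1 u2]; rewrite /abs2; apply: cvgD.
- by rewrite expr2; under eq_fun do rewrite expr2; exact: cvgM.
- by rewrite expr2; under eq_fun do rewrite expr2; exact: cvgM.
Qed.

Lemma ccvgV u l : l != 0 -> ccvg u l -> ccvg (fun n => (u n)^-1) l^-1.
Proof.
move=> l0 ul; have ua := ccvg_abs2 ul; case: ul => u1 u2.
have uV : (abs2 (u n))^-1 @[n --> \oo] --> (abs2 l)^-1.
  by apply: cvgV => //; rewrite abs2_eq0.
split.
- rewrite Rec_inv (_ : (fun n => _) = (fun n => complex.Re (u n) / abs2 (u n)));
    first exact: cvgM.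
  by apply/funext => n; rewrite Rec_inv.
- rewrite Imc_inv (_ : (fun n => _) = (fun n => - complex.Im (u n) / abs2 (u n))).
    by apply: cvgM => //; exact: cvgN.
  by apply/funext => n; rewrite Imc_inv.
Qed.

End complex_limits.

Section pick_inequality.
Variable R : realType.
Notation C := R[i].
Notation RT := (measurableTypeR R).
Notation prob := (probability RT R).
Variable mu : prob.

Notation v := (fun y : R => F_transform mu (iy y)).

Definition defect (y : R) : C := iy y - F_transform mu (iy y).

(** With phi the Voiculescu transform of mu and v = F_mu (i y), the defect is
    phi v and this is the Pick kernel of - phi at the points v. *)
Definition pick_kernel (y s : R) : C :=
  - (defect y - conjc (defect s)) /
    (F_transform mu (iy y) - conjc (F_transform mu (iy s))).

Definition pick_approx (N : nat) (y s : R) : C :=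
  - (defect y - conjc (defect s)) /
    (subordination mu N (iy y) - conjc (subordination mu N (iy s))).

Lemma Im_F_iy y : 0 < y -> y <= complex.Im (F_transform mu (iy y)).
Proof. by move=> y0; exact: (@Im_F_transform_ge _ mu (iy y) y0). Qed.

Lemma pick_den_neq0 y s : 0 < y -> 0 < s ->
  F_transform mu (iy y) - conjc (F_transform mu (iy s)) != 0.
Proof.
move=> y0 s0; apply: Im_gt0_neq0; rewrite Imc_add Imc_opp Imc_conj opprK.
by have := Im_F_iy y0; have := Im_F_iy s0; lra.
Qed.

Lemma natr_complex (N : nat) : (N%:R : C) = (N%:R : R)%:C.
Proof. by rewrite rmorph_nat. Qed.

Lemma subordinationE N y : (0 < N)%N -> subordination mu N (iy y) =
  F_transform mu (iy y) + (N%:R^-1 : R)%:C * defect y.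
Proof.
move=> N0; rewrite /subordination /defect natr_complex -fmorphV/=.
by ring.
Qed.

Section root.
Variables (N : nat) (nu : prob).
Hypotheses (N1 : (1 < N)%N) (nuN : is_free_power nu N mu).

Let N0 : (0 < N)%N. Proof. exact: ltnW. Qed.

Let w y := subordination mu N (iy y).

(** This is F_nu (w y) / (w y - x) - 1 by subordination. It has integral 0
    against nu, and the resolvent identity computes its inner products. *)
Let g y (x : R) : C := F_transform mu (iy y) * resolvent (w y) x - 1.

Let Im_w y : 0 < y -> 0 < complex.Im (w y).
Proof. by move=> y0; apply: (lt_le_trans y0); exact: Im_subordination. Qed.

Let bounded_g y : 0 < y -> bounded_mfun (g y).
Proof.
move=> y0; apply: bounded_mfunB; last exact: bounded_mfun_cst.
apply: bounded_mfunM; first exact: bounded_mfun_cst.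
exact/bounded_mfun_resolvent/Im_w.
Qed.

Let den_neq0 y s : 0 < y -> 0 < s -> w y - conjc (w s) != 0.
Proof.
move=> /Im_w y0 /Im_w s0; apply: Im_gt0_neq0.
by rewrite Imc_add Imc_opp Imc_conj opprK; lra.
Qed.

Let gram y s : 0 < y -> 0 < s ->
  N%:R * cinner nu (g y) (g s) = pick_approx N y s.
Proof.
move=> y0 s0.
set vy := F_transform mu (iy y); set vs := F_transform mu (iy s).
have Vy : vy != 0.
  by apply: Im_gt0_neq0; exact: lt_le_trans y0 (Im_F_iy y0).
have Vs : conjc vs != 0.
  rewrite conjc_eq0.
  by apply: Im_gt0_neq0; exact: lt_le_trans s0 (Im_F_iy s0).
have [by_ bs] := (bounded_mfun_resolvent (Im_w y0), bounded_mfun_resolvent (Im_w s0)).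
have bsJ := bounded_mfunJ bs.
have Gy : cintegral nu (resolvent (w y)) = vy^-1.
  rewrite -cauchyE (subordination_everywhere N1 nuN)//.
  by rewrite /vy /F_transform invrK.
have Gs : cintegral nu (fun x => conjc (resolvent (w s) x)) = (conjc vs)^-1.
  rewrite cintegralJ// -cauchyE (subordination_everywhere N1 nuN)//.
  by rewrite /vs /F_transform conjc_inv invrK.
have dn := den_neq0 y0 s0.
pose I := cintegral nu (fun x => resolvent (w y) x * conjc (resolvent (w s) x)).
have bI : bounded_mfun (fun x => resolvent (w y) x * conjc (resolvent (w s) x)).
  exact: bounded_mfunM.
have IE : - (w y - conjc (w s)) * I = vy^-1 - (conjc vs)^-1.
  rewrite -Gy -Gs -cintegralB// -cintegralZ//; congr cintegral.
  apply/funext => x; rewrite /resolvent conjc_inv conjcB conjc_real.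
  have r1 := resolvent_neq0 x (Im_w y0).
  have r2 : conjc (w s) - x%:C != 0.
    by rewrite -(conjc_real x) -conjcB conjc_eq0 resolvent_neq0// Im_w.
  by field; rewrite r1 r2.
have -> : cinner nu (g y) (g s) = vy * conjc vs * I - 1.
  rewrite /cinner.
  have -> : (fun x => g y x * conjc (g s x)) =
    (fun x => vy * conjc vs * (resolvent (w y) x * conjc (resolvent (w s) x))
      + (- vy * resolvent (w y) x + (- conjc vs * conjc (resolvent (w s) x) + 1))).
    by apply/funext => x; rewrite /g conjcB conjcM conjc1 -/vy -/vs; ring.
  have b1 := bounded_mfun_cst (1 : C).
  have bA := bounded_mfunZ (vy * conjc vs) bI.
  have bB := bounded_mfunZ (- vy) by_; have bC := bounded_mfunZ (- conjc vs) bsJ.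
  rewrite (cintegralD nu bA (bounded_mfunD bB (bounded_mfunD bC b1))).
  rewrite (cintegralD nu bB (bounded_mfunD bC b1)) (cintegralD nu bC b1).
  rewrite (cintegralZ nu _ bI) (cintegralZ nu _ by_) (cintegralZ nu _ bsJ).
  rewrite cintegral_cst Gy Gs -/I.
  by field; rewrite Vy Vs.
have -> : I = - (vy^-1 - (conjc vs)^-1) / (w y - conjc (w s)).
  by rewrite -IE; field.
rewrite /pick_approx -/(w y) -/(w s).
have NE : N%:R != 0 :> R by rewrite pnatr_eq0 -lt0n.
have wE t : w t = F_transform mu (iy t) + (N%:R^-1 : R)%:C * defect t.
  exact: subordinationE.
have NC : (N%:R : C) != 0 by rewrite pnatr_eq0 -lt0n.
have NVC : ((N%:R^-1 : R)%:C : C) = N%:R^-1 by rewrite natr_complex -fmorphV.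
have key : w y - conjc (w s) = vy - conjc vs +
    N%:R^-1 * (defect y - conjc (defect s)).
  by rewrite !wE conjcD conjcM conjc_real NVC -/vy -/vs; ring.
apply: (mulIf dn); rewrite mulfVK//.
transitivity (N%:R * (vy - conjc vs - (w y - conjc (w s)))).
  by field; rewrite dn Vy Vs.
by rewrite key; field.
Qed.

(** The combination g s - 2 g (2 s) kills the leading term of g s for large s and
    keeps a multiple of the function x, the one against which g y is to be
    paired. *)
Lemma pick_approx_inequality y s : 0 < y -> 0 < s ->
  abs2 (pick_approx N y s - 2 * pick_approx N y (2 * s)) <=
  complex.Re (pick_approx N y y) *
  complex.Re (pick_approx N s s - 2 * pick_approx N s (2 * s)
    - 2 * pick_approx N (2 * s) s + 4 * pick_approx N (2 * s) (2 * s)).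
Proof.
move=> y0 s0; have s20 : 0 < 2 * s by lra.
rewrite -!gram//.
move: (bounded_g y0) (bounded_g s0) (bounded_g s20).
move: (g y) (g s) (g (2 * s)) => f a b bf ba bb.
have bh : bounded_mfun (fun x => 1 * a x + (- 2) * b x).
  by apply: bounded_mfunD; exact: bounded_mfunZ.
have := cinner_cauchy_schwarz nu bf bh.
rewrite (cinnerDZl _ _ _ ba bb bh) !(cinnerDZr _ _ _ ba bb)//.
move: (cinner _ f a) (cinner _ f b) (cinner _ f f) => fa fb ff.
move: (cinner _ a a) (cinner _ a b) (cinner _ b a) (cinner _ b b) => aa ab b_a b_b.
have -> : conjc (- 2 : C) = - 2.
  have <- : (- 2 : R)%:C = - 2 :> C by rewrite rmorphN rmorph_nat.
  by rewrite conjc_real.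
rewrite conjc1 => cs.
have -> : N%:R * fa - 2 * (N%:R * fb) = N%:R * (1 * fa + - 2 * fb) by ring.
have -> : N%:R * aa - 2 * (N%:R * ab) - 2 * (N%:R * b_a) + 4 * (N%:R * b_b) =
   N%:R * (1 * (1 * aa + - 2 * ab) + - 2 * (1 * b_a + - 2 * b_b)) by ring.
have nN : 0 < (N%:R : R) by rewrite ltr0n.
have RN (z : C) : complex.Re (N%:R * z) = N%:R * complex.Re z.
  by rewrite natr_complex Rec_mul/= mul0r subr0.
have AN : abs2 (N%:R : C) = N%:R ^+ 2.
  by rewrite natr_complex /abs2 /= expr0n/= addr0.
rewrite abs2M !RN AN mulrACA -expr2.
by rewrite ler_pM2l ?exprn_gt0.
Qed.

End root.

Hypothesis muID : free_infinitely_divisible mu.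

(** Letting the number of convolution roots tend to infinity turns the Gram
    kernels of the roots into the Pick kernel of mu. *)
Lemma pick_inequality y s : 0 < y -> 0 < s ->
  abs2 (pick_kernel y s - 2 * pick_kernel y (2 * s)) <=
  complex.Re (pick_kernel y y) *
  complex.Re (pick_kernel s s - 2 * pick_kernel s (2 * s)
    - 2 * pick_kernel (2 * s) s + 4 * pick_kernel (2 * s) (2 * s)).
Proof.
move=> y0 s0; have s20 : 0 < 2 * s by lra.
have ineq n : abs2 (pick_approx n.+2 y s - 2 * pick_approx n.+2 y (2 * s)) <=
  complex.Re (pick_approx n.+2 y y) *
  complex.Re (pick_approx n.+2 s s - 2 * pick_approx n.+2 s (2 * s)
    - 2 * pick_approx n.+2 (2 * s) s + 4 * pick_approx n.+2 (2 * s) (2 * s)).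
  have [nu nuN] := muID (isT : (0 < n.+2)%N).
  exact: (pick_approx_inequality (nu := nu)).
have wl t : ccvg (fun n => subordination mu n.+2 (iy t)) (v t).
  rewrite -[X in ccvg _ X]addr0 -[X in ccvg _ (_ + X)](mul0r (defect t)).
  rewrite (_ : (fun n => _) =
      (fun n => v t + (n.+2%:R^-1 : R)%:C * defect t)); last first.
    by apply/funext => n; rewrite subordinationE.
  apply: ccvgD; first exact: ccvg_cst.
  apply: ccvgM; last exact: ccvg_cst.
  apply: ccvg_real.
  have := @cvg_harmonic R; rewrite -(cvg_shiftS (harmonic : nat -> R)).
  exact.
have pl a b : 0 < a -> 0 < b ->
    ccvg (fun n => pick_approx n.+2 a b) (pick_kernel a b).
  move=> a0 b0; apply: ccvgM; first exact: ccvg_cst.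
  apply: ccvgV; first exact: pick_den_neq0.
  by apply: ccvgB => //; exact: ccvgJ.
have pZ c a b : 0 < a -> 0 < b ->
    ccvg (fun n => c * pick_approx n.+2 a b) (c * pick_kernel a b).
  by move=> a0 b0; apply: ccvgM; [exact: ccvg_cst|exact: pl].
have l1 := ccvg_abs2 (ccvgB (pl y s y0 s0) (pZ 2 y (2 * s) y0 s20)).
have [l2 _] := pl y y y0 y0.
have [l3 _] := ccvgD (ccvgB (ccvgB (pl s s s0 s0) (pZ 2 s (2 * s) s0 s20))
  (pZ 2 (2 * s) s s20 s0)) (pZ 4 (2 * s) (2 * s) s20 s20).
exact: (ler_cvg_to l1 (cvgM l2 l3) (nearW _ ineq)).
Qed.

Lemma Re_pick_diag y : 0 < y -> 0 <= complex.Re (pick_kernel y y) <= 1.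
Proof.
move=> y0; have vy := Im_F_iy y0.
have -> : complex.Re (pick_kernel y y) =
    1 - y / complex.Im (F_transform mu (iy y)).
  rewrite /pick_kernel /defect; move: vy; move: (F_transform _ _) => [a b] /= vy.
  have b0 : b != 0 by lra.
  have -> : a + - a = 0 by ring.
  rewrite expr0n/= add0r.
  by field; rewrite b0 opprK; lra.
have b0 : 0 < complex.Im (F_transform mu (iy y)) by lra.
rewrite subr_ge0 ler_pdivrMr// mul1r vy gerBl divr_ge0//; lra.
Qed.

End pick_inequality.

(** * The fourth moment bounds the distance to the semicircle equation *)

Section moments.
Variable R : realType.
Notation C := R[i].
Notation RT := (measurableTypeR R).
Variable mu : probability RT R.
Hypotheses (int4 : mu.-integrable [set: RT] (EFin \o (fun x : R => x ^+ 4)))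
  (mean0 : \int[mu]_x x = 0) (var1 : \int[mu]_x (x ^+ 2) = 1).

(** The moments of mu with the weight that the Cauchy transform at i / h puts on
    them; unlike the moments, they express that transform exactly. *)
Definition damped_moment (k : nat) (h : R) : R :=
  \int[mu]_x (x ^+ k / (1 + h ^+ 2 * x ^+ 2)).

Let den_gt0 (h x : R) : 0 < 1 + h ^+ 2 * x ^+ 2.
Proof. by rewrite ltr_pwDl// mulr_ge0// sqr_ge0. Qed.

Let den_ge1 (h x : R) : 1 <= 1 + h ^+ 2 * x ^+ 2.
Proof. by rewrite lerDl mulr_ge0// sqr_ge0. Qed.

Let integrable_bound :
  mu.-integrable [set: RT] (EFin \o (fun x : R => 1 + x ^+ 4)).
Proof.
under [X in _.-integrable _ X]eq_fun do rewrite /= EFinD.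
apply: integrableD => //.
by apply: (@bounded_integrable _ _ _ 1) => // x; rewrite normr1.
Qed.

Let pow_le (k : nat) (x : R) : (k <= 4)%N -> `|x ^+ k| <= 1 + x ^+ 4.
Proof.
move=> k4; rewrite normrX.
have -> : x ^+ 4 = `|x| ^+ 4 by rewrite -normrX ger0_norm// (exprM x 2 2) sqr_ge0.
have := normr_ge0 x; move: `|x| => a a0.
have a4 : 0 <= a ^+ 4 by rewrite exprn_ge0.
have [a1|a1] := leP a 1.
  by apply: (@le_trans _ _ 1); [exact: exprn_ile1|rewrite lerDl].
apply: (@le_trans _ _ (a ^+ 4)); last by rewrite lerDr.
by apply: ler_weXn2l => //; exact: ltW.
Qed.

Let measurable_pow (k : nat) : measurable_fun [set: RT] (fun x : R => x ^+ k).
Proof. by apply: continuous_measurable_fun; exact: exprn_continuous. Qed.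

Let measurable_damped k h :
  measurable_fun [set: RT] (fun x : R => x ^+ k / (1 + h ^+ 2 * x ^+ 2)).
Proof.
apply: continuous_measurable_fun => x; apply: cvgM.
  exact: exprn_continuous.
apply: cvgV; first by rewrite gt_eqF.
apply: cvgD; first exact: cvg_cst.
by apply: cvgM; [exact: cvg_cst|exact: exprn_continuous].
Qed.

Let damped_le k (h x : R) :
  `|x ^+ k / (1 + h ^+ 2 * x ^+ 2)| <= `|x ^+ k|.
Proof.
rewrite normrM normfV (gtr0_norm (den_gt0 h x)) ler_pdivrMr//.
by rewrite ler_peMr.
Qed.

Let integrable_damped k h : (k <= 4)%N -> mu.-integrable [set: RT]
  (EFin \o (fun x : R => x ^+ k / (1 + h ^+ 2 * x ^+ 2))).
Proof.
move=> k4; apply: le_integrable integrable_bound => //.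
  by apply/measurable_EFinP; exact: measurable_damped.
move=> x _ /=; rewrite lee_fin; apply: (le_trans (damped_le _ _ _)).
by apply: (le_trans (pow_le _ k4)); exact: ler_norm.
Qed.

Lemma damped_moment_cvg k (h : nat -> R) : (k <= 4)%N ->
  h n @[n --> \oo] --> (0 : R) ->
  damped_moment k (h n) @[n --> \oo] --> \int[mu]_x (x ^+ k).
Proof.
move=> k4 h0; apply: Rintegral_dominated_cvg integrable_bound _.
- by move=> n; exact: measurable_damped.
- exact: measurable_pow.
- move=> x; suff : x ^+ k / (1 + h n ^+ 2 * x ^+ 2) @[n --> \oo] -->
      x ^+ k / (1 + 0 ^+ 2 * x ^+ 2).
    by rewrite expr0n/= mul0r addr0 divr1.
  apply: cvgM; first exact: cvg_cst.
  apply: cvgV; first by rewrite gt_eqF.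
  apply: cvgD; first exact: cvg_cst.
  apply: cvgM; last exact: cvg_cst.
  by rewrite expr2; under eq_fun do rewrite expr2; exact: cvgM.
- move=> n x; exact: le_trans (damped_le _ _ _) (pow_le _ k4).
Qed.

(** From 1 / (1 + h^2 x^2) = 1 - h^2 x^2 / (1 + h^2 x^2). *)
Lemma damped_momentD k (h : R) : (k <= 2)%N -> damped_moment k h =
  \int[mu]_x (x ^+ k) - h ^+ 2 * damped_moment k.+2 h.
Proof.
move=> k2; have k4 : (k <= 4)%N by exact: leq_trans k2 _.
have i1 := @integrable_damped k.+2 h k2.
have i0 := @integrable_damped k 0 k4.
rewrite /damped_moment -RintegralZl//.
have -> : \int[mu]_x (x ^+ k) = \int[mu]_x (x ^+ k / (1 + 0 ^+ 2 * x ^+ 2)).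
  by apply: eq_Rintegral => x _; rewrite expr0n/= mul0r addr0 divr1.
rewrite -RintegralB//; last first.
  by under [X in _.-integrable _ X]eq_fun do rewrite /= EFinM; exact: integrableZl.
apply: eq_Rintegral => x _; rewrite expr0n/= mul0r addr0 divr1.
have := den_gt0 h x => d0.
by rewrite [x ^+ k.+2]exprS [x ^+ k.+1]exprS; field; rewrite exprMn gt_eqF.
Qed.

Let p h := damped_moment 2 h.
Let r h := damped_moment 3 h.
Let q h := damped_moment 4 h.

Let pE h : p h = 1 - h ^+ 2 * q h.
Proof. by rewrite /p damped_momentD// var1. Qed.

Lemma cauchy_iy (h : R) : 0 < h -> cauchy_transform mu (iy h^-1) =
  (h ^+ 4 * r h) +i* (- h * (1 - h ^+ 2 * p h)).
Proof.
move=> h0; have hn : h != 0 by rewrite gt_eqF.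
have E (x : R) : resolvent (iy h^-1) x =
    (- h ^+ 2 * (x ^+ 1 / (1 + h ^+ 2 * x ^+ 2))) +i*
    (- h * (x ^+ 0 / (1 + h ^+ 2 * x ^+ 2))).
  have d0 := den_gt0 h x.
  rewrite /resolvent; apply: complexP; rewrite ?Rec_inv ?Imc_inv /abs2 Im_subC Re_subC /=.
    by rewrite expr1; field; rewrite exprMn (gt_eqF d0) hn.
  by rewrite expr0; field; rewrite exprMn (gt_eqF d0) hn.
rewrite cauchyE (funext E); apply: complexP; rewrite /=.
  transitivity (- h ^+ 2 * damped_moment 1 h).
    by rewrite /damped_moment -RintegralZl//; exact: integrable_damped.
  rewrite damped_momentD// (_ : \int[mu]_x (x ^+ 1) = 0); last first.
    by rewrite -[RHS]mean0; apply: eq_Rintegral => x _; rewrite expr1.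
  by rewrite /r; ring.
transitivity (- h * damped_moment 0 h).
  by rewrite /damped_moment -RintegralZl//; exact: integrable_damped.
rewrite damped_momentD// (_ : \int[mu]_x (x ^+ 0) = 1)//.
by rewrite -[RHS](Rintegral_prob_cst mu); apply: eq_Rintegral.
Qed.

Let D h := (1 - h ^+ 2 * p h) ^+ 2 + h ^+ 6 * r h ^+ 2.

Let D_neq0 h : 0 < h -> D h != 0.
Proof.
move=> h0; have : cauchy_transform mu (iy h^-1) != 0.
  by apply: cauchy_neq0; rewrite /= invr_gt0.
apply: contra_neq => D0; rewrite cauchy_iy//.
move/eqP: D0; rewrite /D paddr_eq0 ?sqr_ge0//; last first.
  by rewrite mulr_ge0// ?sqr_ge0// exprn_ge0// ltW.
rewrite sqrf_eq0 mulf_eq0 !expf_eq0/= (gt_eqF h0)/= => /andP[/eqP-> /eqP->].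
by rewrite !mulr0.
Qed.

Lemma defectE h : 0 < h -> defect mu h^-1 =
  (- h ^+ 2 * r h / D h) +i*
  (h * (h ^+ 2 * p h ^+ 2 + h ^+ 4 * r h ^+ 2 - p h) / D h).
Proof.
move=> h0; have D0 := D_neq0 h0; have hn : h != 0 by rewrite gt_eqF.
rewrite /defect /F_transform cauchy_iy//.
have aE : abs2 ((h ^+ 4 * r h) +i* (- h * (1 - h ^+ 2 * p h))) = h ^+ 2 * D h.
  by rewrite /abs2 /D /=; ring.
apply: complexP.
  rewrite Rec_add Rec_opp Rec_inv aE /=.
  by field; rewrite hn D0.
rewrite Imc_add Imc_opp Imc_inv aE /=.
transitivity ((D h - 1 + h ^+ 2 * p h) / (h * D h)).
  by field; rewrite hn D0.
have -> : D h - 1 + h ^+ 2 * p h =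
    h ^+ 2 * (h ^+ 2 * p h ^+ 2 + h ^+ 4 * r h ^+ 2 - p h) by rewrite /D; ring.
by field; rewrite hn D0.
Qed.

Section vanishing.
Variable h : nat -> R.
Hypotheses (h_gt0 : forall n, 0 < h n) (h_cvg : h n @[n --> \oo] --> (0 : R)).

Let cX (u : nat -> R) (l : R) k : u n @[n --> \oo] --> l ->
  u n ^+ k @[n --> \oo] --> l ^+ k.
Proof.
move=> ul; elim: k => [|k IH]; first by rewrite expr0; under eq_fun do rewrite expr0; exact: cvg_cst.
by rewrite exprS; under eq_fun do rewrite exprS; exact: cvgM.
Qed.

Let m3 := \int[mu]_x (x ^+ 3).
Let m4 := \int[mu]_x (x ^+ 4).

Let cp : p (h n) @[n --> \oo] --> (1 : R).
Proof. by rewrite -var1; exact: damped_moment_cvg. Qed.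

Let cr : r (h n) @[n --> \oo] --> m3.
Proof. exact: damped_moment_cvg. Qed.

Let cq : q (h n) @[n --> \oo] --> m4.
Proof. exact: damped_moment_cvg. Qed.

Let cD : D (h n) @[n --> \oo] --> (1 : R).
Proof.
have -> : 1 = (1 - 0 ^+ 2 * 1) ^+ 2 + 0 ^+ 6 * m3 ^+ 2 :> R by ring.
apply: cvgD.
  apply: cX; apply: cvgB; first exact: cvg_cst.
  by apply: cvgM => //; exact: cX.
by apply: cvgM => //; exact: cX.
Qed.

Lemma defect_cvg : ccvg (fun n => (h n)^-1%:C * defect mu (h n)^-1) (- 'i).
Proof.
split.
- have -> : (fun n => complex.Re ((h n)^-1%:C * defect mu (h n)^-1)) =
     (fun n => - h n * r (h n) / D (h n)).
    apply/funext => n; have hn := h_gt0 n.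
    rewrite defectE// Rec_mul /=.
    by field; rewrite D_neq0// gt_eqF.
  have -> : complex.Re (- 'i : C) = - 0 * m3 / 1 by rewrite /=; ring.
  apply: cvgM; first by apply: cvgM => //; exact: cvgN.
  by apply: cvgV => //; rewrite oner_eq0.
- have -> : (fun n => complex.Im ((h n)^-1%:C * defect mu (h n)^-1)) =
     (fun n => (h n ^+ 2 * p (h n) ^+ 2 + h n ^+ 4 * r (h n) ^+ 2 - p (h n)) / D (h n)).
    apply/funext => n; have hn := h_gt0 n.
    rewrite defectE// Imc_mul /=.
    by field; rewrite D_neq0// gt_eqF.
  have -> : complex.Im (- 'i : C) = (0 ^+ 2 * 1 ^+ 2 + 0 ^+ 4 * m3 ^+ 2 - 1) / 1.
    by rewrite /=; field.
  apply: cvgM; last by apply: cvgV => //; rewrite oner_eq0.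
  apply: cvgB => //; apply: cvgD; apply: cvgM; exact: cX.
Qed.

Lemma Im_defect_cvg :
  (complex.Im (defect mu (h n)^-1) / h n + 1) / h n ^+ 2 @[n --> \oo] -->
  m4 - 1.
Proof.
have -> : (fun n => (complex.Im (defect mu (h n)^-1) / h n + 1) / h n ^+ 2) =
   (fun n => (q (h n) - 2 * p (h n) + p (h n) ^+ 2 + h n ^+ 2 * p (h n) ^+ 2
     + h n ^+ 2 * r (h n) ^+ 2 + h n ^+ 4 * r (h n) ^+ 2) / D (h n)).
  apply/funext => n; have hn := h_gt0 n; have hn0 : h n != 0 by rewrite gt_eqF.
  have Dn := D_neq0 hn.
  rewrite defectE// [complex.Im _]/=.
  transitivity ((D (h n) - p (h n) + h n ^+ 2 * p (h n) ^+ 2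
     + h n ^+ 4 * r (h n) ^+ 2) / (h n ^+ 2 * D (h n))).
    by field; rewrite Dn hn0.
  have -> : D (h n) - p (h n) + h n ^+ 2 * p (h n) ^+ 2
     + h n ^+ 4 * r (h n) ^+ 2 = h n ^+ 2 * (q (h n) - 2 * p (h n) + p (h n) ^+ 2 + h n ^+ 2 * p (h n) ^+ 2
     + h n ^+ 2 * r (h n) ^+ 2 + h n ^+ 4 * r (h n) ^+ 2).
    transitivity (1 - p (h n) + h n ^+ 2 * (- 2 * p (h n) + p (h n) ^+ 2 + h n ^+ 2 * p (h n) ^+ 2
     + h n ^+ 2 * r (h n) ^+ 2 + h n ^+ 4 * r (h n) ^+ 2)); last first.
      by rewrite [X in 1 - X]pE; ring.
    by rewrite /D; ring.
  by field; rewrite Dn hn0.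
have -> : m4 - 1 = (m4 - 2 * 1 + 1 ^+ 2 + 0 ^+ 2 * 1 ^+ 2 + 0 ^+ 2 * m3 ^+ 2
   + 0 ^+ 4 * m3 ^+ 2) / 1 by field.
apply: cvgM; last by apply: cvgV => //; rewrite oner_eq0.
apply: cvgD; last by apply: cvgM; exact: cX.
apply: cvgD; last by apply: cvgM; exact: cX.
apply: cvgD; last by apply: cvgM; exact: cX.
apply: cvgD; last exact: cX.
by apply: cvgB => //; apply: cvgM => //; exact: cvg_cst.
Qed.

End vanishing.

End moments.

Section kernel_algebra.
Variable K : fieldType.
Implicit Types (e v a b alpha beta h i k d A B : K).

Lemma pick_row_expansion e v a b h i : (2 : K) != 0 -> h != 0 ->
  i + h * (v + h * a) != 0 -> 2 * i + h * (v + h / 2 * b) != 0 ->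
  (h^-1) ^+ 2 * (- (e - h * a) / (v - (- (i / h) - h * a))
     - 2 * (- (e - h / 2 * b) / (v - (- (2 * i / h) - h / 2 * b)))) =
  - (i * (b - 2 * a) + (e - h * a) * (v + h / 2 * b)
     - 2 * (e - h / 2 * b) * (v + h * a)) /
  ((i + h * (v + h * a)) * (2 * i + h * (v + h / 2 * b))).
Proof.
move=> n2 h0; set X := i + _; set Y := 2 * i + _ => X0 Y0.
have -> : v - (- (i / h) - h * a) = X / h by rewrite /X; field.
have -> : v - (- (2 * i / h) - h / 2 * b) = Y / h.
  by rewrite /Y; field; rewrite n2 h0.
transitivity (- ((e - h * a) * Y - 2 * (e - h / 2 * b) * X) / (h * (X * Y))).
  by field; rewrite X0 Y0 h0 n2.
have -> : (e - h * a) * Y - 2 * (e - h / 2 * b) * X = h * (i * (b - 2 * a) +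
   (e - h * a) * (v + h / 2 * b) - 2 * (e - h / 2 * b) * (v + h * a)).
  by rewrite /X /Y; field.
by field; rewrite X0 Y0 h0 n2.
Qed.

Lemma geometric_split d k h : k != 0 -> k - h ^+ 2 * d != 0 ->
  d / (k - h ^+ 2 * d) = d / k + h ^+ 2 * (d ^+ 2 / (k * (k - h ^+ 2 * d))).
Proof. by move=> k0 kd; field; rewrite k0 kd. Qed.

(** Here h = 1 / s, and alpha, beta are the rescaled defects at s and 2 s, with
    conjugates a, b. The terms of order h^2 of the alternating sum cancel. At
    order h^4 there remain the corrections A, B to alpha, beta, and the squares
    left by [geometric_split]. *)
Lemma pick_block_expansion alpha beta a b h i A B :
  let d11 := alpha - a in let d12 := alpha - b / 2 in
  let d21 := beta / 2 - a in let d22 := beta - b in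
  (2 : K) != 0 -> (3 : K) != 0 -> h != 0 -> i != 0 ->
  alpha = a + 2 * i * (-1 + h ^+ 2 * A) ->
  beta = b + 2 * i * (-1 + (h / 2) ^+ 2 * B) ->
  2 * i - h ^+ 2 * d11 != 0 -> 3 * i - h ^+ 2 * d12 != 0 ->
  3 * i - h ^+ 2 * d21 != 0 -> 8 * i - h ^+ 2 * d22 != 0 ->
  (h^-1) ^+ 4 *
   (- (h * alpha - h * a) / (i / h - h * alpha - (- (i / h) - h * a))
    - 2 * (- (h * alpha - h / 2 * b) /
            (i / h - h * alpha - (- (2 * i / h) - h / 2 * b)))
    - 2 * (- (h / 2 * beta - h * a) /
            (2 * i / h - h / 2 * beta - (- (i / h) - h * a)))
    + 4 * (- (h / 2 * beta - h / 2 * b) /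
            (2 * i / h - h / 2 * beta - (- (2 * i / h) - h / 2 * b)))) =
  (A - B / 4) / 3
  - (d11 ^+ 2 / (2 * i * (2 * i - h ^+ 2 * d11))
     - 2 * (d12 ^+ 2 / (3 * i * (3 * i - h ^+ 2 * d12)))
     - 2 * (d21 ^+ 2 / (3 * i * (3 * i - h ^+ 2 * d21)))
     + 4 * (d22 ^+ 2 / (8 * i * (8 * i - h ^+ 2 * d22)))).
Proof.
move=> d11 d12 d21 d22 n2 n3 h0 i0 aE bE k11 k12 k21 k22.
have [n4 n8] : (4 : K) != 0 /\ (8 : K) != 0.
  have n4 : (4 : K) != 0 by rewrite (natrM K 2 2) mulf_neq0.
  by split => //; rewrite (natrM K 2 4) mulf_neq0.
have -> : i / h - h * alpha - (- (i / h) - h * a) = (2 * i - h ^+ 2 * d11) / h.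
  by rewrite /d11; field.
have -> : i / h - h * alpha - (- (2 * i / h) - h / 2 * b) =
    (3 * i - h ^+ 2 * d12) / h by rewrite /d12; field; rewrite n2 h0.
have -> : 2 * i / h - h / 2 * beta - (- (i / h) - h * a) =
    (3 * i - h ^+ 2 * d21) / h by rewrite /d21; field; rewrite n2 h0.
have -> : 2 * i / h - h / 2 * beta - (- (2 * i / h) - h / 2 * b) =
    (8 * i - h ^+ 2 * d22) / (2 * h) by rewrite /d22; field; rewrite n2 h0.
have -> : h * alpha - h * a = h * d11 by rewrite /d11; ring.
have -> : h * alpha - h / 2 * b = h * d12 by rewrite /d12; field.
have -> : h / 2 * beta - h * a = h * d21 by rewrite /d21; field.
have -> : h / 2 * beta - h / 2 * b = h / 2 * d22 by rewrite /d22; field.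
transitivity (- (h^-1) ^+ 2 * (d11 / (2 * i - h ^+ 2 * d11)
    - 2 * (d12 / (3 * i - h ^+ 2 * d12)) - 2 * (d21 / (3 * i - h ^+ 2 * d21))
    + 4 * (d22 / (8 * i - h ^+ 2 * d22)))).
  by field; rewrite k11 k12 k21 k22 n2 h0.
rewrite (geometric_split _ k11) ?mulf_neq0//.
rewrite (geometric_split _ k12) ?mulf_neq0//.
rewrite (geometric_split _ k21) ?mulf_neq0//.
rewrite (geometric_split _ k22) ?mulf_neq0//.
set q11 := d11 ^+ 2 / _; set q12 := d12 ^+ 2 / _.
set q21 := d21 ^+ 2 / _; set q22 := d22 ^+ 2 / _.
rewrite /d11 /d12 /d21 /d22 aE bE.
by field; rewrite n2 n3 n8 n4 h0 i0.
Qed.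

End kernel_algebra.

Section moment_bound.
Variable R : realType.
Notation C := R[i].
Notation RT := (measurableTypeR R).
Variable mu : probability RT R.
Hypotheses (int4 : mu.-integrable [set: RT] (EFin \o (fun x : R => x ^+ 4)))
  (mean0 : \int[mu]_x x = 0) (var1 : \int[mu]_x (x ^+ 2) = 1)
  (muID : free_infinitely_divisible mu).

Let h (n : nat) : R := n.+1%:R^-1.
Let h2 (n : nat) : R := h n / 2.

Let h_gt0 n : 0 < h n. Proof. by rewrite invr_gt0. Qed.
Let h2_gt0 n : 0 < h2 n. Proof. by rewrite divr_gt0. Qed.
Let h_cvg : h n @[n --> \oo] --> (0 : R). Proof. exact: cvg_harmonic. Qed.
Let h2_cvg : h2 n @[n --> \oo] --> (0 : R).
Proof. by rewrite -(mul0r (2^-1 : R)); apply: cvgM => //; exact: cvg_cst. Qed.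

Let alpha n := (h n)^-1%:C * defect mu (h n)^-1.
Let beta n := (h2 n)^-1%:C * defect mu (h2 n)^-1.
Let A n := (complex.Im (defect mu (h n)^-1) / h n + 1) / h n ^+ 2.
Let B n := (complex.Im (defect mu (h2 n)^-1) / h2 n + 1) / h2 n ^+ 2.
Let m4 := \int[mu]_x (x ^+ 4).

Let c_alpha : ccvg alpha (- 'i). Proof. exact: defect_cvg. Qed.
Let c_beta : ccvg beta (- 'i). Proof. exact: defect_cvg. Qed.
Let c_A : A n @[n --> \oo] --> m4 - 1. Proof. exact: Im_defect_cvg. Qed.
Let c_B : B n @[n --> \oo] --> m4 - 1. Proof. exact: Im_defect_cvg. Qed.

Let i0 : 'i != 0 :> C. Proof. by rewrite eq_complex /= oner_eq0 andbF. Qed.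
Let n2 : (2 : C) != 0. Proof. by rewrite pnatr_eq0. Qed.
Let n3 : (3 : C) != 0. Proof. by rewrite pnatr_eq0. Qed.
Let conj_i : conjc ('i : C) = - 'i.
Proof. by apply: complexP; rewrite /= ?oppr0. Qed.

Let hC n : (h n)%:C != 0 :> C.
Proof. by rewrite -normc_eq0 normc_real normr_eq0 gt_eqF. Qed.

Let c_h : ccvg (fun n => (h n)%:C) 0. Proof. exact: ccvg_real. Qed.

Let s_gt0 n : 0 < (h n)^-1. Proof. by rewrite invr_gt0. Qed.

Let h2V n : (h2 n)^-1 = 2 * (h n)^-1.
Proof. by rewrite /h2 invf_div. Qed.

Let s2_gt0 n : 0 < 2 * (h n)^-1. Proof. by rewrite mulr_gt0. Qed.

Let iyE (y : R) : iy y = 'i * y%:C.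
Proof. by apply: complexP; rewrite /=; ring. Qed.

Let half_real (x : R) : (x / 2)%:C = x%:C / 2.
Proof. by rewrite rmorphM fmorphV rmorph_nat. Qed.

Let double_real (x : R) : (2 * x)%:C = 2 * x%:C.
Proof. by rewrite rmorphM rmorph_nat. Qed.

Let inv_real (x : R) : (x^-1)%:C = x%:C^-1.
Proof. by rewrite fmorphV. Qed.

Let dE n : defect mu (h n)^-1 = (h n)%:C * alpha n.
Proof. by rewrite /alpha mulrA -rmorphM/= divff ?gt_eqF// mul1r. Qed.

Let d2E n : defect mu (2 * (h n)^-1) = (h n)%:C / 2 * beta n.
Proof.
rewrite -h2V /beta mulrA (_ : (h n)%:C / 2 = (h2 n)%:C).
  by rewrite -rmorphM/= divff ?gt_eqF// mul1r.
exact/esym/half_real.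
Qed.

Let FE n : F_transform mu (iy (h n)^-1) = 'i / (h n)%:C - (h n)%:C * alpha n.
Proof. by rewrite -dE /defect iyE inv_real; ring. Qed.

Let F2E n : F_transform mu (iy (2 * (h n)^-1)) =
  2 * 'i / (h n)%:C - (h n)%:C / 2 * beta n.
Proof. by rewrite -d2E /defect iyE double_real inv_real; ring. Qed.

Let conj_half (z : C) n : conjc ((h n)%:C / 2 * z) = (h n)%:C / 2 * conjc z.
Proof.
rewrite conjcM (_ : (h n)%:C / 2 = (h n / 2)%:C) ?conjc_real//.
Qed.

Let conjdE n : conjc (defect mu (h n)^-1) = (h n)%:C * conjc (alpha n).
Proof. by rewrite dE conjcM conjc_real. Qed.

Let conjd2E n :
  conjc (defect mu (2 * (h n)^-1)) = (h n)%:C / 2 * conjc (beta n).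
Proof. by rewrite d2E conj_half. Qed.

Let conjiV n : conjc ('i / (h n)%:C) = - ('i / (h n)%:C).
Proof. by rewrite -inv_real conjcM conjc_real conj_i mulNr. Qed.

Let conjFE n : conjc (F_transform mu (iy (h n)^-1)) =
  - ('i / (h n)%:C) - (h n)%:C * conjc (alpha n).
Proof. by rewrite FE conjcB conjiV conjcM conjc_real. Qed.

Let conjF2E n : conjc (F_transform mu (iy (2 * (h n)^-1))) =
  - (2 * 'i / (h n)%:C) - (h n)%:C / 2 * conjc (beta n).
Proof.
rewrite F2E conjcB conj_half; congr (_ - _).
rewrite -mulrA conjcM conjiV mulrN; congr (- (_ * _)).
by rewrite -(rmorph_nat (real_complex R)) conjc_real.
Qed.

Section at_point.
Variable y : R.
Hypothesis y0 : 0 < y.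

Let v := F_transform mu (iy y).
Let e := defect mu y.

Let row n := ((h n)^-1%:C) ^+ 2 *
  (pick_kernel mu y (h n)^-1 - 2 * pick_kernel mu y (2 * (h n)^-1)).

Let row_cvg : ccvg row ((1 - e * v) / 2).
Proof.
pose a n := conjc (alpha n); pose b n := conjc (beta n).
have ca : ccvg a 'i by have := ccvgJ c_alpha; rewrite conjcN conj_i opprK.
have cb : ccvg b 'i by have := ccvgJ c_beta; rewrite conjcN conj_i opprK.
have -> : row = (fun n =>
  - ('i * (b n - 2 * a n) + (e - (h n)%:C * a n) * (v + (h n)%:C / 2 * b n)
     - 2 * (e - (h n)%:C / 2 * b n) * (v + (h n)%:C * a n)) /
  (('i + (h n)%:C * (v + (h n)%:C * a n)) *
   (2 * 'i + (h n)%:C * (v + (h n)%:C / 2 * b n)))).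
  apply/funext => n; rewrite /row /pick_kernel conjdE conjd2E conjFE conjF2E.
  rewrite -/(a n) -/(b n) -/e -/v inv_real.
  apply: pick_row_expansion => //.
  - have := pick_den_neq0 mu y0 (s_gt0 n); rewrite conjFE -/v -/(a n).
    apply: contra_neq => E; apply: (mulfI (hC n)); rewrite mulr0 -E.
    by field; rewrite hC.
  - have := pick_den_neq0 mu y0 (s2_gt0 n); rewrite conjF2E -/v -/(b n).
    apply: contra_neq => E; apply: (mulfI (hC n)); rewrite mulr0 -E.
    by field; rewrite ?n2 hC.
have -> : (1 - e * v) / 2 =
  - ('i * ('i - 2 * 'i) + (e - 0 * 'i) * (v + 0 / 2 * 'i)
     - 2 * (e - 0 / 2 * 'i) * (v + 0 * 'i)) /
  (('i + 0 * (v + 0 * 'i)) * (2 * 'i + 0 * (v + 0 / 2 * 'i))).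
  have i2 : 'i * 'i = -1 :> C by rewrite -expr2 sqr_i.
  transitivity ((- ('i * 'i) - e * v) / (- 2 * ('i * 'i))).
    by rewrite i2; field.
  by field; rewrite i0.
have ch2 : ccvg (fun n => (h n)%:C / 2) (0 / 2).
  by apply: ccvgM => //; exact: ccvg_cst.
have c2 := ccvg_cst (2 : C); have ci := ccvg_cst ('i : C).
have ce := ccvg_cst e; have cv := ccvg_cst v.
have X1 := ccvgD cv (ccvgM ch2 cb); have X2 := ccvgD cv (ccvgM c_h ca).
have X3 := ccvgB ce (ccvgM c_h ca); have X4 := ccvgB ce (ccvgM ch2 cb).
apply: ccvgM.
  apply: ccvgN; apply: ccvgB; last exact: ccvgM (ccvgM c2 X4) X2.
  by apply: ccvgD; [exact: ccvgM ci (ccvgB cb (ccvgM c2 ca))|exact: ccvgM].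
apply: ccvgV.
  by rewrite !mul0r !addr0 !mulf_neq0.
exact: ccvgM (ccvgD ci (ccvgM c_h X2)) (ccvgD (ccvgM c2 ci) (ccvgM c_h X1)).
Qed.

Let block n := ((h n)^-1%:C) ^+ 4 *
  (pick_kernel mu (h n)^-1 (h n)^-1 - 2 * pick_kernel mu (h n)^-1 (2 * (h n)^-1)
   - 2 * pick_kernel mu (2 * (h n)^-1) (h n)^-1
   + 4 * pick_kernel mu (2 * (h n)^-1) (2 * (h n)^-1)).

Let block_cvg : ccvg block ((m4 - 2) / 4)%:C.
Proof.
pose a n := conjc (alpha n); pose b n := conjc (beta n).
have ca : ccvg a 'i by have := ccvgJ c_alpha; rewrite conjcN conj_i opprK.
have cb : ccvg b 'i by have := ccvgJ c_beta; rewrite conjcN conj_i opprK.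
have ImE (z : C) : z = conjc z + 2 * 'i * (complex.Im z)%:C.
  by case: z => p q; apply: complexP; rewrite /=; ring.
have aE n : alpha n = a n + 2 * 'i * (-1 + (h n)%:C ^+ 2 * (A n)%:C).
  rewrite [LHS]ImE; congr (_ + _ * _).
  have -> : complex.Im (alpha n) = -1 + h n ^+ 2 * A n.
    rewrite /alpha /A Imc_mul Rec_real Imc_real mul0r addr0.
    by field; rewrite gt_eqF.
  by rewrite rmorphD rmorphM rmorphXn rmorphN1.
have bE n : beta n = b n + 2 * 'i * (-1 + ((h n)%:C / 2) ^+ 2 * (B n)%:C).
  rewrite [LHS]ImE; congr (_ + _ * _).
  have -> : complex.Im (beta n) = -1 + (h n / 2) ^+ 2 * B n.
    rewrite /beta /B Imc_mul Rec_real Imc_real mul0r addr0 -/(h2 n).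
    by field; rewrite gt_eqF.
  by rewrite -half_real rmorphD rmorphM rmorphXn rmorphN1.
pose d11 n := alpha n - a n; pose d12 n := alpha n - b n / 2.
pose d21 n := beta n / 2 - a n; pose d22 n := beta n - b n.
pose den (k : C) (d : nat -> C) n := k * 'i - (h n)%:C ^+ 2 * d n.
have -> : block = (fun n => ((A n)%:C - (B n)%:C / 4) / 3
  - (d11 n ^+ 2 / (2 * 'i * den 2 d11 n)
     - 2 * (d12 n ^+ 2 / (3 * 'i * den 3 d12 n))
     - 2 * (d21 n ^+ 2 / (3 * 'i * den 3 d21 n))
     + 4 * (d22 n ^+ 2 / (8 * 'i * den 8 d22 n)))).
  apply/funext => n.
  have hn := hC n.
  rewrite /block /pick_kernel conjdE conjd2E conjFE conjF2E dE d2E FE F2E.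
  rewrite -/(a n) -/(b n) inv_real.
  apply: pick_block_expansion => //.
  - have := pick_den_neq0 mu (s_gt0 n) (s_gt0 n); rewrite conjFE FE -/(a n).
    apply: contra_neq => E; apply: (mulfI hn); rewrite mulr0 -E.
    by field.
  - have := pick_den_neq0 mu (s_gt0 n) (s2_gt0 n); rewrite conjF2E FE -/(b n).
    apply: contra_neq => E; apply: (mulfI hn); rewrite mulr0 -E.
    by field; rewrite ?n2 hn.
  - have := pick_den_neq0 mu (s2_gt0 n) (s_gt0 n); rewrite conjFE F2E -/(a n).
    apply: contra_neq => E; apply: (mulfI hn); rewrite mulr0 -E.
    by field; rewrite ?n2 hn.
  - have := pick_den_neq0 mu (s2_gt0 n) (s2_gt0 n); rewrite conjF2E F2E -/(b n).
    apply: contra_neq => E.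
    apply: (mulfI (mulf_neq0 n2 hn)); rewrite mulr0 -E.
    by field; rewrite ?n2 hn.
pose c : C := (m4 - 1)%:C.
have -> : ((m4 - 2) / 4)%:C = (c - c / 4) / 3
  - ((- 'i - 'i) ^+ 2 / (2 * 'i * (2 * 'i - 0 ^+ 2 * (- 'i - 'i)))
   - 2 * ((- 'i - 'i / 2) ^+ 2 / (3 * 'i * (3 * 'i - 0 ^+ 2 * (- 'i - 'i / 2))))
   - 2 * ((- 'i / 2 - 'i) ^+ 2 / (3 * 'i * (3 * 'i - 0 ^+ 2 * (- 'i / 2 - 'i))))
   + 4 * ((- 'i - 'i) ^+ 2 / (8 * 'i * (8 * 'i - 0 ^+ 2 * (- 'i - 'i))))).
  transitivity ((c - 1) / 4).
    by rewrite /c rmorphM fmorphV rmorph_nat !rmorphB /= !rmorph_nat rmorph1; ring.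
  by field; rewrite i0.
have cX u l : ccvg u l -> ccvg (fun n => u n ^+ 2) (l ^+ 2).
  by move=> ul; rewrite expr2; under eq_fun do rewrite expr2; exact: ccvgM.
have cst z := ccvg_cst (z : C).
have term k d l : k != 0 -> ccvg d l -> ccvg (fun n =>
    d n ^+ 2 / (k * 'i * den k d n)) (l ^+ 2 / (k * 'i * (k * 'i - 0 ^+ 2 * l))).
  move=> k0 dl; apply: ccvgM; first exact: cX.
  apply: ccvgV; first by rewrite expr0n/= mul0r subr0 !mulf_neq0.
  by apply: ccvgM => //; apply: ccvgB => //; apply: ccvgM => //; exact: cX.
have n8 : (8 : C) != 0 by rewrite pnatr_eq0.
have t11 := term 2 d11 _ n2 (ccvgB c_alpha ca).
have t12 := term 3 d12 _ n3 (ccvgB c_alpha (ccvgM cb (cst 2^-1))).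
have t21 := term 3 d21 _ n3 (ccvgB (ccvgM c_beta (cst 2^-1)) ca).
have t22 := term 8 d22 _ n8 (ccvgB c_beta cb).
have tAB := ccvgB (ccvg_real c_A) (ccvgM (ccvg_real c_B) (cst 4^-1)).
exact: ccvgB (ccvgM tAB (cst 3^-1)) (ccvgD (ccvgB (ccvgB t11
  (ccvgM (cst 2) t12)) (ccvgM (cst 2) t21)) (ccvgM (cst 4) t22)).
Qed.

(** Multiply [pick_inequality] by s^4 and let s tend to infinity: the row tends to
    half the residual, the block to a quarter of the free fourth cumulant, and
    the remaining factor is at most 1. *)
Lemma semicircle_equation_error :
  abs2 (1 - defect mu y * F_transform mu (iy y)) <=
  `|\int[mu]_x (x ^+ 4) - 2|.
Proof.
have ineq n : abs2 (row n) <= complex.Re (pick_kernel mu y y) * complex.Re (block n).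
  have := pick_inequality muID y0 (s_gt0 n).
  have sE k : ((h n)^-1%:C : C) ^+ k = ((h n)^-1 ^+ k)%:C by rewrite rmorphXn.
  rewrite /row /block abs2M !sE Rec_mul Imc_real mul0r subr0 Rec_real.
  set P := abs2 (_ - _); set Q := complex.Re (_ + _) => PQ.
  have -> : abs2 ((h n)^-1 ^+ 2)%:C = (h n)^-1 ^+ 4.
    by rewrite /abs2 /=; ring.
  by rewrite mulrCA ler_wpM2l// exprn_ge0// ltW.
have l1 := ccvg_abs2 row_cvg; have [l2 _] := block_cvg.
move: l1 l2 ineq (Re_pick_diag mu y0); rewrite -/e -/v Rec_real.
move: (complex.Re (pick_kernel mu y y)) => k l1 l2 ineq /andP[k0 k1].
have half : (2^-1 : C) = (2^-1 : R)%:C by rewrite inv_real rmorph_nat.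
have aV : abs2 (2^-1 : C) = 4^-1 by rewrite half /abs2 /=; field.
have : abs2 ((1 - e * v) / 2) <= k * ((m4 - 2) / 4).
  exact: (ler_cvg_to l1 (cvgM (cvg_cst k) l2) (nearW _ ineq)).
rewrite abs2M aV mulrA ler_pM2r; last by rewrite invr_gt0.
move=> /le_trans; apply.
apply: (@le_trans _ _ (k * `|m4 - 2|)); first by rewrite ler_wpM2l// ler_norm.
by rewrite ler_piMl.
Qed.

End at_point.

End moment_bound.

(** * The Cauchy transform of the semicircle distribution *)

Section semicircle_transform.
Variable R : realType.
Notation RT := (measurableTypeR R).
Notation leb := (@lebesgue_measure R).
Notation sc := (semicircle R : probability RT R).

Lemma semicircle_dominated : semicircle R `<< leb.
Proof.
apply/null_content_dominatesP => A mA A0; rewrite /semicircle.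
apply/eqP; rewrite eq_le; apply/andP; split; last first.
  by apply: integral_ge0 => x _; rewrite lee_fin semicircle_pdf_ge0.
apply: (@le_trans _ _ (\int[leb]_(x in A) ((2 * pi)^-1 * 2 : R)%:E)%E); last first.
  by rewrite integral_cst// A0 mule0.
apply: ge0_le_integral => //=.
- by move=> x _; rewrite lee_fin semicircle_pdf_ge0.
- apply/measurable_EFinP; apply: measurable_funTS.
  exact: measurable_semicircle_pdf.
- move=> x _; rewrite lee_fin /semicircle_pdf ler_wpM2l//.
    by rewrite invr_ge0 mulr_ge0// pi_ge0.
  have -> : 2 = Num.sqrt (2 ^+ 2) :> R by rewrite sqrtr_sqr ger0_norm.
  by rewrite ler_sqrt ?sqr_ge0//; have := sqr_ge0 x; lra.
Qed.

(** The density is a Radon-Nikodym derivative, which is unique up to a null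
    set. *)
Lemma integral_semicircle (f : R -> R) : sc.-integrable [set: RT] (EFin \o f) ->
  (\int[sc]_x (f x)%:E = \int[leb]_x (f x * semicircle_pdf x)%:E)%E.
Proof.
move=> fi; have dom := semicircle_dominated.
transitivity (\int[leb]_x ((f x)%:E * (semicircle_pdf x)%:E))%E; last first.
  by apply: eq_integral => x _; rewrite EFinM.
rewrite -(Radon_Nikodym_change_of_variables dom)//=.
have mf : measurable_fun [set: RT] (EFin \o f) by exact: measurable_int fi.
have mp : measurable_fun [set: RT] (EFin \o (@semicircle_pdf R)).
  by apply/measurable_EFinP; exact: measurable_semicircle_pdf.
apply: ae_eq_integral => //.
- by apply: emeasurable_funM => //; exact: mf.
- exact: emeasurable_funM mf mp.
- apply: ae_eqe_mul2l => /=.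
  rewrite Radon_NikodymE//=; case: cid => /= h [h1 h2 h3].
  apply: integral_ae_eq => //=.
  by move=> E _ mE; rewrite -h3.
Qed.

Lemma integral_semicircle_itv (f : R -> R) (M : R) :
  continuous f -> (forall x, `|f x| <= M) ->
  (\int[sc]_x (f x)%:E =
   \int[leb]_(x in `[(-2)%R, 2%R]) (f x * semicircle_pdf x)%:E)%E.
Proof.
move=> cf fM; rewrite integral_semicircle; last first.
  by apply: (@bounded_integrable _ _ _ M) => //; exact: continuous_measurable_fun.
rewrite [RHS]integral_mkcond; apply: eq_integral => x _.
rewrite patchE; case: ifPn => // x2.
rewrite semicircle_pdf_eq0 ?mulr0//; apply: contra x2 => x2.
by rewrite inE.
Qed.

Let continuous_2sin : continuous (fun t : R => 2 * sin t).
Proof. by move=> t; apply: cvgM; [exact: cvg_cst|exact: continuous_sin]. Qed.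

Let continuous_f_pdf (f : R -> R) : continuous f ->
  continuous (fun x => f x * semicircle_pdf x).
Proof. by move=> cf x; apply: cvgM; [exact: cf|exact: continuous_semicircle_pdf]. Qed.

(** The change of variables x = 2 sin t. *)
Lemma integral_semicircle_sin (f : R -> R) (M : R) :
  continuous f -> (forall x, `|f x| <= M) ->
  (\int[sc]_x (f x)%:E = \int[leb]_(t in `[(- (pi / 2))%R, (pi / 2)%R])
     (2 / pi * cos t ^+ 2 * f (2 * sin t))%:E)%E.
Proof.
move=> cf fM; rewrite (integral_semicircle_itv cf fM).
have pi0 := @pi_gt0 R.
pose F (t : R) := 2 * sin t : R.
have dF (t : R) : is_derive t (1 : R) F (2 * cos t).
  by apply: is_derive_eq; rewrite /GRing.scale/=; ring.
have F1 : F (- (pi / 2)) = -2 by rewrite /F sinN sin_pihalf mulrN1.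
have F2 : F (pi / 2) = 2 by rewrite /F sin_pihalf mulr1.
have d1F : F^`()%classic = (fun t => 2 * cos t).
  by apply/funext => t; rewrite derive1E; exact: (@derive_val _ _ _ _ _ _ _ (dF t)).
have cdF : continuous F^`()%classic.
  by rewrite d1F => t; apply: cvgM; [exact: cvg_cst|exact: continuous_cos].
rewrite (_ : `[(-2)%R, 2%R]%classic = `[F (- (pi / 2)), F (pi / 2)]%classic);
  last by rewrite F1 F2.
rewrite (@integration_by_substitution_increasing _ F
  (fun x => f x * semicircle_pdf x)); first last.
- exact/continuous_subspaceT/continuous_f_pdf.
- split=> [t _||].
  + exact: (@ex_derive _ _ _ _ _ _ _ (dF t)).
  + exact/cvg_at_right_filter/continuous_2sin.
  + exact/cvg_at_left_filter/continuous_2sin.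
- by apply: cvgP; apply/cvg_at_left_filter/cdF.
- by apply: cvgP; apply/cvg_at_right_filter/cdF.
- by move=> t _; exact: cdF.
- by move=> x y xI yI xy; rewrite /F ltr_pM2l// ltr_sin.
- lra.
apply: eq_integral => t; rewrite inE/= => tI.
rewrite d1F; congr EFin; rewrite /semicircle_pdf/= !fctE /F.
have -> : 4 - (2 * sin t) ^+ 2 = (2 * cos t) ^+ 2.
  by have := cos2Dsin2 t; rewrite !exprMn; lra.
rewrite sqrtr_sqr ger0_norm.
  by move: (@pi R) (lt0r_neq0 pi0) => p pn; field.
by rewrite mulr_ge0// cos_ge0_pihalf//; move: tI; rewrite in_itv.
Qed.

Section at_height.
Variable y : R.
Hypothesis y0 : 0 < y.

Let c := Num.sqrt (y ^+ 2 + 4).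
Let k := c / y.

Let y2_gt0 (x : R) : 0 < x ^+ 2 + y ^+ 2.
Proof. by rewrite ltr_wpDl ?sqr_ge0// exprn_gt0. Qed.

Let c0 : 0 < c. Proof. by rewrite sqrtr_gt0 ltr_wpDl ?sqr_ge0. Qed.

Let c2 : c ^+ 2 = y ^+ 2 + 4.
Proof. by rewrite sqr_sqrtr// addr_ge0 ?sqr_ge0. Qed.

Let k0 : 0 < k. Proof. exact: divr_gt0. Qed.

Let q (t : R) := cos t ^+ 2 + k * sin t ^+ 2.

Let q_gt0 t : 0 < q t.
Proof.
rewrite /q; have := cos2Dsin2 t; have := sqr_ge0 (cos t).
have := sqr_ge0 (sin t); set a := sin t ^+ 2; set b := cos t ^+ 2 => a0 b0 ab.
have [a1|a1] := eqVneq a 0; first by rewrite a1 mulr0; lra.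
have : 0 < k * a by rewrite mulr_gt0// lt_neqAle eq_sym a1.
by lra.
Qed.

(** A determination of arctan (k tan t) that is smooth across the poles of the
    tangent. *)
Let psi (t : R) := t + atan ((k - 1) * (sin t * cos t) * (q t)^-1).

Let is_derive_psi t :
  is_derive t (1 : R) psi (k / (cos t ^+ 2 + k ^+ 2 * sin t ^+ 2)).
Proof.
have dq : is_derive t (1 : R) q (2 * (k - 1) * (sin t * cos t)).
  by rewrite /q; apply: is_derive_eq; rewrite /GRing.scale/=; ring.
have dp : is_derive t (1 : R) (fun t => (k - 1) * (sin t * cos t))
    ((k - 1) * (cos t ^+ 2 - sin t ^+ 2)).
  by apply: is_derive_eq; rewrite /GRing.scale/=; ring.
have qn : q t != 0 by rewrite gt_eqF.
have dV := is_deriveV qn dq.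
have du := is_deriveM dp dV.
have da := is_derive1_comp (is_derive1_atan _) du.
have -> : psi = id + (atan \o ((fun t => (k - 1) * (sin t * cos t)) *
   (fun t => (q t)^-1))) by [].
apply: is_derive_eq; rewrite /GRing.scale /= !fctE.
have cs : cos t ^+ 2 = 1 - sin t ^+ 2 by have := cos2Dsin2 t; lra.
have pq : ((k - 1) * (sin t * cos t)) ^+ 2 + q t ^+ 2 =
    cos t ^+ 2 + k ^+ 2 * sin t ^+ 2.
  rewrite /q; move: (sin t) (cos t) k cs => a b l E.
  transitivity ((l - 1) ^+ 2 * a ^+ 2 * b ^+ 2 + (b ^+ 2 + l * a ^+ 2) ^+ 2).
    by ring.
  by rewrite E; ring.
have pq0 : 0 < ((k - 1) * (sin t * cos t)) ^+ 2 + q t ^+ 2.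
  by rewrite ltr_wpDl ?sqr_ge0// exprn_gt0.
rewrite -pq.
transitivity (1 + ((k - 1) * (cos t ^+ 2 - sin t ^+ 2) * q t
   - (k - 1) * (sin t * cos t) * (2 * (k - 1) * (sin t * cos t))) /
   (((k - 1) * (sin t * cos t)) ^+ 2 + q t ^+ 2)).
  by field; rewrite qn gt_eqF.
have num : ((k - 1) * (cos t ^+ 2 - sin t ^+ 2) * q t
   - (k - 1) * (sin t * cos t) * (2 * (k - 1) * (sin t * cos t))) =
   (k - 1) * (cos t ^+ 2 - k * sin t ^+ 2).
  transitivity ((k - 1) * ((cos t ^+ 2 - sin t ^+ 2) * (cos t ^+ 2 + k * sin t ^+ 2)
    - 2 * (k - 1) * (sin t ^+ 2 * cos t ^+ 2))); first by rewrite /q; ring.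
  by rewrite cs; ring.
rewrite num pq.
have pq1 : cos t ^+ 2 + k ^+ 2 * sin t ^+ 2 != 0 by rewrite -pq gt_eqF.
apply: (mulIf pq1); rewrite mulrDl mul1r !mulfVK//.
by rewrite cs; ring.
Qed.

Lemma semicircle_poisson :
  (\int[sc]_x ((x ^+ 2 + y ^+ 2)^-1)%:E = ((c - y) / (2 * y))%:E)%E.
Proof.
have pi0 := @pi_gt0 R.
have cf : continuous (fun x : R => (x ^+ 2 + y ^+ 2)^-1).
  move=> x; apply: cvgV; first by rewrite gt_eqF.
  by apply: cvgD; [exact: exprn_continuous|exact: cvg_cst].
have fM (x : R) : `|(x ^+ 2 + y ^+ 2)^-1| <= (y ^+ 2)^-1.
  rewrite ger0_norm ?invr_ge0 ?(ltW (y2_gt0 x))//.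
  by rewrite lef_pV2 ?posrE ?exprn_gt0 ?y2_gt0// lerDr sqr_ge0.
rewrite (integral_semicircle_sin cf fM).
pose F (t : R) := (2 / pi) * (- (1 / 4) * t + c / (4 * y) * psi t).
have dF (t : R) : is_derive t (1 : R) F
    (2 / pi * cos t ^+ 2 * ((2 * sin t) ^+ 2 + y ^+ 2)^-1).
  have dpsi := is_derive_psi t.
  rewrite /F; apply: is_derive_eq; rewrite /GRing.scale /=.
  have d0 : (2 * sin t) ^+ 2 + y ^+ 2 != 0 by rewrite gt_eqF.
  have yn : y != 0 by rewrite gt_eqF.
  have cs : cos t ^+ 2 = 1 - sin t ^+ 2 by have := cos2Dsin2 t; lra.
  have -> : k / (cos t ^+ 2 + k ^+ 2 * sin t ^+ 2) =
     c * y / ((2 * sin t) ^+ 2 + y ^+ 2).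
    have -> : (2 * sin t) ^+ 2 + y ^+ 2 = y ^+ 2 * (cos t ^+ 2 + k ^+ 2 * sin t ^+ 2).
      by rewrite /k expr_div_n c2 cs; field.
    have d1 : cos t ^+ 2 + k ^+ 2 * sin t ^+ 2 != 0.
      apply: contra_neq d0 => E.
      transitivity (y ^+ 2 * (cos t ^+ 2 + k ^+ 2 * sin t ^+ 2)); last by rewrite E mulr0.
      by rewrite /k expr_div_n c2 cs; field.
    move: (cos t ^+ 2 + k ^+ 2 * sin t ^+ 2) d1 => d d1.
    by rewrite /k; field; rewrite d1 yn.
  rewrite cs.
  transitivity (2 / pi * (- (1 / 4) + c ^+ 2 / 4 / ((2 * sin t) ^+ 2 + y ^+ 2))).
    by move: (@pi R) (lt0r_neq0 pi0) => p pn; field; rewrite d0 yn pn.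
  by rewrite c2; move: (@pi R) (lt0r_neq0 pi0) => p pn; field; rewrite d0 pn.
have cF t : {for t, continuous F}.
  by apply: differentiable_continuous; apply/derivable1_diffP;
     exact: (@ex_derive _ _ _ _ _ _ _ (dF t)).
rewrite (@continuous_FTC2 _ _ F); first last.
- by move=> t _; rewrite derive1E; exact: (@derive_val _ _ _ _ _ _ _ (dF t)).
- split=> [t _||].
  + exact: (@ex_derive _ _ _ _ _ _ _ (dF t)).
  + exact/cvg_at_right_filter/cF.
  + exact/cvg_at_left_filter/cF.
- apply: continuous_subspaceT => t; apply: cvgM.
    apply: cvgM; first exact: cvg_cst.
    apply: (@continuous_comp _ _ _ cos (fun x : R => x ^+ 2)).
      exact: continuous_cos.
    exact: exprn_continuous.
  by apply: (@continuous_comp _ _ _ (fun t => 2 * sin t) (fun x : R => (x ^+ 2 + y ^+ 2)^-1));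
    [exact: continuous_2sin|exact: cf].
- lra.
rewrite -EFinB; congr EFin.
rewrite /F /psi sinN cosN cos_pihalf !mulr0 !mul0r atan0.
have yn : y != 0 by rewrite gt_eqF.
by move: (@pi R) (lt0r_neq0 pi0) => p pn; field; rewrite yn pn.
Qed.

(** The integrand is odd. *)
Lemma semicircle_conjugate_poisson :
  (\int[sc]_x (x / (x ^+ 2 + y ^+ 2))%:E = 0)%E.
Proof.
have cf : continuous (fun x : R => x / (x ^+ 2 + y ^+ 2)).
  move=> x; apply: cvgM; first exact: cvg_id.
  apply: cvgV; first by rewrite gt_eqF.
  by apply: cvgD; [exact: exprn_continuous|exact: cvg_cst].
have fM (x : R) : `|x / (x ^+ 2 + y ^+ 2)| <= y^-1.
  rewrite normrM normfV (gtr0_norm (y2_gt0 x)) ler_pdivrMr//.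
  rewrite -(ler_pM2l y0) mulrA divff ?gt_eqF// mul1r.
  have := sqr_ge0 (`|x| - y); have := real_normK (num_real x).
  have := sqr_ge0 x; nra.
have cg := continuous_f_pdf cf.
rewrite (integral_semicircle_itv cf fM).
pose g (x : R) := x / (x ^+ 2 + y ^+ 2) * semicircle_pdf x.
have ig : leb.-integrable `[(-2)%R, 2%R] (EFin \o g).
  apply: continuous_compact_integrable; first exact: segment_compact.
  exact: continuous_subspaceT.
rewrite -[LHS]/(\int[leb]_(x in `[(-2)%R, 2%R]) (EFin \o g) x)%E.
set J := (LHS).
have JE : J = (- J)%E.
  have le22 : (-2 : R) <= 2 by lra.
  have := @integration_by_substitution_oppr R g (-2) 2 le22.
  rewrite opprK => /(_ (continuous_subspaceT cg)) E.
  rewrite {1}/J {}E /J -integralN; last exact: integrable_add_def.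
  apply: eq_integral => x _; apply: (congr1 EFin (_ : g (- x) = - g x)).
  by rewrite /g /semicircle_pdf sqrrN !mulNr.
have : J \is a fin_num by exact: integrable_fin_num.
move: JE; case: J => // r [rE] _; congr EFin; lra.
Qed.

End at_height.

End semicircle_transform.

(** * Weak convergence from convergence of Cauchy transforms *)

Section bernstein.
Variable R : realType.

(** [bernstein n phi t] is the expectation of phi at a binomial variable with
    parameters n and t, computed by conditioning on the first trial. *)
Fixpoint bernstein (n : nat) (phi : nat -> R) (t : R) : R :=
  if n is m.+1 then
    t * bernstein m (fun k => phi k.+1) t + (1 - t) * bernstein m phi t
  else phi 0%N.

Lemma bernstein_le n phi psi t : 0 <= t <= 1 -> (forall k, phi k <= psi k) ->
  bernstein n phi t <= bernstein n psi t.
Proof.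
move=> t01; have /andP[t0 t1] := t01.
elim: n phi psi => [|n IH] phi psi le //=.
by rewrite lerD// ler_wpM2l ?subr_ge0// IH.
Qed.

Lemma bernstein_affine n phi (a b t : R) :
  bernstein n (fun k => a + b * phi k) t = a + b * bernstein n phi t.
Proof. by elim: n phi => [|n IH] phi //=; rewrite !IH; ring. Qed.

Lemma bernstein_variance n (c t : R) :
  bernstein n (fun k => (k%:R - c) ^+ 2) t =
  (n%:R * t - c) ^+ 2 + n%:R * t * (1 - t).
Proof.
elim: n c => [|n IH] c /=; first by rewrite !mul0r; ring.
have -> : (fun k => (k.+1%:R - c) ^+ 2) = (fun k => (k%:R - (c - 1)) ^+ 2 : R).
  by apply/funext => k; rewrite -natr1; congr (_ ^+ 2); ring.
by rewrite !IH -natr1; ring.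
Qed.

Lemma uniformly_continuous_itv (h : R -> R) (e : R) : continuous h -> 0 < e ->
  exists2 d, 0 < d & forall t s, 0 <= t <= 1 -> `|s - t| <= d ->
  `|h s - h t| <= e.
Proof.
move=> ch e0.
have := (@compact_near_coveringP _ `[(0 : R), 1]).1 (@segment_compact R 0 1).
move=> /(_ R (0^'+) (fun d t => forall s, `|s - t| <= d -> `|h s - h t| <= e)).
have e20 : 0 < e / 2 by lra.
case=> [/= t _|r /= r0 hr].
- have /cvgrPdist_le/(_ _ e20)[/= r r0 hr] := ch t.
  have r20 : 0 < r / 2 by lra.
  exists (ball t (r / 2), [set d : R | d < r / 2]) => /=.
    split; first exact: nbhsx_ballx.
    exact: nbhs_right_lt.
  move=> [x d] /= [xt dr] s sx.
  have h1 : `|h t - h x| <= e / 2.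
    by apply: hr; rewrite /ball_/=; move: xt; rewrite /ball/=; lra.
  have h2 : `|h t - h s| <= e / 2.
    apply: hr; rewrite /=; move: xt; rewrite /ball/= => xt.
    have -> : t - s = (t - x) - (s - x) by ring.
    by apply: (le_lt_trans (ler_normB _ _)); lra.
  have -> : h s - h x = (h t - h x) - (h t - h s) by ring.
  by apply: (le_trans (ler_normB _ _)); lra.
- exists (r / 2); first by lra.
  move=> t s t01; apply: (hr (r / 2)) => //=.
  + by rewrite sub0r normrN gtr0_norm; lra.
  + by lra.
Qed.

(** The weak law of large numbers for the binomial distribution. *)
Lemma bernstein_approximation (h : R -> R) (M e : R) : continuous h ->
  (forall t, `|h t| <= M) -> 0 < e ->
  exists n phi, forall t, 0 <= t <= 1 -> `|h t - bernstein n phi t| <= e.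
Proof.
move=> ch hM e0; have e20 : 0 < e / 2 by lra.
have [d d0 hd] := uniformly_continuous_itv ch e20.
have M0 : 0 <= M := le_trans (normr_ge0 _) (hM 0).
pose K := 2 * M / d ^+ 2.
have K0 : 0 <= K by apply: divr_ge0; [exact: mulr_ge0|exact: sqr_ge0].
pose n := (Num.truncn (K / (e / 2))).+1.
have nK : K / n%:R <= e / 2.
  rewrite ler_pdivrMr// mulrC -ler_pdivrMr//.
  by apply/ltW; exact: truncnS_gt.
have n0 : n%:R != 0 :> R by rewrite pnatr_eq0.
pose phi (k : nat) := h (k%:R / n%:R).
exists n, phi => t t01; have /andP[t0 t1] := t01.
pose psi (k : nat) := (k%:R - n%:R * t) ^+ 2.
have dev k : `|phi k - h t| <= e / 2 + K / n%:R ^+ 2 * psi k.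
  have pE : K / n%:R ^+ 2 * psi k = K * (k%:R / n%:R - t) ^+ 2.
    by rewrite /psi; field.
  rewrite pE; set s := k%:R / n%:R.
  have [st|st] := leP `|s - t| d.
    apply: (le_trans (hd t s t01 st)).
    by rewrite lerDl; apply: mulr_ge0 => //; exact: sqr_ge0.
  apply: (@le_trans _ _ (2 * M)).
    apply: (le_trans (ler_normB _ _)).
    by have := hM s; have := hM t; rewrite /phi -/s; lra.
  apply: (@le_trans _ _ (K * d ^+ 2)); first by rewrite /K mulfVK// expf_neq0// gt_eqF.
  have : K * d ^+ 2 <= K * (s - t) ^+ 2.
    rewrite ler_wpM2l// -(real_normK (num_real (s - t))).
    by rewrite ler_pXn2r ?nnegrE// ltW.
  by lra.
have var : K / n%:R ^+ 2 * bernstein n psi t <= e / 2.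
  rewrite bernstein_variance subrr expr0n/= add0r.
  apply: le_trans nK.
  have -> : K / n%:R ^+ 2 * (n%:R * t * (1 - t)) = K / n%:R * (t * (1 - t)).
    by field.
  rewrite ler_piMr ?divr_ge0//; nra.
have up : bernstein n phi t <= (h t + e / 2) + K / n%:R ^+ 2 * bernstein n psi t.
  rewrite -bernstein_affine; apply: bernstein_le => // k.
  by have := dev k; have := ler_norm (phi k - h t); lra.
have lo : (h t - e / 2) + (- (K / n%:R ^+ 2)) * bernstein n psi t <= bernstein n phi t.
  rewrite -bernstein_affine; apply: bernstein_le => // k.
  by have := dev k; have := ler_norm (- (phi k - h t)); rewrite normrN; lra.
by rewrite ler_norml; lra.
Qed.

End bernstein.

Section weak_convergence.
Variable R : realType.
Notation RT := (measurableTypeR R).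
Notation prob := (probability RT R).
Variables (mu_ : nat -> prob) (nu : prob).

(** The bounded continuous functions along which convergence holds form a
    uniformly closed vector space. *)
Definition convergent (f : R -> R) :=
  [/\ continuous f, exists M, forall x, `|f x| <= M &
      \int[mu_ n]_x f x @[n --> \oo] --> \int[nu]_x f x].

Let integrable_bc (m : prob) f : continuous f ->
  (exists M, forall x, `|f x| <= M) -> m.-integrable [set: RT] (EFin \o f).
Proof.
move=> cf [M fM]; apply: (@bounded_integrable _ _ _ M) => //.
exact: continuous_measurable_fun.
Qed.

Lemma convergent_cst c : convergent (fun=> c).
Proof.
split; [by move=> x; exact: cvg_cst|by exists (`|c|)|].
under eq_fun do rewrite Rintegral_prob_cst.
by rewrite Rintegral_prob_cst; exact: cvg_cst.
Qed.

Lemma convergentD f g : convergent f -> convergent g ->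
  convergent (fun x => f x + g x).
Proof.
move=> [cf bf If] [cg bg Ig]; split.
- by move=> x; apply: cvgD; [exact: cf|exact: cg].
- have [[M fM] [K gK]] := (bf, bg); exists (M + K) => x.
  exact: le_trans (ler_normD _ _) (lerD (fM x) (gK x)).
- under eq_fun do rewrite RintegralD ?integrable_bc//.
  by rewrite RintegralD ?integrable_bc//; exact: cvgD.
Qed.

Lemma convergentZ c f : convergent f -> convergent (fun x => c * f x).
Proof.
move=> [cf bf If]; split.
- by move=> x; apply: cvgM; [exact: cvg_cst|exact: cf].
- have [M fM] := bf; exists (`|c| * M) => x.
  by rewrite normrM ler_wpM2l.
- under eq_fun do rewrite RintegralZl ?integrable_bc//.
  by rewrite RintegralZl ?integrable_bc//; apply: cvgM => //; exact: cvg_cst.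
Qed.

Lemma convergent_sum (n : nat) (F : 'I_n -> R -> R) :
  (forall i, convergent (F i)) -> convergent (fun x => \sum_(i < n) F i x).
Proof.
elim: n F => [|n IH] F cF.
  by under eq_fun do rewrite big_ord0; exact: convergent_cst.
under eq_fun do rewrite big_ord_recr.
by apply: convergentD => //; exact: IH.
Qed.

Lemma Rintegral_dist (m : prob) (f g t : R -> R) :
  m.-integrable [set: RT] (EFin \o f) -> m.-integrable [set: RT] (EFin \o g) ->
  m.-integrable [set: RT] (EFin \o t) -> (forall x, `|f x - g x| <= t x) ->
  `|\int[m]_x f x - \int[m]_x g x| <= \int[m]_x t x.
Proof.
move=> If Ig It fgt; rewrite -RintegralB//.
have Ifg : m.-integrable [set: RT] (EFin \o (fun x => f x - g x)).
  by under [X in _.-integrable _ X]eq_fun do rewrite /= EFinB; exact: integrableB.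
apply: le_trans (le_normr_Rintegral _ Ifg) _ => //.
by apply: le_Rintegral => //; exact: (integrable_norm Ifg).
Qed.

(** A three-epsilon argument, where the approximation error has to be small only
    in mean. *)
Lemma convergent_approx (f : R -> R) : continuous f ->
  (exists M, forall x, `|f x| <= M) ->
  (forall e, 0 < e -> exists g, convergent g /\
     (`|\int[nu]_x f x - \int[nu]_x g x| <= e /\
      \forall n \near \oo, `|\int[mu_ n]_x f x - \int[mu_ n]_x g x| <= e)) ->
  convergent f.
Proof.
move=> cf bf approx; split => //; apply/cvgrPdist_le => e e0.
have e3 : 0 < e / 3 by lra.
have [g [[_ _ Ig] [nug mug]]] := approx _ e3.
have /cvgrPdist_le/(_ _ e3) gn := Ig.
near=> n.
have h1 : `|\int[mu_ n]_x f x - \int[mu_ n]_x g x| <= e / 3 by near: n.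
have h2 : `|\int[nu]_x g x - \int[mu_ n]_x g x| <= e / 3 by near: n.
move: nug h1 h2; rewrite !ler_norml => /andP[? ?] /andP[? ?] /andP[? ?].
by move=> *; apply/andP; split; lra.
Unshelve. all: by end_near. Qed.

Lemma convergent_uniform (f : R -> R) : continuous f ->
  (exists M, forall x, `|f x| <= M) ->
  (forall e, 0 < e -> exists2 g, convergent g & forall x, `|f x - g x| <= e) ->
  convergent f.
Proof.
move=> cf bf approx; apply: convergent_approx => // e e0.
have [g cg fge] := approx e e0; have [cg' bg _] := cg.
have ie (m : prob) : m.-integrable [set: RT] (EFin \o (fun=> e)).
  by apply: integrable_bc; [move=> x; exact: cvg_cst|exists (`|e|)].
have d (m : prob) : `|\int[m]_x f x - \int[m]_x g x| <= e.
  rewrite -[leRHS](Rintegral_prob_cst m).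
  by apply: Rintegral_dist => //; exact: integrable_bc.
by exists g; split => //; split => //; exact: nearW.
Qed.

Definition lorentz (x : R) : R := (1 + x ^+ 2)^-1.

Notation u := lorentz.

Let den_gt0 (x : R) : 0 < 1 + x ^+ 2.
Proof. by rewrite ltr_pwDl// sqr_ge0. Qed.

Let u_ge0 (x : R) : 0 <= u x. Proof. by rewrite /lorentz invr_ge0 ltW. Qed.

Let u_le1 (x : R) : u x <= 1.
Proof. by rewrite /lorentz invf_le1// lerDl sqr_ge0. Qed.

Let continuous_u : continuous u.
Proof.
move=> x; apply: cvgV; first by rewrite gt_eqF.
by apply: cvgD; [exact: cvg_cst|exact: exprn_continuous].
Qed.

Let continuous_uX k : continuous (fun x => u x ^+ k).
Proof.
move=> x; apply: (@continuous_comp _ _ _ u (fun y : R => y ^+ k)).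
  exact: continuous_u.
exact: exprn_continuous.
Qed.

Section weight.
Variable w : R -> R.
Hypotheses (cw : continuous w) (wu : forall x, `|w x * u x| <= 1).

(** Dividing u / (1 + b u) minus the beginning of its expansion in b by
    (- b)^k, and letting b tend to 0, yields the next power of u. *)
Lemma convergent_pow :
  (forall b, 0 < b -> convergent (fun x => w x * (u x / (1 + b * u x)))) ->
  forall k, convergent (fun x => w x * u x * u x ^+ k).
Proof.
move=> cb; elim/ltn_ind => k IH.
have cwu : continuous (fun x => w x * u x * u x ^+ k).
  move=> x; apply: cvgM; last exact: continuous_uX.
  by apply: cvgM; [exact: cw|exact: continuous_u].
have uk x j : 0 <= u x ^+ j <= 1.
  by rewrite exprn_ge0 ?exprn_ile1 ?u_ge0 ?u_le1.
have bwu x : `|w x * u x * u x ^+ k| <= 1.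
  have /andP[k0 k1] := uk x k.
  by rewrite normrM (ger0_norm k0) mulr_ile1.
apply: convergent_uniform => //; first by exists 1.
move=> b b0.
exists (fun x => (- b) ^- k * (w x * (u x / (1 + b * u x)) +
    (- 1) * \sum_(j < k) (- b) ^+ j * (w x * u x * u x ^+ j))).
  apply: convergentZ; apply: convergentD; first exact: cb.
  apply: convergentZ; apply: convergent_sum => j; apply: convergentZ.
  exact: IH.
move=> x.
have bu0 : 0 <= b * u x by rewrite mulr_ge0 ?u_ge0// ltW.
have bn : (- b) ^+ k != 0 by rewrite expf_neq0// oppr_eq0 gt_eqF.
have d0 : 1 + b * u x != 0 by rewrite gt_eqF//; lra.
have sumE : \sum_(j < k) (- b) ^+ j * (w x * u x * u x ^+ j) =
    w x * u x * ((1 - (- b) ^+ k * u x ^+ k) / (1 + b * u x)).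
  have -> : 1 - (- b) ^+ k * u x ^+ k =
      (1 + b * u x) * \sum_(j < k) (- b * u x) ^+ j.
    rewrite -exprMn -opprB subrX1 -mulNr; congr (_ * _); ring.
  rewrite [(1 + b * u x) * _]mulrC mulfK// mulr_sumr; apply: eq_bigr => j _.
  by rewrite exprMn; ring.
rewrite sumE.
have -> : w x * u x * u x ^+ k - (- b) ^- k * (w x * (u x / (1 + b * u x)) +
     -1 * (w x * u x * ((1 - (- b) ^+ k * u x ^+ k) / (1 + b * u x)))) =
    w x * u x * u x ^+ k * (b * u x / (1 + b * u x)).
  by move: (u x) d0 => z d0; field; rewrite d0 bn.
rewrite normrM -[leRHS]mul1r ler_pM//.
rewrite ger0_norm; last by rewrite divr_ge0//; lra.
rewrite ler_pdivrMr; last by lra.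
have := u_le1 x; nra.
Qed.

End weight.

Section polynomial_weight.
Variable W : R -> R.
Hypothesis cWu : forall k, convergent (fun x => W x * u x ^+ k).

Lemma convergent_bernstein n phi k :
  convergent (fun x => W x * u x ^+ k * bernstein n phi (u x)).
Proof.
elim: n phi k => [|n IH] phi k /=.
  under eq_fun do rewrite mulrC.
  by apply: convergentZ; exact: cWu.
rewrite (_ : (fun x => _) = (fun x =>
   W x * u x ^+ k.+1 * bernstein n (fun k => phi k.+1) (u x) +
   (W x * u x ^+ k * bernstein n phi (u x) +
    (- 1) * (W x * u x ^+ k.+1 * bernstein n phi (u x))))).
  by apply: convergentD => //; apply: convergentD => //; exact: convergentZ.
by apply/funext => x; rewrite [_ ^+ k.+1]exprS; ring.
Qed.

Lemma convergent_comp (h : R -> R) (M : R) : continuous h ->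
  (forall t, `|h t| <= M) -> (forall x, `|W x| <= 1) ->
  convergent (fun x => W x * h (u x)).
Proof.
move=> ch hM W1; have M0 : 0 <= M := le_trans (normr_ge0 _) (hM 0).
have cW : continuous W.
  have [+ _ _] := cWu 0.
  by rewrite (_ : (fun x => _) = W)//; apply/funext => x; rewrite expr0 mulr1.
apply: convergent_uniform.
- move=> x; apply: cvgM; first exact: cW.
  by apply: (@continuous_comp _ _ _ u h); [exact: continuous_u|exact: ch].
- by exists (1 * M) => x; rewrite normrM ler_pM.
move=> e e0; have [n [phi hphi]] := bernstein_approximation ch hM e0.
exists (fun x => W x * u x ^+ 0 * bernstein n phi (u x)).
  exact: convergent_bernstein.
move=> x; rewrite expr0 mulr1 -mulrBr normrM -[leRHS]mul1r ler_pM//.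
by apply: hphi; rewrite u_ge0 u_le1.
Qed.

End polynomial_weight.

Hypotheses
  (cvg_even : forall a, 0 < a -> convergent (fun x => (x ^+ 2 + a)^-1))
  (cvg_odd : forall a, 0 < a -> convergent (fun x => x / (x ^+ 2 + a))).

Let uE (x b : R) : 0 < b -> u x / (1 + b * u x) = (x ^+ 2 + (1 + b))^-1.
Proof.
move=> b0; have d1 := den_gt0 x.
have d2 : 0 < x ^+ 2 + (1 + b) by rewrite ltr_wpDl ?sqr_ge0//; lra.
by rewrite /lorentz; field; rewrite !gt_eqF.
Qed.

Let even_pow k : convergent (fun x => 1 * u x ^+ k).
Proof.
case: k => [|k].
  by under eq_fun do rewrite expr0 mulr1; exact: convergent_cst.
have := @convergent_pow (fun=> 1) _ _ _ k.
rewrite (_ : (fun x => 1 * u x * u x ^+ k) = (fun x => 1 * u x ^+ k.+1)).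
  apply.
  - by move=> x; exact: cvg_cst.
  - by move=> x; rewrite mul1r ger0_norm ?u_ge0 ?u_le1.
  - move=> b b0; under eq_fun do rewrite mul1r uE//.
    by apply: cvg_even; lra.
by apply/funext => x; rewrite [_ ^+ k.+1]exprS !mul1r.
Qed.

Let xu_le1 (x : R) : `|x * u x| <= 1.
Proof.
rewrite normrM (ger0_norm (u_ge0 x)) /lorentz ler_pdivrMr// mul1r.
have := sqr_ge0 (`|x| - 1); rewrite -(real_normK (num_real x)).
by have := normr_ge0 x; nra.
Qed.

Let odd_pow k : convergent (fun x => x * u x * u x ^+ k).
Proof.
apply: (@convergent_pow (fun x => x)) => // [x|b b0]; first exact: cvg_id.
under eq_fun do rewrite uE//.
by apply: cvg_odd; lra.
Qed.

Lemma continuous_max_cst (a : R) : continuous (fun x : R => Num.max x a).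
Proof.
have -> : (fun x : R => Num.max x a) = (fun x => (x + a + `|x - a|) / 2).
  by apply/funext => x; rewrite maxr_absE.
move=> x; apply: cvgM; last exact: cvg_cst.
apply: cvgD; first by apply: cvgD; [exact: cvg_id|exact: cvg_cst].
apply: cvg_norm; apply: cvgB; [exact: cvg_id|exact: cvg_cst].
Qed.

Section compact_support.
Variables (g : R -> R) (M L : R).
Hypotheses (cg : continuous g) (gM : forall x, `|g x| <= M) (L0 : 0 < L)
  (gL : forall x, L <= `|x| -> g x = 0).

(* the value of u at L: below it, functions of u are constant *)
Let t0 := (1 + L ^+ 2)^-1.

(** Inverse of |x| |-> u x on [0, L], extended by constants. *)
Let root (t : R) := Num.sqrt ((Num.max t t0)^-1 - 1).

Let t0_gt0 : 0 < t0. Proof. by rewrite invr_gt0. Qed.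

Let max_gt0 (t : R) : 0 < Num.max t t0.
Proof. by rewrite lt_max t0_gt0 orbT. Qed.

Let continuous_root : continuous root.
Proof.
move=> t; apply: (@continuous_comp _ _ _ (fun t => (Num.max t t0)^-1 - 1) Num.sqrt); last first.
  exact: sqrt_continuous.
apply: cvgB; last exact: cvg_cst.
by apply: cvgV; [rewrite gt_eqF|exact: continuous_max_cst].
Qed.

Let root_u_in (x : R) : `|x| <= L -> root (u x) = `|x| /\ Num.max (u x) t0 = u x.
Proof.
move=> xL.
have m : Num.max (u x) t0 = u x.
  apply/max_idPl; rewrite /lorentz lef_pV2 ?posrE// lerD2l -(real_normK (num_real x)).
  by rewrite ler_pXn2r ?nnegrE// ltW.
by rewrite /root m /lorentz invrK addrAC subrr add0r sqrtr_sqr.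
Qed.

Let root_u_out (x : R) : L <= `|x| -> root (u x) = L.
Proof.
move=> xL; rewrite /root (_ : Num.max _ _ = t0).
  by rewrite invrK addrAC subrr add0r sqrtr_sqr gtr0_norm.
apply/max_idPr; rewrite /lorentz lef_pV2 ?posrE// lerD2l -(real_normK (num_real x)).
by rewrite ler_pXn2r ?nnegrE// ltW.
Qed.

Let E (x : R) := (g x + g (- x)) / 2.
Let O (x : R) := (g x - g (- x)) / 2.

Let continuous_gN : continuous (fun x => g (- x)).
Proof.
move=> x; apply: (@continuous_comp _ _ _ -%R g); last exact: cg.
exact: opp_continuous.
Qed.

Let cE : continuous E.
Proof.
move=> x; apply: cvgM; last exact: cvg_cst.
by apply: cvgD; [exact: cg|exact: continuous_gN].
Qed.

Let cO : continuous O.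
Proof.
move=> x; apply: cvgM; last exact: cvg_cst.
by apply: cvgB; [exact: cg|exact: continuous_gN].
Qed.

Let EM x : `|E x| <= M.
Proof.
rewrite /E normrM normfV (ger0_norm (ler0n _ 2)) ler_pdivrMr//.
apply: (le_trans (ler_normD _ _)); have := gM x; have := gM (- x); lra.
Qed.

Let OM x : `|O x| <= M.
Proof.
rewrite /O normrM normfV (ger0_norm (ler0n _ 2)) ler_pdivrMr//.
apply: (le_trans (ler_normB _ _)); have := gM x; have := gM (- x); lra.
Qed.

Let EL x : L <= `|x| -> E x = 0.
Proof. by move=> xL; rewrite /E !gL ?normrN// addr0 mul0r. Qed.

Let OL x : L <= `|x| -> O x = 0.
Proof. by move=> xL; rewrite /O !gL ?normrN// subrr mul0r. Qed.

Let ON x : O (- x) = - O x.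
Proof. by rewrite /O opprK -mulNr opprB. Qed.

Let E_norm x : E `|x| = E x.
Proof.
have [x0|x0] := leP 0 x; first by rewrite ger0_norm.
by rewrite ltr0_norm// /E opprK addrC.
Qed.

Let L_norm : L <= `|L|. Proof. exact: ler_norm. Qed.

Let convergent_even : convergent E.
Proof.
have := @convergent_comp (fun=> 1) even_pow (E \o root) M.
rewrite (_ : (fun x => 1 * (E \o root) (u x)) = E).
  apply.
  - move=> t; apply: (@continuous_comp _ _ _ root E); last exact: cE.
    exact: continuous_root.
  - by move=> t; exact: EM.
  - by move=> x; rewrite normr1.
apply/funext => x; rewrite mul1r /=.
have [xL|/ltW xL] := leP `|x| L; first by rewrite (root_u_in xL).1 E_norm.
by rewrite root_u_out// !EL.
Qed.

(** The odd part is divided by x u x, after an average near 0 that keeps the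
    quotient continuous. *)
Let convergent_odd : convergent O.
Proof.
apply: convergent_uniform => //; first by exists M.
move=> e e0; have M0 : 0 <= M := le_trans (normr_ge0 _) (gM 0).
have O0 : O 0 = 0 by rewrite /O oppr0 subrr mul0r.
have e20 : 0 < e / 2 by lra.
have [r r0 Or] : exists2 r, 0 < r & forall x, `|x| < r -> `|O x| <= e / 2.
  have /cvgrPdist_le/(_ _ e20)[/= r r0 hr] := @cO 0.
  exists r => // x xr; have := hr x.
  by rewrite /= O0 !sub0r !normrN; exact.
pose k (t : R) := O (root t) / (Num.max (root t) r * Num.max t t0).
have den t : 0 < Num.max (root t) r * Num.max t t0.
  by rewrite mulr_gt0// lt_max r0 orbT.
exists (fun x => x * u x * k (u x)).
  apply: (@convergent_comp _ odd_pow k (M / (r * t0))) => //.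
  - move=> t; apply: cvgM.
      by apply: (@continuous_comp _ _ _ root O); [exact: continuous_root|exact: cO].
    apply: cvgV; first by rewrite gt_eqF.
    apply: cvgM; last exact: continuous_max_cst.
    apply: (@continuous_comp _ _ _ root (fun s => Num.max s r)).
      exact: continuous_root.
    exact: continuous_max_cst.
  - move=> t; rewrite normrM normfV (gtr0_norm (den t)) ler_pM ?invr_ge0 ?(ltW (den t))//.
    rewrite lef_pV2 ?posrE ?den ?mulr_gt0//.
    by rewrite ler_pM ?(ltW r0) ?(ltW t0_gt0)// le_max lexx orbT.
move=> x; have [xL|/ltW xL] := leP `|x| L; last first.
  by rewrite /k root_u_out// (OL xL) (OL L_norm) mul0r mulr0 subrr normr0 ltW.
have [rE mE] := root_u_in xL.
have un : u x != 0 by rewrite /lorentz invr_eq0 gt_eqF.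
have mn : Num.max `|x| r != 0 by rewrite gt_eqF// lt_max r0 orbT.
have -> : x * u x * k (u x) = x * O `|x| / Num.max `|x| r.
  by rewrite /k rE mE; move: (u x) un => z un; field; rewrite un mn.
have xO : x * O `|x| = `|x| * O x.
  have [x0|x0] := leP 0 x; first by rewrite ger0_norm.
  by rewrite ltr0_norm// ON mulrN mulNr.
rewrite xO; have [rx|xr] := leP r `|x|.
  have x0 : `|x| != 0 by rewrite gt_eqF//; lra.
  by rewrite mulrAC divff// mul1r subrr normr0 ltW.
have -> : O x - `|x| * O x / r = O x * (1 - `|x| / r) by field; rewrite gt_eqF.
rewrite normrM; apply: (@le_trans _ _ (e / 2 * 1)); last by lra.
apply: ler_pM => //; first exact: Or.
have xr0 : 0 <= `|x| / r by rewrite divr_ge0// ltW.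
have xr1 : `|x| / r <= 1 by rewrite ler_pdivrMr// mul1r ltW.
by rewrite ger0_norm; lra.
Qed.

Lemma convergent_compact_support : convergent g.
Proof.
have -> : g = (fun x => E x + O x).
  by apply/funext => x; rewrite /E /O; field.
exact: convergentD.
Qed.

End compact_support.

Hypothesis tight : forall e, 0 < e -> exists2 K, 0 < K &
  \forall n \near \oo, tail (mu_ n) K <= e.

Lemma weak_convergence (f : R -> R) (M : R) : continuous f ->
  (forall x, `|f x| <= M) -> convergent f.
Proof.
move=> cf fM; have M0 : 0 <= M := le_trans (normr_ge0 _) (fM 0).
have bf : exists M, forall x, `|f x| <= M by exists M.
apply: convergent_approx => // e e0.
pose d := e / (M + 1).
have d0 : 0 < d by rewrite divr_gt0//; lra.
have Md : M * d <= e by rewrite /d mulrA ler_pdivrMr; [nra|lra].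
have [K1 K10 t1] := tight d0; have [K2 K20 t2] := tail_small nu d0.
pose K := Num.max K1 K2.
have K0 : 0 < K by rewrite lt_max K10.
have K1K : K1 <= K by rewrite le_max lexx.
have K2K : K2 <= K by rewrite le_max lexx orbT.
(* a cutoff equal to 1 on [-K, K] and to 0 outside [-2 K, 2 K] *)
pose chi (x : R) := Num.max (1 - Num.max (`|x| / K - 1) 0) 0.
have cchi : continuous chi.
  move=> x; apply: (@continuous_comp _ _ _ (fun x => 1 - Num.max (`|x| / K - 1) 0)
    (fun s => Num.max s 0)); last exact: continuous_max_cst.
  apply: cvgB; first exact: cvg_cst.
  apply: (@continuous_comp _ _ _ (fun x => `|x| / K - 1) (fun s => Num.max s 0));
    last exact: continuous_max_cst.
  apply: cvgB; last exact: cvg_cst.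
  by apply: cvgM; [exact: norm_continuous|exact: cvg_cst].
have chi0 x : 0 <= chi x by rewrite le_max lexx orbT.
have chi1 x : chi x <= 1.
  by rewrite ge_max ler01 andbT gerBl le_max lexx orbT.
have chiK x : 1 - chi x <= Num.min (`|x| / K) 1.
  rewrite le_min gerBl chi0 andbT lerBlDr -lerBlDl le_max.
  have [xK|xK] := leP (`|x| / K) 1.
    apply/orP; left; rewrite (_ : Num.max _ _ = 0).
      by rewrite subr0 gerBl divr_ge0// ltW.
    by apply/max_idPr; lra.
  by apply/orP; right; lra.
pose g x := f x * chi x.
have cg : continuous g by move=> x; apply: cvgM; [exact: cf|exact: cchi].
have gM x : `|g x| <= M.
  by rewrite normrM -[leRHS]mulr1 ler_pM// ger0_norm.
have convg : convergent g.
  apply: (@convergent_compact_support g M (2 * K)) => //; first by lra.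
  move=> x xK; rewrite /g /chi (_ : Num.max _ 0 = 0) ?mulr0//.
  apply/max_idPr; rewrite subr_le0 le_max; apply/orP; left.
  by rewrite lerBrDr ler_pdivlMr.
have dist (m : prob) : `|\int[m]_x f x - \int[m]_x g x| <= M * tail m K.
  have it := integrable_min_tail m K0.
  rewrite /tail -RintegralZl//; apply: Rintegral_dist.
  - exact: integrable_bc.
  - by apply: integrable_bc => //; exists M.
  - by under [X in _.-integrable _ X]eq_fun do rewrite /= EFinM; exact: integrableZl.
  move=> x; have -> : f x - g x = f x * (1 - chi x) by rewrite /g; ring.
  by rewrite normrM ler_pM// ger0_norm// subr_ge0.
exists g; split => //; split.
  apply: (le_trans (dist nu)); apply: le_trans Md; rewrite ler_wpM2l//.
  by apply: le_trans t2; exact: tail_le.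
near=> n.
have tn : tail (mu_ n) K1 <= d by near: n.
apply: (le_trans (dist _)); apply: le_trans Md; rewrite ler_wpM2l//.
by apply: le_trans tn; exact: tail_le.
Unshelve. all: by end_near. Qed.

End weak_convergence.

(** * The limit theorem *)

Section limit.
Variable R : realType.
Notation C := R[i].
Notation RT := (measurableTypeR R).
Notation prob := (probability RT R).

Lemma ccvg_abs2_0 (u : nat -> C) (l : C) :
  abs2 (u n - l) @[n --> \oo] --> (0 : R) -> ccvg u l.
Proof.
move=> ul.
have nl : normc (u n - l) @[n --> \oo] --> (0 : R).
  rewrite -(@sqrtr0 R).
  rewrite (_ : (fun n => _) = (fun n => Num.sqrt (abs2 (u n - l)))).
    by apply: continuous_cvg => //; exact: sqrt_continuous.
  by apply/funext => n; rewrite -normcE2 sqrtr_sqr ger0_norm// normc_ge0.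
split; apply/cvgrPdist_le => e e0; have /cvgrPdist_le/(_ e e0) h := nl.
- apply: filterS h => n; rewrite sub0r normrN ger0_norm ?normc_ge0//.
  by apply: le_trans; rewrite distrC -Rec_opp -Rec_add; exact: normc_Re.
- apply: filterS h => n; rewrite sub0r normrN ger0_norm ?normc_ge0//.
  by apply: le_trans; rewrite distrC -Imc_opp -Imc_add; exact: normc_Im.
Qed.

(** The quadratic v (i y - v) = 1 has exactly one root in the upper half-plane;
    the other root stays at distance at least y from v, so a small residual
    forces v to be close to the first one. *)
Lemma quadratic_root_cvg (v : nat -> C) (y : R) : 0 < y ->
  (forall n, y <= complex.Im (v n)) ->
  abs2 (1 - (iy y - v n) * v n) @[n --> \oo] --> (0 : R) ->
  ccvg v (iy ((y + Num.sqrt (y ^+ 2 + 4)) / 2)).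
Proof.
move=> y0 vy res; apply: ccvg_abs2_0.
set c := Num.sqrt _; set r := (y + c) / 2; pose s := (c - y) / 2.
have c2 : c ^+ 2 = y ^+ 2 + 4 by rewrite sqr_sqrtr// addr_ge0 ?sqr_ge0.
have yc : y <= c.
  rewrite -(@ler_pXn2r _ 2) ?nnegrE ?sqrtr_ge0 ?(ltW y0)// c2.
  by rewrite lerDl.
have fac n : 1 - (iy y - v n) * v n = (v n - iy r) * (v n + iy s).
  case: (v n) => a b; apply: complexP; rewrite /=.
    have -> : 1 = r * s by rewrite /r /s; lra.
    by rewrite /r /s; field.
  by rewrite /r /s; field.
have low n : y ^+ 2 <= abs2 (v n + iy s).
  rewrite /abs2; apply: (@le_trans _ _ (complex.Im (v n + iy s) ^+ 2)).
    rewrite ler_pXn2r ?nnegrE ?(ltW y0)//; rewrite Imc_add /=; have := vy n.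
      by rewrite /s; lra.
    by rewrite /s; lra.
  by rewrite lerDr sqr_ge0.
apply: (@squeeze_cvgr _ _ _ _ (fun=> 0)
    (fun n => abs2 (1 - (iy y - v n) * v n) / y ^+ 2)).
- apply: nearW => n; rewrite abs2_ge0/= fac abs2M ler_pdivlMr ?exprn_gt0//.
  by rewrite ler_wpM2l ?abs2_ge0.
- exact: cvg_cst.
- by rewrite -(mul0r (y ^+ 2)^-1); apply: cvgM => //; exact: cvg_cst.
Qed.

Variable mu : nat -> prob.
Hypotheses (mean0 : forall n, (0 < n)%N -> ('E_(mu n)[fun x => x] = 0)%E)
  (variance1 : forall n, (0 < n)%N -> ('V_(mu n)[fun x => x] = 1)%E)
  (muID : forall n, (0 < n)%N -> free_infinitely_divisible (mu n))
  (moment4 : (\int[mu n]_x (x ^+ 4)%:E)%E @[n --> \oo] --> (2%:E : \bar R)).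

Let m4 n := \int[mu n]_x (x ^+ 4).

Let m4_cvg : m4 n @[n --> \oo] --> (2 : R).
Proof. by have /fine_cvgP[] := moment4. Qed.

Let int4 : \forall n \near \oo, (0 < n)%N /\
  (mu n).-integrable [set: RT] (EFin \o (fun x : R => x ^+ 4)).
Proof.
have /fine_cvgP[fin _] := moment4.
near=> n; split; first by near: n; exact: nbhs_infty_gt.
apply/integrableP; split.
  by apply/measurable_EFinP; apply: continuous_measurable_fun; exact: exprn_continuous.
under eq_integral => x _.
  rewrite gee0_abs; last by rewrite lee_fin (exprM x 2 2) sqr_ge0.
  over.
by rewrite ltey_eq; apply/orP; left; near: n.
Unshelve. all: by end_near. Qed.

Let mean_var n : (0 < n)%N ->
  \int[mu n]_x x = 0 /\ \int[mu n]_x (x ^+ 2) = 1.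
Proof.
move=> n0; have E := mean0 n0; have V := variance1 n0; split.
  by move: E; rewrite unlock => E; rewrite /Rintegral E.
move: V; rewrite /variance unlock E/= unlock => V.
rewrite -[RHS]/(fine 1%E) -V; congr fine; apply: eq_integral => x _.
by rewrite -[(_ * _) x]/((x - 0) * (x - 0)) subr0 expr2.
Qed.

Let residual y : 0 < y ->
  abs2 (1 - (iy y - F_transform (mu n) (iy y)) * F_transform (mu n) (iy y))
  @[n --> \oo] --> (0 : R).
Proof.
move=> y0; apply: (@squeeze_cvgr _ _ _ _ (fun=> 0) (fun n => `|m4 n - 2|)).
- near=> n; rewrite abs2_ge0/=.
  have [n0 i4] : (0 < n)%N /\
     (mu n).-integrable [set: RT] (EFin \o (fun x : R => x ^+ 4)) by near: n.
  have [m0 v1] := mean_var n0.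
  exact: (semicircle_equation_error i4 m0 v1 (muID n0) y0).
- exact: cvg_cst.
- rewrite -(@normr0 _ R) -(subrr (2 : R)); apply: cvg_norm.
  by apply: cvgB => //; exact: cvg_cst.
Unshelve. all: by end_near. Qed.

Lemma cauchy_transform_cvg y : 0 < y ->
  ccvg (fun n => cauchy_transform (mu n) (iy y))
    (0 -i* ((Num.sqrt (y ^+ 2 + 4) - y) / 2)).
Proof.
move=> y0; set c := Num.sqrt _.
have c2 : c ^+ 2 = y ^+ 2 + 4 by rewrite sqr_sqrtr// addr_ge0 ?sqr_ge0.
have c0 : 0 <= c by exact: sqrtr_ge0.
pose r := (y + c) / 2.
have r0 : 0 < r by rewrite /r; lra.
have E : 0 -i* ((c - y) / 2) = (iy r)^-1.
  apply: complexP; rewrite ?Rec_inv ?Imc_inv /abs2 /= ?mul0r//.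
  rewrite expr0n/= add0r expr2 invfM mulNr mulrA divff ?gt_eqF// mul1r.
  congr (- _); apply: (mulIf (lt0r_neq0 r0)).
  by rewrite mulVf ?gt_eqF// /r; lra.
rewrite E.
rewrite (_ : (fun n => _) = (fun n => (F_transform (mu n) (iy y))^-1)); last first.
  by apply/funext => n; rewrite /F_transform invrK.
apply: ccvgV; first exact: Im_gt0_neq0.
apply: quadratic_root_cvg => //; last exact: residual.
by move=> n; exact: Im_F_iy.
Qed.

Let cauchy_iyE (m : prob) y : 0 < y -> cauchy_transform m (iy y) =
  (- \int[m]_x (x / (x ^+ 2 + y ^+ 2))) -i*
  (y * \int[m]_x (x ^+ 2 + y ^+ 2)^-1).
Proof.
move=> y0; have y20 (x : R) : 0 < x ^+ 2 + y ^+ 2.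
  by rewrite ltr_wpDl ?sqr_ge0// exprn_gt0.
have cV : continuous (fun x : R => (x ^+ 2 + y ^+ 2)^-1).
  move=> x; apply: cvgV; first by rewrite gt_eqF.
  by apply: cvgD; [exact: exprn_continuous|exact: cvg_cst].
have bres := @bounded_mfun_resolvent _ (iy y) y0.
have ReE : (fun x => complex.Re (resolvent (iy y) x)) =
    (fun x => - (x / (x ^+ 2 + y ^+ 2))).
  apply/funext => x; rewrite Rec_inv /abs2 Re_subC Im_subC /= sub0r sqrrN.
  by rewrite mulNr.
have ImE : (fun x => complex.Im (resolvent (iy y) x)) =
    (fun x => - y * (x ^+ 2 + y ^+ 2)^-1).
  by apply/funext => x; rewrite Imc_inv /abs2 Re_subC Im_subC /= sub0r sqrrN.
apply: complexP.
- transitivity (\int[m]_x (- (x / (x ^+ 2 + y ^+ 2)))); first by rewrite -ReE.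
  rewrite [RHS]/= -[RHS]mulN1r -RintegralZl//.
    by apply: eq_Rintegral => x _; rewrite mulN1r.
  have := integrableN (bounded_mfun_Re m bres); rewrite ReE.
  by congr integrable; apply/funext => x /=; rewrite opprK.
- transitivity (\int[m]_x (- y * (x ^+ 2 + y ^+ 2)^-1)); first by rewrite -ImE.
  rewrite [RHS]/= -mulNr -RintegralZl//.
  apply: (@bounded_integrable _ _ _ (y ^+ 2)^-1).
    exact: continuous_measurable_fun.
  move=> x; rewrite ger0_norm ?invr_ge0 ?(ltW (y20 x))//.
  by rewrite lef_pV2 ?posrE ?exprn_gt0 ?y20// lerDr sqr_ge0.
Qed.

Let continuous_even (a : R) : 0 < a -> continuous (fun x : R => (x ^+ 2 + a)^-1).
Proof.
move=> a0 x; apply: cvgV; first by rewrite gt_eqF// ltr_wpDl ?sqr_ge0.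
by apply: cvgD; [exact: exprn_continuous|exact: cvg_cst].
Qed.

Let even_cvg (a : R) : 0 < a ->
  convergent mu (semicircle R) (fun x => (x ^+ 2 + a)^-1).
Proof.
move=> a0; have y0 : 0 < Num.sqrt a by rewrite sqrtr_gt0.
have aE : a = Num.sqrt a ^+ 2 by rewrite sqr_sqrtr// ltW.
move: (Num.sqrt a) y0 aE => y y0 aE; rewrite {a}aE in a0 *.
have yn : y != 0 by rewrite gt_eqF.
split; first exact: continuous_even.
  exists (y ^+ 2)^-1 => x.
  have d0 : 0 < x ^+ 2 + y ^+ 2 by rewrite ltr_wpDl ?sqr_ge0.
  rewrite ger0_norm ?invr_ge0 ?(ltW d0)//.
  by rewrite lef_pV2 ?posrE// lerDr sqr_ge0.
have -> : \int[semicircle R]_x (x ^+ 2 + y ^+ 2)^-1 =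
    - y^-1 * - ((Num.sqrt (y ^+ 2 + 4) - y) / 2).
  by rewrite /Rintegral semicircle_poisson//=; field.
have [_ h] := cauchy_transform_cvg y0.
rewrite (_ : (fun n => _) =
    (fun n => - y^-1 * complex.Im (cauchy_transform (mu n) (iy y)))).
  by apply: cvgM; [exact: cvg_cst|exact: h].
by apply/funext => n; rewrite cauchy_iyE// [complex.Im _]/=; field.
Qed.

Let odd_cvg (a : R) : 0 < a ->
  convergent mu (semicircle R) (fun x => x / (x ^+ 2 + a)).
Proof.
move=> a0; have y0 : 0 < Num.sqrt a by rewrite sqrtr_gt0.
have aE : a = Num.sqrt a ^+ 2 by rewrite sqr_sqrtr// ltW.
move: (Num.sqrt a) y0 aE => y y0 aE; rewrite {a}aE in a0 *.
split.
- by move=> x; apply: cvgM; [exact: cvg_id|exact: continuous_even].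
- exists y^-1 => x; have d0 : 0 < x ^+ 2 + y ^+ 2 by rewrite ltr_wpDl ?sqr_ge0.
  rewrite normrM normfV (gtr0_norm d0) ler_pdivrMr//.
  rewrite -(ler_pM2l y0) mulrA divff ?gt_eqF// mul1r.
  have := sqr_ge0 (`|x| - y); have := real_normK (num_real x).
  have := sqr_ge0 x; nra.
have -> : \int[semicircle R]_x (x / (x ^+ 2 + y ^+ 2)) = - 0.
  by rewrite oppr0 /Rintegral semicircle_conjugate_poisson.
have [h _] := cauchy_transform_cvg y0.
rewrite (_ : (fun n => _) =
    (fun n => - complex.Re (cauchy_transform (mu n) (iy y)))).
  by apply: cvgN; exact: h.
by apply/funext => n; rewrite cauchy_iyE// [complex.Re _]/= opprK.
Qed.

(** Chebyshev: |x| / K <= (1 + x^2) / (2 K). *)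
Let tight (e : R) : 0 < e -> exists2 K, 0 < K &
  \forall n \near \oo, tail (mu n) K <= e.
Proof.
move=> e0; exists e^-1; first by rewrite invr_gt0.
near=> n.
have [n0 i4] : (0 < n)%N /\
  (mu n).-integrable [set: RT] (EFin \o (fun x : R => x ^+ 4)) by near: n.
have [_ v1] := mean_var n0.
have i1 : (mu n).-integrable [set: RT] (EFin \o (fun=> 1 : R)).
  by apply: (@bounded_integrable _ _ _ 1) => // x; rewrite normr1.
have i2 : (mu n).-integrable [set: RT] (EFin \o (fun x : R => x ^+ 2)).
  have : (mu n).-integrable [set: RT] (EFin \o (fun x : R => 1 + x ^+ 4)).
    by under [X in _.-integrable _ X]eq_fun do rewrite /= EFinD; exact: integrableD.
  apply: le_integrable => //.
    by apply/measurable_EFinP; apply: continuous_measurable_fun; exact: exprn_continuous.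
  move=> x _ /=; rewrite lee_fin ger0_norm ?sqr_ge0//.
  apply: le_trans (ler_norm _).
  have := sqr_ge0 (x ^+ 2 - 1); rewrite (_ : x ^+ 4 = (x ^+ 2) ^+ 2) -?exprM//.
  by have := sqr_ge0 (x ^+ 2); nra.
have i12 : (mu n).-integrable [set: RT] (EFin \o (fun x : R => 1 + x ^+ 2)).
  by under [X in _.-integrable _ X]eq_fun do rewrite /= EFinD; exact: integrableD.
apply: (@le_trans _ _ (\int[mu n]_x (e / 2 * (1 + x ^+ 2)))).
  apply: le_Rintegral => //.
  - by apply: integrable_min_tail; rewrite invr_gt0.
  - by under [X in _.-integrable _ X]eq_fun do rewrite /= EFinM; exact: integrableZl.
  move=> x _; rewrite ge_min; apply/orP; left; rewrite invrK -(real_normK (num_real x)).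
  by have := sqr_ge0 (`|x| - 1); nra.
rewrite RintegralZl// RintegralD// v1 Rintegral_prob_cst; lra.
Unshelve. all: by end_near. Qed.

Lemma semicircle_limit : cvg_weakly mu (semicircle R : prob).
Proof.
move=> f cf [M [Mr fM]].
have bf x : `|f x| <= M + 1 by apply: (fM (M + 1)) => //; rewrite ltrDl.
by have [] := weak_convergence even_cvg odd_cvg tight cf bf.
Qed.

End limit.

Theorem theorem1p4 (R : realType)
    (mu : nat -> probability (measurableTypeR R) R)
    (mean0 : forall n, (0 < n)%N -> ('E_(mu n)[fun x => x] = 0)%E)
    (variance1 : forall n, (0 < n)%N -> ('V_(mu n)[fun x => x] = 1)%E)
    (muID : forall n, (0 < n)%N -> free_infinitely_divisible (mu n))
    (moment4 : (\int[mu n]_x (x ^+ 4)%:E)%E @[n --> \oo] --> (2%:E : \bar R)) :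
  cvg_weakly mu (semicircle R : probability (measurableTypeR R) R).
Proof. exact: semicircle_limit. Qed.
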